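(* Let $\Omega\subset\mathbb{R}^2$ be a bounded open convex set containing the origin in its interior, and suppose $$\sup_{\theta\in S^1}\sup_{\delta>0}\delta^{-1/2}\mu(\theta,\delta)<\infty.$$ Then there is a constant $C_\Omega$ such that for all $R\ge2$ and all $h$ with $1\le h\le R$, $$\mathcal{G}_\Omega(R,h)\le C_\Omega (R\log R)^{1/2}.$$
   Context: For $t>0$ let $\mathcal{N}_\Omega(t)=\mathrm{card}(t\Omega\cap\mathbb{Z}^2)$, $E_\Omega(t)=\mathcal{N}_\Omega(t)-t^2\,\mathrm{area}(\Omega)$, and $\mathcal{G}_\Omega(R,h)=\big(\frac1h\int_R^{R+h}|E_\Omega(t)|^2dt\big)^{1/2}$. Let $\rho^*(\xi)=\sup\{\langle x,\xi\rangle:x\in\Omega\}$ for $\xi\in\mathbb{R}^2$. For $\theta\in S^1$ and $\delta>0$ let $\mathcal{C}(\theta,\delta)=\{x\in\partial\Omega:\langle x,\theta\rangle=\rho^*(\theta)-\delta\}$ and $\mu(\theta,\delta)=\mathrm{diam}(\mathcal{C}(\theta,\delta))$ (with $\mathrm{diam}(\emptyset)=0$). *)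

(* Defs.v *)
From HB Require Import structures.
From mathcomp Require Import all_boot all_order all_algebra.
From mathcomp Require Import finmap.
From mathcomp Require Import all_classical all_reals all_analysis.
Set Implicit Arguments. Unset Strict Implicit. Unset Printing Implicit Defensive.
Import Order.TTheory GRing.Theory Num.Theory.
Import numFieldNormedType.Exports.
Local Open Scope classical_set_scope.
Local Open Scope ring_scope.

Section Defs.
Variable R : realType.

Definition dot2 (x y : R * R) : R := x.1 * y.1 + x.2 * y.2.
Definition dist2 (x y : R * R) : R :=
  Num.sqrt ((x.1 - y.1) ^+ 2 + (x.2 - y.2) ^+ 2).
Definition on_S1 (th : R * R) : Prop := th.1 ^+ 2 + th.2 ^+ 2 = 1.

Definition convex2 (O : set (R * R)) : Prop :=
  forall x y (l : R), O x -> O y -> 0 <= l <= 1 ->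
    O ((1 - l) * x.1 + l * y.1, (1 - l) * x.2 + l * y.2).
Definition bounded2 (O : set (R * R)) : Prop :=
  exists M : R, forall x, O x -> `|x.1| <= M /\ `|x.2| <= M.

Definition rho_star (O : set (R * R)) (xi : R * R) : R :=
  sup [set dot2 x xi | x in O].

Definition boundary2 (O : set (R * R)) : set (R * R) :=
  closure O `\` interior O.

Definition diam2 (A : set (R * R)) : R :=
  if pselect (A = set0) then 0
  else sup [set dist2 x y | x in A & y in A].

Definition Ccap (O : set (R * R)) (th : R * R) (d : R) : set (R * R) :=
  [set x | boundary2 O x /\ dot2 x th = rho_star O th - d].

Definition mu_cap (O : set (R * R)) (th : R * R) (d : R) : R :=
  diam2 (Ccap O th d).

Definition area2 (O : set (R * R)) : R :=
  fine ((@lebesgue_measure R \x @lebesgue_measure R)%E O).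

Definition lattice_pts (O : set (R * R)) (t : R) : set (int * int) :=
  [set p | exists x, O x /\ (t * x.1, t * x.2) = (p.1%:~R, p.2%:~R)].

Definition Ncount (O : set (R * R)) (t : R) : R :=
  (#|` fset_set (lattice_pts O t)|)%:R.

Definition Eerr (O : set (R * R)) (t : R) : R :=
  Ncount O t - t ^+ 2 * area2 O.

Definition Gmean (O : set (R * R)) (Rr h : R) : R :=
  Num.sqrt (h^-1 * Rintegral (@lebesgue_measure R) `[Rr, Rr + h]
                                (fun t => `|Eerr O t| ^+ 2)).
End Defs.

(* Main.v *)
(** Smooth the lattice count: let K(x) = F(x_1) F(x_2), where F is the normalised
    square of |sum_{j<m} sin(pi j/m) e(jx)|, with m ~ r.  K has mass 1 on each unit
    lattice square and all but O(1/r) of it lies within 1/(2q) ~ r^{-1/2} of the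
    lattice point, so the count N(t) lies between the integrals of K over the
    dilates of O by t -+ O(r^{-1/2}), up to O(sqrt r).

    Expand K in a Fourier series.  A frequency k <> 0 contributes
    t^2 int W_k(u) cos(2 pi t u) du, where W_k is the length of the slice
    {x in O : <x,k> = u}; it is concave on its support (-rho^*(-k), rho^*(k)), and
    the cap hypothesis bounds it by K |k|^{-3/2} times the square root of the distance to either
    endpoint.  Sample u on the grids v + hZ, 0 <= v < h, h = 1/(2r), and sum by
    parts twice: by concavity the second differences of W_k have total mass
    O(|k|^{-3/2} h^{1/2}) near each endpoint and a smaller total in between.
    A mean value inequality for cosine sums on an interval of length 1/2 leaves
    sum_{k,l} |k|^{-3/2} |l|^{-3/2} / (1 + (rho^*(k) - rho^*(l))^2) over |k|, |l| << r,
    which is O(log r) because {rho^* < 1} is again a convex body, so that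
    m <= rho^*(k) < m+1 has O(m) solutions.  Averaging over v gives
    int_r^{r+1/2} |E|^2 << r log r, and [R, R+h] is covered by such intervals. *)

Require Import Defs.
From HB Require Import structures.
From mathcomp Require Import all_boot all_order all_algebra.
From mathcomp Require Import all_classical all_reals all_analysis.
From mathcomp Require Import finmap measurable_realfun.
From mathcomp Require Import zify ring lra.
Import Order.TTheory GRing.Theory Num.Theory.
Import numFieldNormedType.Exports.
Local Open Scope classical_set_scope.
Local Open Scope ring_scope.
Set Implicit Arguments.
Unset Strict Implicit.

(** Second differences at a scale h replace two integrations by parts; only their total mass is
    needed, and concavity makes it telescope.

    The scale is forced: summation by parts divides by 2 cos(2 pi t h) - 2, and with h = 1/(2r) and
    t near r the phase 2 pi t h is near pi, so this factor stays away from 0.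

    Powers of r: coefficients of total mass |k|^{-3/2} h^{1/2} give a mean square of order h log r
    on each grid. The factor t^4 and the factor h^2 from integrating over v turn this into r^4 h^3
    log r, of order r log r.

    An interval of length 1/2 cannot separate frequencies closer than about 1, so all grid points
    near one endpoint of the support are treated as a single frequency; the loss is only a
    constant. *)

Local Notation freq m := ('I_(m + m).+1 * 'I_(m + m).+1)%type.

(** * Slices and dilates of plane sets *)

Section AffineSubstitution.
Context {R : realType}.
Local Notation mu := (@lebesgue_measure R).
Local Open Scope ereal_scope.

Lemma measurable_affine (a b : R) :
  measurable_fun setT (fun x : measurableTypeR R => (a * x + b)%R : measurableTypeR R).
Proof. by apply: measurable_funD => //; exact: measurable_funM. Qed.

Let aff (a b : R) : measurableTypeR R -> measurableTypeR R := fun x => (a * x + b)%R.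

(** The push-forward under the affine map, rescaled by [|a|], agrees with Lebesgue measure on the
    intervals []p, q]], and these determine it. For [a < 0] the preimage is closed on the other
    side, with the same length. *)
Lemma lebesgue_measure_affine (a b : R) (A : set R) : a != 0%R -> measurable A ->
  mu A = `|a|%:E * mu ((fun x : R => a * x + b)%R @^-1` A).
Proof.
move=> a0 mA.
have mphi : measurable_fun setT (aff a b) := measurable_affine a b.
have [nu nuE] : exists nu : {measure set (measurableTypeR R) -> \bar R},
    (nu : set _ -> _) = pushforward mu (aff a b).
  by exists (measure_function_pushforward__canonical__measure_function_Measure mu mphi).
rewrite -[RHS]/(`|a|%:E * pushforward mu (aff a b) A) -nuE.
rewrite -[RHS]/(mscale (NngNum (normr_ge0 a)) nu A).
apply: lebesgue_measure_unique => // _ [[p q] _ <-].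
rewrite /= /mscale/= nuE /pushforward.
have [ag0|ag0] : (0 < a \/ a < 0)%R by move: a0; rewrite neq_lt => /orP[]; [right|left].
- rewrite (_ : _ @^-1` _ = `](p - b) / a, (q - b) / a]%classic)%R; last first.
    apply/seteqP; split => x /=; rewrite !in_itv/= /aff ltr_pdivrMr// ler_pdivlMr// => /andP[h1 h2]; apply/andP; split; lra.
  rewrite !lebesgue_measure_itv/= !lte_fin ltr_pM2r ?invr_gt0// ltrD2r.
  case: ifPn => // pq; last by rewrite mule0.
  by rewrite -!EFinD -EFinM gtr0_norm//; congr (_%:E); field.
- rewrite (_ : _ @^-1` _ = `[(q - b) / a, (p - b) / a[%classic)%R; last first.
    apply/seteqP; split => x /=; rewrite !in_itv/= /aff ltr_ndivlMr// ler_ndivrMr// => /andP[h1 h2]; apply/andP; split; lra.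
  rewrite !lebesgue_measure_itv/= !lte_fin ltr_nM2r ?invr_lt0// ltrD2r.
  case: ifPn => // pq; last by rewrite mule0.
  by rewrite -!EFinD -EFinM ltr0_norm//; congr (_%:E); field.
Qed.

Lemma ge0_integral_affine (a b : R) (f : R -> \bar R) : a != 0%R ->
  measurable_fun setT f -> (forall x, 0 <= f x) ->
  \int[mu]_x f x = `|a|%:E * \int[mu]_x f (a * x + b)%R.
Proof.
move=> a0 mf f0.
have mphi : measurable_fun setT (aff a b) := measurable_affine a b.
have [nu nuE] : exists nu : {measure set (measurableTypeR R) -> \bar R},
    (nu : set _ -> _) = pushforward mu (aff a b).
  by exists (measure_function_pushforward__canonical__measure_function_Measure mu mphi).
have -> : \int[mu]_x f x = \int[mscale (NngNum (normr_ge0 a)) nu]_x f x.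
  apply: eq_measure_integral => A mA _ /=; rewrite /mscale/= nuE.
  exact: lebesgue_measure_affine.
rewrite ge0_integral_mscale//=; congr (_ * _).
have -> : \int[nu]_x f x = \int[pushforward mu (aff a b)]_x f x by rewrite nuE.
by rewrite ge0_integral_pushforward// preimage_setT.
Qed.

End AffineSubstitution.

Section PlaneBorel.
Context {R : realType}.

(** Measurability refers to the product sigma-algebra, so openness is turned into a countable union
    of measurable boxes: those with rational corners that fit inside [A]. *)
Lemma open2_measurable (A : set (R * R)) : open A ->
  measurable (A : set (measurableTypeR R * measurableTypeR R)%type).
Proof.
move=> oA.
pose box (q : rat * rat * (rat * rat)) : set (R * R) :=
  `]ratr q.1.1, ratr q.1.2[%classic `*` `]ratr q.2.1, ratr q.2.2[%classic.
pose F q := if pselect (box q `<=` A) then box q else set0.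
have -> : A = \bigcup_q F q.
  apply/seteqP; split => [x Ax|x [q _]]; last by rewrite /F; case: pselect => // h /h.
  have [[U V] /= [Ux Vx] UVA] := oA _ Ax.
  have [e1 /= e10 e1U] := Ux; have [e2 /= e20 e2V] := Vx.
  have h (z e : R) : 0 < e -> exists p : rat * rat, z - e < ratr p.1 < z /\ z < ratr p.2 < z + e.
    move=> e0.
    have [p] := @rat_in_itvoo R (z - e) z ltac:(lra).
    have [q] := @rat_in_itvoo R z (z + e) ltac:(lra).
    by rewrite !in_itv/= => hq hp; exists (p, q).
  have [p [/andP[p1 p2] /andP[p3 p4]]] := h x.1 e1 e10.
  have [q [/andP[q1 q2] /andP[q3 q4]]] := h x.2 e2 e20.
  exists (p, q) => //; rewrite /F; case: pselect => [ha|]; first by split; rewrite /= in_itv/=; apply/andP.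
  case; move=> y [/=]; rewrite !in_itv/= => /andP[y1 y2] /andP[y3 y4].
  apply: UVA; split => /=.
    by apply: e1U; rewrite /ball_/= distrC ltr_distl; apply/andP; split; lra.
  by apply: e2V; rewrite /ball_/= distrC ltr_distl; apply/andP; split; lra.
apply: countable_bigcupT_measurable => //.
move=> q; rewrite /F; case: pselect => [ha|ha]; last exact: measurable0.
by apply: measurableX; exact: measurable_itv.
Qed.

End PlaneBorel.

Section Slices.
Context {R : realType}.
Local Notation mu := (@lebesgue_measure R).
Local Notation mu2 := (mu \x mu)%E.
Local Notation T := (measurableTypeR R).
Local Notation TT := (measurableTypeR R * measurableTypeR R)%type.

Definition slice (A : set (R * R)) (k1 k2 u : R) : set R :=
  [set y | A ((u - k2 * y) / k1, y)].

(* The weight of the line k1 x + k2 y = u in the slicing formula: y parametrises the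
   slice and 1/|k1| is the Jacobian. *)
Definition slen (A : set (R * R)) (k1 k2 u : R) : R :=
  `|k1|^-1 * fine (mu (slice A k1 k2 u)).

Lemma measurable_slice_map (k1 k2 : R) :
  measurable_fun setT (fun z : TT => ((z.1 - k2 * z.2) / k1, z.2) : TT).
Proof.
apply/measurable_fun_pairP; split; last exact: measurable_snd.
apply: measurable_funM => //; apply: measurable_funB; first exact: measurable_fst.
by apply: measurable_funM => //; exact: measurable_snd.
Qed.

Lemma measurable_sliceT (A : set (R * R)) (k1 k2 : R) : measurable (A : set TT) ->
  measurable ([set z : TT | A ((z.1 - k2 * z.2) / k1, z.2)]).
Proof.
by move=> mA; rewrite -[X in measurable X]setTI; exact: (measurable_slice_map k1 k2).
Qed.

Lemma measurable_slice (A : set (R * R)) (k1 k2 u : R) : measurable (A : set TT) ->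
  measurable (slice A k1 k2 u : set T).
Proof.
move=> mA; rewrite (_ : slice _ _ _ _ = xsection [set z : TT | A ((z.1 - k2 * z.2) / k1, z.2)] u).
  by apply: measurable_xsection; exact: measurable_sliceT.
by rewrite xsectionE.
Qed.

Lemma measurable_slice_measure (A : set (R * R)) (k1 k2 : R) : measurable (A : set TT) ->
  measurable_fun setT (fun u : T => mu (slice A k1 k2 u)).
Proof.
move=> mA.
have := measurable_fun_xsection mu (measurable_sliceT k1 k2 mA).
congr (measurable_fun _ _); apply/funext => u /=; congr (mu _).
by rewrite xsectionE.
Qed.

Local Open Scope ereal_scope.

(** Tonelli, with the substitution [u = k1 x + k2 y] in the inner integral at fixed [y].
    Nonnegativity of [phi] spares all integrability questions; cosines are treated later as
    differences of nonnegative functions. *)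
Lemma slice_integral (A : set (R * R)) (k1 k2 : R) (phi : T -> R) :
  measurable (A : set TT) -> k1 != 0%R ->
  measurable_fun setT phi -> (forall x, 0 <= phi x)%R ->
  \int[mu2]_(z in A) (phi (k1 * z.1 + k2 * z.2)%R)%:E =
  \int[mu]_u ((phi u)%:E * ((`|k1|^-1)%:E * mu (slice A k1 k2 u))).
Proof.
move=> mA k10 mphi phi0.
have mlin : measurable_fun setT (fun z : TT => (k1 * z.1 + k2 * z.2)%R : T).
  by apply: measurable_funD; apply: measurable_funM.
have mphi2 : measurable_fun setT (fun z : TT => (phi (k1 * z.1 + k2 * z.2)%R)%:E).
  by apply/measurable_EFinP; exact: (measurableT_comp mphi mlin).
have mI B : measurable (B : set TT) -> measurable_fun setT (\1_B : TT -> R).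
  exact: measurable_indic.
pose f (z : TT) := (phi (k1 * z.1 + k2 * z.2)%R)%:E * (\1_A z)%:E.
have f0 z : 0 <= f z by rewrite mule_ge0// lee_fin// phi0.
have mf : measurable_fun setT f.
  by apply: emeasurable_funM => //; apply/measurable_EFinP; exact: mI.
rewrite integral_mkcond.
transitivity (\int[mu2]_z f z).
  apply: eq_integral => z _; rewrite /f patchE indicE; case: ifPn => _; by rewrite ?mule1 ?mule0.
rewrite (fubini_tonelli2 f)//.
have sub y : \int[mu]_x f (x, y) = \int[mu]_u ((phi u)%:E * ((`|k1|^-1)%:E * (\1_A ((u - k2 * y) / k1, y)%R)%:E)).
  have mfy : measurable_fun setT (fun x : T => f (x, y)).
    exact: (measurableT_comp mf (measurable_pair2 y)).
  rewrite (@ge0_integral_affine R k1^-1%R (- (k2 * y) / k1)%R); last 3 first.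
  - by rewrite invr_neq0.
  - by [].
  - by [].
  rewrite -ge0_integralZl//; last first.
  - exact: (measurableT_comp mfy (measurable_affine k1^-1%R (- (k2 * y) / k1)%R)).
  apply: eq_integral => u _; rewrite /f/= normfV.
  rewrite (_ : k1^-1 * u + - (k2 * y) / k1 = (u - k2 * y) / k1)%R; last by field.
  rewrite (_ : (k1 * ((u - k2 * y) / k1) + k2 * y) = u)%R; last by field.
  by rewrite muleCA.
transitivity (\int[mu]_y \int[mu]_u ((phi u)%:E * ((`|k1|^-1)%:E * (\1_A ((u - k2 * y) / k1, y)%R)%:E))).
  by apply: eq_integral => y _; exact: sub.
pose g (z : TT) := (phi z.1)%:E * ((`|k1|^-1)%:E * (\1_A ((z.1 - k2 * z.2) / k1, z.2)%R)%:E).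
have mg : measurable_fun setT g.
  apply: emeasurable_funM; first by apply/measurable_EFinP; exact: (measurableT_comp mphi measurable_fst).
  apply: emeasurable_funM => //; apply/measurable_EFinP.
  exact: (measurableT_comp (mI _ mA) (measurable_slice_map k1 k2)).
have g0 z : 0 <= g z by rewrite !mule_ge0// lee_fin// ?phi0// invr_ge0.
rewrite -(fubini_tonelli g)//; apply: eq_integral => u _; rewrite /g /=.
rewrite ge0_integralZl//; last 2 first.
- apply: emeasurable_funM => //; apply/measurable_EFinP.
  exact: (measurableT_comp (measurableT_comp (mI _ mA) (measurable_slice_map k1 k2)) (measurable_pair1 u)).
- by rewrite lee_fin phi0.
congr (_ * _); rewrite ge0_integralZl//; last first.
- apply/measurable_EFinP.
  exact: (measurableT_comp (measurableT_comp (mI _ mA) (measurable_slice_map k1 k2)) (measurable_pair1 u)).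
congr (_ * _).
transitivity (\int[mu]_y (\1_(slice A k1 k2 u) y)%:E); first exact: eq_integral.
by rewrite integral_indic//= ?setIT//; exact: measurable_slice.
Qed.

End Slices.

Section Dilation.
Context {R : realType}.
Local Notation mu := (@lebesgue_measure R).
Local Notation mu2 := (mu \x mu)%E.
Local Notation T := (measurableTypeR R).
Local Notation TT := (measurableTypeR R * measurableTypeR R)%type.

Definition dil (t : R) (A : set (R * R)) : set (R * R) :=
  [set x | A (t^-1 * x.1, t^-1 * x.2)].

Definition swap2 (A : set (R * R)) : set (R * R) := [set x | A (x.2, x.1)].

Lemma measurable_dil t (A : set (R * R)) :
  measurable (A : set TT) -> measurable (dil t A : set TT).
Proof.
move=> mA; rewrite -[X in measurable X]setTI.
have m : measurable_fun setT (fun z : TT => (t^-1 * z.1, t^-1 * z.2) : TT).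
  by apply/measurable_fun_pairP; split; exact: measurable_funM.
exact: m.
Qed.

Lemma slice_itv (A : set (R * R)) (M k1 k2 u : R) :
  (forall x, A x -> `|x.1| <= M /\ `|x.2| <= M) -> slice A k1 k2 u `<=` `[-M, M].
Proof.
by move=> AM y /AM[_ /=]; rewrite ler_norml in_itv.
Qed.

Lemma slice_fin (A : set (R * R)) (M k1 k2 u : R) : measurable (A : set TT) ->
  (forall x, A x -> `|x.1| <= M /\ `|x.2| <= M) ->
  mu (slice A k1 k2 u) \is a fin_num.
Proof.
move=> mA AM; rewrite ge0_fin_numE//.
apply: (@le_lt_trans _ _ (mu `[-M, M])).
  apply: le_measure; last exact: slice_itv AM.
    by apply/mem_set; exact: measurable_slice.
  by apply/mem_set; exact: measurable_itv.
by rewrite lebesgue_measure_itv/=; case: ifP => // _; rewrite -EFinD ltry.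
Qed.

Lemma measurable_slen (A : set (R * R)) (k1 k2 : R) : measurable (A : set TT) ->
  measurable_fun setT (slen A k1 k2 : T -> T).
Proof.
move=> mA; apply: measurable_funM => //.
apply: (measurableT_comp (f := fine)) => //.
exact: measurable_slice_measure.
Qed.

Lemma slen_ge0 (A : set (R * R)) (k1 k2 u : R) : 0 <= slen A k1 k2 u.
Proof. by rewrite mulr_ge0// ?invr_ge0// fine_ge0. Qed.

Local Open Scope ereal_scope.

(** One factor [t] comes from rescaling [u], the other from the slice, which is [t] times as long in
    the dilate. *)
Lemma dil_slice_integral (A : set (R * R)) (M t k1 k2 : R) (phi : T -> R) :
  measurable (A : set TT) ->
  (forall x, A x -> `|x.1| <= M /\ `|x.2| <= M)%R -> (0 < t)%R -> k1 != 0%R ->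
  measurable_fun setT phi -> (forall x, 0 <= phi x)%R ->
  \int[mu2]_(z in dil t A) (phi (k1 * z.1 + k2 * z.2)%R)%:E =
  \int[mu]_u (t ^+ 2 * (phi (t * u) * slen A k1 k2 u))%:E.
Proof.
move=> mA AM t0 k10 mphi phi0.
rewrite slice_integral//; last exact: measurable_dil.
rewrite (@ge0_integral_affine R t 0%R); last 3 first.
- by rewrite gt_eqF.
- apply: emeasurable_funM; first exact/measurable_EFinP.
  apply: emeasurable_funM => //.
  apply: measurable_slice_measure; exact: measurable_dil.
- by move=> u; rewrite !mule_ge0// lee_fin ?phi0// invr_ge0.
rewrite -ge0_integralZl//; last 2 first.
- apply: (measurableT_comp (f := fun u : T => (phi u)%:E * ((`|k1|^-1)%:E * mu (slice (dil t A) k1 k2 u))) _ (measurable_affine t 0%R)).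
  apply: emeasurable_funM; first exact/measurable_EFinP.
  apply: emeasurable_funM => //.
  apply: measurable_slice_measure; exact: measurable_dil.
- by move=> u _; rewrite !mule_ge0// lee_fin ?phi0// invr_ge0.
apply: eq_integral => u _; rewrite addr0.
have -> : mu (slice (dil t A) k1 k2 (t * u)%R) = t%:E * mu (slice A k1 k2 u).
  have ti0 : t^-1%R != 0%R by rewrite invr_neq0// gt_eqF.
  rewrite [X in _ = _ * X](@lebesgue_measure_affine R t^-1%R 0%R)//; last exact: measurable_slice.
  rewrite gtr0_norm ?invr_gt0// muleA -EFinM mulfV ?gt_eqF// mul1e.
  congr (mu _); apply/seteqP; split => y; rewrite /slice /dil/= addr0;
   (rewrite (_ : (t^-1 * ((t * u - k2 * y) / k1) = (u - k2 * (t^-1 * y)) / k1)%R)//;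
    field; rewrite k10 gt_eqF//).
have /fineK <- := slice_fin k1 k2 u mA AM.
by rewrite gtr0_norm// -!EFinM /slen; congr (_%:E); ring.
Qed.

(** Slicing divides by the first coordinate of the frequency; exchanging the coordinates makes it
    available when the second one is the larger. *)
Lemma swap2_integral (A : set (R * R)) (f : TT -> \bar R) :
  measurable (A : set TT) -> measurable_fun setT f -> (forall z, 0 <= f z) ->
  \int[mu2]_(z in A) f z = \int[mu2]_(z in swap2 A) f (z.2, z.1).
Proof.
move=> mA mf f0.
have m : measurable_fun setT (fun z : TT => (z.2, z.1) : TT).
  by apply/measurable_fun_pairP; split; [exact: measurable_snd|exact: measurable_fst].
pose g (z : TT) := f z * (\1_A z)%:E.
have mg : measurable_fun setT g by apply: emeasurable_funM => //; exact/measurable_EFinP.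
have g0 z : 0 <= g z by rewrite mule_ge0// lee_fin.
have gE (B : set TT) (u : TT -> \bar R) z : (u \_ B) z = u z * (\1_B z)%:E.
  by rewrite patchE indicE; case: ifPn => _; rewrite ?mule1 ?mule0.
transitivity (\int[mu2]_z g z).
  by rewrite integral_mkcond; apply: eq_integral => z _; rewrite gE.
transitivity (\int[mu2]_z g (z.2, z.1)); last first.
  by rewrite [RHS]integral_mkcond; apply: eq_integral => z _; rewrite gE.
rewrite (fubini_tonelli1 g)// (fubini_tonelli2 (fun z : TT => g (z.2, z.1)))//.
exact: (measurableT_comp mg m).
Qed.

Lemma integral_shift_itv (f : T -> R) (a h : R) :
  measurable_fun setT f -> (forall x, 0 <= f x)%R ->
  \int[mu]_(u in `[a, (a + h)%R[) (f u)%:E = \int[mu]_(v in `[0%R, h[) (f (a + v)%R)%:E.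
Proof.
move=> mf f0.
have mr : measurable_fun setT ((fun u => (f u)%:E) \_ `[a, (a + h)%R[).
  apply/(measurable_restrictT _ _).1 => //; apply: measurable_funTS; exact/measurable_EFinP.
rewrite integral_mkcond (@ge0_integral_affine R 1%R a)//; last first.
  by move=> x; rewrite patchE; case: ifP => // _; rewrite lee_fin.
rewrite normr1 mul1e [RHS]integral_mkcond; apply: eq_integral => u _.
by rewrite !patchE mul1r (addrC u a) !mem_setE !in_itv/= lerDl ltrD2l.
Qed.

(** Each cell of length [h] is translated back to [[0, h[]. The integral becomes an integral over
    shifts [v] of sums over a grid, where summation by parts needs no derivative. *)
Lemma integral_grid (f : T -> R) (a h : R) (L : nat) : (0 < h)%R ->
  measurable_fun setT f -> (forall x, 0 <= f x)%R ->
  \int[mu]_(u in `[a, (a + L%:R * h)%R[) (f u)%:E =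
  \int[mu]_(v in `[0%R, h[) (\sum_(j < L) f (a + j%:R * h + v))%:E.
Proof.
move=> h0 mf f0; elim: L => [|L IH].
  rewrite mul0r addr0 set_itvco0 integral_set0.
  by under eq_integral do rewrite big_ord0; rewrite integral0.
rewrite (@itv_bndbnd_setU _ _ _ (BLeft (a + L%:R * h)%R)); last 2 first.
- by rewrite bnd_simp lerDl mulr_ge0// ltW.
- by rewrite bnd_simp lerD2l ler_wpM2r ?(ltW h0)// ler_nat.
rewrite ge0_integral_setU//=; last 3 first.
- exact/measurable_EFinP/measurable_funTS.
- by move=> x _; rewrite lee_fin.
- rewrite disj_set2E; apply/eqP/seteqP; split => // x /=; rewrite !in_itv/= => -[/andP[_ h1] /andP[h2 _]].
  by move: h1; rewrite ltNge h2.
rewrite IH (_ : a + L.+1%:R * h = a + L%:R * h + h)%R; last by rewrite -natr1; ring.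
rewrite integral_shift_itv// -ge0_integralD//=; last 4 first.
- by move=> v _; rewrite lee_fin sumr_ge0.
- apply/measurable_EFinP; apply: measurable_sum => j.
  by apply: measurable_funTS; apply: (measurableT_comp mf); exact: measurable_funD.
- by move=> v _; rewrite lee_fin.
- apply/measurable_EFinP.
  by apply: measurable_funTS; apply: (measurableT_comp mf); exact: measurable_funD.
by apply: eq_integral => v _; rewrite big_ord_recr/= EFinD.
Qed.

Lemma integral_grid_support (f : T -> R) (a h : R) (L : nat) : (0 < h)%R ->
  measurable_fun setT f -> (forall x, 0 <= f x)%R ->
  (forall x, f x != 0 -> a <= x < a + L%:R * h)%R ->
  \int[mu]_u (f u)%:E =
  \int[mu]_(v in `[0%R, h[) (\sum_(j < L) f (a + j%:R * h + v))%:E.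
Proof.
move=> h0 mf f0 supp; rewrite -integral_grid// [RHS]integral_mkcond.
apply: eq_integral => u _; rewrite patchE mem_setE in_itv/=.
by have [->//|/supp ->//] := eqVneq (f u) 0%R; case: ifP.
Qed.

End Dilation.

(** * Convex bodies and their slice profiles *)

Section ConvexBodies.
Context {R : realType}.
Implicit Types (O : set (R * R)) (k x y : R * R).

Definition body O (c M : R) : Prop :=
  [/\ 0 < c, open O, convex2 O,
      (forall x, O x -> `|x.1| <= M /\ `|x.2| <= M) &
      (forall x, `|x.1| <= c -> `|x.2| <= c -> O x)].

Lemma open2P O : open O <->
  forall x, O x -> exists2 e : R, 0 < e &
    forall y, `|x.1 - y.1| < e -> `|x.2 - y.2| < e -> O y.
Proof.
split=> [oO x Ox|oO].
  have [[U V] /= [[e1 /= e10 h1] [e2 /= e20 h2]] UV] := oO _ Ox.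
  exists (Num.min e1 e2); first by rewrite lt_min; apply/andP.
  move=> y; rewrite !lt_min => /andP[a1 a2] /andP[b1 b2]; apply: UV; split => /=.
    exact: h1.
  exact: h2.
rewrite openE => x /oO[e e0 h].
exists (ball x.1 e, ball x.2 e); first by split; exact: nbhsx_ballx.
by move=> y [/= h1 h2]; apply: h.
Qed.

Variables (O : set (R * R)) (c M : R).
Hypothesis bO : body O c M.

Lemma body_c_gt0 : 0 < c. Proof. by case: bO. Qed.
Let c0 := body_c_gt0.
Let oO : open O. Proof. by case: bO. Qed.
Let cO : convex2 O. Proof. by case: bO. Qed.
Let OM : forall x, O x -> `|x.1| <= M /\ `|x.2| <= M. Proof. by case: bO. Qed.
Let Oc : forall x, `|x.1| <= c -> `|x.2| <= c -> O x. Proof. by case: bO. Qed.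

Lemma body_O0 : O (0, 0).
Proof. by apply: Oc; rewrite normr0 ltW. Qed.

Lemma body_cM : c <= M.
Proof.
have /OM[] : O (c, c) by apply: Oc => /=; rewrite ger0_norm// ltW.
by rewrite /= ger0_norm// ltW.
Qed.

Lemma body_swap : body (swap2 O) c M.
Proof.
split => //.
- move/open2P : (oO) => o; apply/open2P => x /o[e e0 h]; exists e => // y h1 h2.
  by apply: h.
- by move=> x y l Ox Oy hl; have := cO Ox Oy hl.
- by move=> x /OM[]; split.
- by move=> x h1 h2; apply: Oc.
Qed.

Lemma measurable_body :
  measurable (O : set (measurableTypeR R * measurableTypeR R)%type).
Proof. exact: open2_measurable. Qed.

(** [y - x] lies in [e/c] times the inner square of half-side [c], hence in [(e/c) O], and convexity
    gives [t O + (e/c) O] inside [(t + e/c) O]. This converts every displacement in the plane into a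
    change of dilation. *)
Lemma dil_shift (t e : R) x y : 0 < t -> 0 <= e -> dil t O x ->
  `|x.1 - y.1| <= e -> `|x.2 - y.2| <= e -> dil (t + e / c) O y.
Proof.
move=> t0 e0 Ox h1 h2; rewrite /dil/=.
move: e0; rewrite le_eqVlt => /predU1P[e0|e0].
  move: h1 h2; rewrite -e0 !normr_le0 !subr_eq0 => /eqP <- /eqP <-.
  by rewrite mul0r addr0.
have ec : 0 < e / c by rewrite divr_gt0.
have te : 0 < t + e / c by rewrite addr_gt0.
pose z := ((y.1 - x.1) / (e / c), (y.2 - x.2) / (e / c)).
have hz a b : `|a - b| <= e -> `|(b - a) / (e / c)| <= c.
  move=> ha; rewrite normrM normfV (gtr0_norm ec) distrC.
  by rewrite ler_pdivrMr// mulrCA mulfV ?mulr1// gt_eqF.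
have Oz : O z := @Oc z (hz _ _ h1) (hz _ _ h2).
have hl : 0 <= (e / c) / (t + e / c) <= 1.
  by apply/andP; split; [rewrite divr_ge0// ltW|rewrite (ler_pdivrMr _ _ te) mul1r lerDr ltW].
have := cO Ox Oz hl; rewrite /z/=.
have c0' : c != 0 by rewrite gt_eqF.
have e0' : e != 0 by rewrite gt_eqF.
have t0' : t != 0 by rewrite gt_eqF.
have d0 : t * c + e != 0 by rewrite gt_eqF// addr_gt0// mulr_gt0.
congr (O (_, _)); by field; rewrite c0' e0' t0' d0.
Qed.

Lemma dil_mono (s t : R) x : 0 < s -> s <= t -> dil s O x -> dil t O x.
Proof.
move=> s0 st Ox.
have tc : 0 <= (t - s) * c by rewrite mulr_ge0 ?subr_ge0// ltW.
have -> : t = s + (t - s) * c / c by rewrite mulfK ?gt_eqF//; ring.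
by apply: (dil_shift s0 tc Ox); rewrite subrr normr0.
Qed.

Lemma body_lin k : has_sup [set dot2 x k | x in O].
Proof.
split; first by exists (dot2 (0, 0) k); exists (0, 0) => //; exact: body_O0.
exists (M * (`|k.1| + `|k.2|)) => _ [x /OM[h1 h2] <-].
rewrite /dot2 (le_trans (ler_norm _))// (le_trans (ler_normD _ _))//.
by rewrite !normrM mulrDr lerD// ler_wpM2r.
Qed.

Lemma rho_ub k x : O x -> dot2 x k <= rho_star O k.
Proof.
move=> Ox; apply: sup_ubound; first exact: (body_lin k).2.
by exists x.
Qed.

Lemma rho_adh k u : u < rho_star O k -> exists2 x, O x & u < dot2 x k.
Proof.
move=> h; have e0 : 0 < rho_star O k - u by rewrite subr_gt0.
have [_ [x Ox <-]] := sup_adherent e0 (body_lin k).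
by rewrite opprB addrCA subrr addr0; exists x.
Qed.

Lemma rho_lub k b : (forall x, O x -> dot2 x k <= b) -> rho_star O k <= b.
Proof.
move=> h; rewrite leNgt; apply/negP => /rho_adh[x /h].
by rewrite leNgt => /negP.
Qed.

Lemma rho_le k : rho_star O k <= M * (`|k.1| + `|k.2|).
Proof.
apply: rho_lub => x /OM[h1 h2].
rewrite /dot2 (le_trans (ler_norm _))// (le_trans (ler_normD _ _))//.
by rewrite !normrM mulrDr lerD// ler_wpM2r.
Qed.

(** Tested at the corner of the inner square whose signs are those of [k]. *)
Lemma rho_ge k : c * (`|k.1| + `|k.2|) <= rho_star O k.
Proof.
have nsg (a : R) : `|Num.sg a * c| <= c.
  by rewrite normrM (gtr0_norm c0) ler_piMl ?(ltW c0)// normr_sg; case: eqP.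
have := @rho_ub k _ (@Oc (Num.sg k.1 * c, Num.sg k.2 * c) (nsg _) (nsg _)).
apply: le_trans; rewrite /dot2/= (mulrC _ c) (mulrC _ c) -!mulrA -mulrDr.
by rewrite ler_pM2l// !normrEsg.
Qed.

Lemma rhoD k l : rho_star O (k.1 + l.1, k.2 + l.2) <= rho_star O k + rho_star O l.
Proof.
apply: rho_lub => x Ox; have := rho_ub k Ox; have := rho_ub l Ox.
rewrite /dot2/=; lra.
Qed.

Lemma rhoZ k s : 0 < s -> rho_star O (s * k.1, s * k.2) = s * rho_star O k.
Proof.
move=> s0; apply/eqP; rewrite eq_le; apply/andP; split.
  apply: rho_lub => x Ox; rewrite /dot2/= mulrCA (mulrCA _ s) -mulrDr.
  by rewrite ler_pM2l//; exact: rho_ub.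
rewrite mulrC -ler_pdivlMr//; apply: rho_lub => x Ox; rewrite ler_pdivlMr//.
by have := rho_ub (s * k.1, s * k.2) Ox; rewrite /dot2/=; lra.
Qed.

(** An open set leaves room to move from [x] in the direction [k], so the supremum is not
    attained. *)
Lemma rho_strict k x : k != (0, 0) -> O x -> dot2 x k < rho_star O k.
Proof.
move=> k0 Ox; move/open2P : (oO) => /(_ x Ox)[e e0 h].
have nk : 0 < `|k.1| + `|k.2|.
  rewrite lt_neqAle addr_ge0// andbT eq_sym paddr_eq0// !normr_eq0.
  by apply: contra k0 => /andP[/eqP h1 /eqP h2]; rewrite (surjective_pairing k) h1 h2.
pose d := e / (2 * (`|k.1| + `|k.2|)).
have d0 : 0 < d by rewrite divr_gt0// mulr_gt0.
have hd (a : R) : `|a| <= `|k.1| + `|k.2| -> `|d * a| < e.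
  move=> ha; rewrite normrM (gtr0_norm d0) /d mulrAC ltr_pdivrMr ?mulr_gt0//.
  by rewrite ltr_pM2l//; lra.
have Oy : O (x.1 + d * k.1, x.2 + d * k.2).
  by apply: h => /=; rewrite opprD addrA subrr sub0r normrN; apply: hd; rewrite ?lerDl ?lerDr.
apply: lt_le_trans (rho_ub k Oy); rewrite /dot2/=.
rewrite -subr_gt0 (_ : _ - _ = d * (k.1 ^+ 2 + k.2 ^+ 2)); last by ring.
rewrite mulr_gt0// lt_neqAle addr_ge0 ?sqr_ge0// andbT eq_sym paddr_eq0 ?sqr_ge0//.
rewrite !sqrf_eq0; apply: contra k0 => /andP[/eqP h1 /eqP h2].
by rewrite (surjective_pairing k) h1 h2.
Qed.

End ConvexBodies.

Section OpenIntervals.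
Context {R : realType}.

Lemma open_interval_form (S : set R) (M : R) : open S -> is_interval S ->
  S `<=` `[-M, M] -> S !=set0 -> exists p q : R, p < q /\ S = `]p, q[%classic.
Proof.
move=> oS iS SM S0.
have hs : has_sup S by split => //; exists M => y /SM; rewrite /= in_itv/= => /andP[].
have hi : has_inf S by split => //; exists (- M) => y /SM; rewrite /= in_itv/= => /andP[].
have nS y : S y -> exists2 e : R, 0 < e & forall z, `|y - z| < e -> S z.
  by move=> /oS[e /= e0 h]; exists e => // z; exact: h.
have h1 y : S y -> y < sup S.
  move=> Sy; have [e e0 /(_ (y + e / 2))] := nS y Sy.
  have -> : `|y - (y + e / 2)| = e / 2 by rewrite opprD addrA subrr sub0r normrN gtr0_norm// divr_gt0.
  move=> /(_ ltac:(lra)) h; apply: lt_le_trans (sup_ubound hs.2 h); lra.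
have h2 y : S y -> inf S < y.
  move=> Sy; have [e e0 /(_ (y - e / 2))] := nS y Sy.
  have -> : `|y - (y - e / 2)| = e / 2 by rewrite opprB addrCA subrr addr0 gtr0_norm// divr_gt0.
  move=> /(_ ltac:(lra)) h; apply: le_lt_trans (inf_lbound hi.2 h) _; lra.
exists (inf S), (sup S); split.
  by have [y Sy] := S0; exact: lt_trans (h2 y Sy) (h1 y Sy).
apply/seteqP; split => [y Sy|y]; first by rewrite /= in_itv/= h1// h2.
rewrite /= in_itv/= => /andP[a b].
have [x Sx xb] := sup_adherent (ltac:(by rewrite subr_gt0) : 0 < sup S - y) hs.
have [z Sz za] := inf_adherent (ltac:(by rewrite subr_gt0) : 0 < y - inf S) hi.
by apply: (iS z x Sz Sx); apply/andP; split; apply/ltW; lra.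
Qed.

End OpenIntervals.

Section Profiles.
Context {R : realType}.
Local Notation mu := (@lebesgue_measure R).

(** All that the oscillatory estimates use about the slice lengths in one direction. The two
    endpoint bounds share one constant, which makes the notion stable under reflection. *)
Record profile (W : R -> R) (a b kap : R) : Prop := Profile {
  profile_ge0 : forall u, 0 <= W u;
  profile_supp : forall u, W u != 0 -> a < u < b;
  profile_concave : forall u v l, a < u < b -> a < v < b -> 0 <= l <= 1 ->
    (1 - l) * W u + l * W v <= W ((1 - l) * u + l * v);
  profile_right : forall u, a < u < b -> W u <= kap * Num.sqrt (b - u);
  profile_left : forall u, a < u < b -> W u <= kap * Num.sqrt (u - a)
}.

Lemma profile_reflect W a b kap : profile W a b kap ->
  profile (fun u => W (- u)) (- b) (- a) kap.
Proof.
move=> [h1 h2 h3 h4 h5].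
have neg u : - b < u < - a -> a < - u < b by move=> /andP[p q]; apply/andP; split; lra.
split => // [u /h2 /andP[p q]|u v l /neg hu /neg hv hl|u /neg hu|u /neg hu].
- by apply/andP; split; lra.
- have := h3 _ _ _ hu hv hl.
  by rewrite (_ : (1 - l) * - u + l * - v = - ((1 - l) * u + l * v))//; ring.
- by rewrite (_ : - a - u = - u - a); [exact: h5|ring].
- by rewrite (_ : u - - b = b - - u); [exact: h4|ring].
Qed.

Definition nrm2 (k : R * R) : R := Num.sqrt (k.1 ^+ 2 + k.2 ^+ 2).

Definition adherent2 (O : set (R * R)) (P : R * R) : Prop :=
  forall e : R, 0 < e -> exists x, [/\ O x, `|P.1 - x.1| < e & `|P.2 - x.2| < e].

(* The hypothesis on mu with theta = k/|k|, freed of the normalisation of k; as O is open,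
   its boundary consists of the adherent points outside O. *)
Definition cap_bound (O : set (R * R)) (K : R) : Prop :=
  0 <= K /\ forall (k : R * R) (u : R) (P Q : R * R), k != (0, 0) -> u < rho_star O k ->
    ~ O P -> ~ O Q -> adherent2 O P -> adherent2 O Q ->
    dot2 P k = u -> dot2 Q k = u ->
    dist2 P Q <= K * Num.sqrt ((rho_star O k - u) / nrm2 k).

Lemma rho_swap (O : set (R * R)) (k : R * R) : rho_star (swap2 O) k = rho_star O (k.2, k.1).
Proof.
rewrite /rho_star; congr sup; apply/seteqP; split => _ [x Ox <-].
  by exists (x.2, x.1) => //; rewrite /dot2/= addrC.
by exists (x.2, x.1) => //; [rewrite /swap2/= -surjective_pairing|rewrite /dot2/= addrC].
Qed.

Lemma cap_bound_swap (O : set (R * R)) (K : R) : cap_bound O K -> cap_bound (swap2 O) K.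
Proof.
move=> [K0 h]; split => // k u P Q k0 uk OP OQ aP aQ Pk Qk.
have ad (X : R * R) : adherent2 (swap2 O) X -> adherent2 O (X.2, X.1).
  by move=> aX e /aX[x [h1 h2 h3]]; exists (x.2, x.1).
rewrite rho_swap in uk *.
have := h (k.2, k.1) u (P.2, P.1) (Q.2, Q.1).
have -> : nrm2 (k.2, k.1) = nrm2 k by rewrite /nrm2/= addrC.
rewrite /dist2/= (addrC ((P.2 - Q.2) ^+ 2)); apply => //.
- by apply: contra k0 => /eqP[] h2 h1; rewrite (surjective_pairing k) h1 h2.
- exact: ad.
- exact: ad.
- by rewrite -Pk /dot2/= addrC.
- by rewrite -Qk /dot2/= addrC.
Qed.

Variables (O : set (R * R)) (c M K : R).
Hypothesis bO : body O c M.
Hypothesis hK : cap_bound O K.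

Let OM : forall x, O x -> `|x.1| <= M /\ `|x.2| <= M. Proof. by case: bO. Qed.
Let cO : convex2 O. Proof. by case: bO. Qed.

Variable k : R * R.
Hypothesis k10 : k.1 != 0.

Let dotE u y : dot2 ((u - k.2 * y) / k.1, y) k = u.
Proof. by rewrite /dot2/=; field. Qed.

Let slice_conv u v l y z : slice O k.1 k.2 u y -> slice O k.1 k.2 v z -> 0 <= l <= 1 ->
  slice O k.1 k.2 ((1 - l) * u + l * v) ((1 - l) * y + l * z).
Proof.
move=> Oy Oz hl; have := cO Oy Oz hl; rewrite /slice/=.
by congr (O (_, _)); field.
Qed.

Lemma slice_open_itv u : slice O k.1 k.2 u !=set0 ->
  exists p q : R, p < q /\ slice O k.1 k.2 u = `]p, q[%classic.
Proof.
apply: (@open_interval_form _ _ M).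
- have c1 : continuous (fun y : R => (u - k.2 * y) / k.1).
    by move=> y; apply: cvgM; [apply: cvgB; [exact: cvg_cst|apply: cvgM; [exact: cvg_cst|exact: cvg_id]]|exact: cvg_cst].
  have cf : continuous (fun y : R => ((u - k.2 * y) / k.1, y)).
    by move=> y; exact: (cvg_pair (c1 y) (@cvg_id _ (nbhs y))).
  have oO : open O by case: bO.
  rewrite -[slice _ _ _ _]/((fun y : R => ((u - k.2 * y) / k.1, y)) @^-1` O); apply: open_comp => // y _; exact: cf.
- move=> y z Oy Oz w /andP[yw wz].
  have [yz|yz] := eqVneq y z.
    by rewrite (_ : w = y)//; apply/eqP; rewrite eq_le yw andbT yz.
  have d0 : 0 < z - y by rewrite subr_gt0 lt_neqAle yz/= (le_trans yw).
  have hl : 0 <= (w - y) / (z - y) <= 1.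
    apply/andP; split; first by rewrite divr_ge0 ?subr_ge0// (le_trans yw).
    by rewrite ler_pdivrMr// mul1r lerD2r.
  have := slice_conv Oy Oz hl; congr (slice O _ _ _ _); last by field; rewrite gt_eqF.
  by ring.
- exact: slice_itv (@OM).
Qed.

Lemma slenE u p q : p < q -> slice O k.1 k.2 u = `]p, q[%classic ->
  slen O k.1 k.2 u = `|k.1|^-1 * (q - p).
Proof.
by move=> pq; rewrite /slen => ->; rewrite lebesgue_measure_itv/= lte_fin pq.
Qed.

Lemma slice_nonempty u : - rho_star O (- k.1, - k.2) < u < rho_star O k ->
  slice O k.1 k.2 u !=set0.
Proof.
move=> /andP[h1 h2].
have [x Ox xu] := rho_adh bO h2.
have [z Oz zu] : exists2 z, O z & dot2 z k < u.
  have [z Oz b] := rho_adh bO (ltac:(by rewrite ltrNl) : - u < rho_star O (- k.1, - k.2)).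
  by exists z => //; move: b; rewrite /dot2/=; lra.
have d0 : 0 < dot2 x k - dot2 z k by lra.
have hl : 0 <= (u - dot2 z k) / (dot2 x k - dot2 z k) <= 1.
  apply/andP; split; first by rewrite divr_ge0// ltW//; lra.
  by rewrite ler_pdivrMr//; lra.
exists ((1 - (u - dot2 z k) / (dot2 x k - dot2 z k)) * z.2 +
        (u - dot2 z k) / (dot2 x k - dot2 z k) * x.2).
have := cO Oz Ox hl; rewrite /slice/=; congr (O (_, _)).
move: d0; rewrite /dot2/= => d0; field; rewrite k10/= gt_eqF//.
Qed.

Lemma slice_supp u : slice O k.1 k.2 u !=set0 ->
  - rho_star O (- k.1, - k.2) < u < rho_star O k.
Proof.
move=> [y Oy]; apply/andP; split; last first.
  rewrite -(dotE u y); apply: (rho_strict bO) => //.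
  by apply: contra k10 => /eqP kE; rewrite kE.
rewrite ltrNl -[X in X < _](_ : dot2 ((u - k.2 * y) / k.1, y) (- k.1, - k.2) = _).
  apply: (rho_strict bO) => //.
  by apply: contra k10 => /eqP[kE _]; rewrite -oppr_eq0 kE.
by rewrite -[in RHS](dotE u y) /dot2/=; ring.
Qed.

(** The two ends of a slice are boundary points on the same line; this is the pair to which
    [cap_bound] is applied. *)
Lemma slice_endpoint u p q (z : R) : p < q -> slice O k.1 k.2 u = `]p, q[%classic ->
  z = p \/ z = q -> ~ O ((u - k.2 * z) / k.1, z) /\ adherent2 O ((u - k.2 * z) / k.1, z).
Proof.
move=> pq S zpq; split.
  have -> : O ((u - k.2 * z) / k.1, z) = slice O k.1 k.2 u z by [].
  by rewrite S /= in_itv/=; case: zpq => ->; rewrite ltxx ?andbF.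
move=> e e0.
(* The first coordinate moves [|k.2 / k.1|] times as much as the second, hence the second bound on
   [d]; the first bound keeps the approximating point inside the slice. *)
pose d := Num.min ((q - p) / 2) (e / (2 * (1 + `|k.2 / k.1|))).
have d0 : 0 < d by rewrite lt_min divr_gt0 ?subr_gt0//= divr_gt0// mulr_gt0.
have d1 : d <= (q - p) / 2 by rewrite ge_min lexx.
have d2 : d * (1 + `|k.2 / k.1|) <= e / 2.
  have : d <= e / (2 * (1 + `|k.2 / k.1|)) by rewrite ge_min lexx orbT.
  by rewrite ler_pdivlMr ?mulr_gt0// => h; lra.
have [y [Oy yz]] : exists y, slice O k.1 k.2 u y /\ `|z - y| = d.
  case: zpq => ->.
    exists (p + d); rewrite S /= in_itv/=; split; first by apply/andP; split; lra.
    by rewrite opprD addrA subrr sub0r normrN gtr0_norm.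
  exists (q - d); rewrite S /= in_itv/=; split; first by apply/andP; split; lra.
  by rewrite opprB addrCA subrr addr0 gtr0_norm.
exists ((u - k.2 * y) / k.1, y); split => //=.
  rewrite (_ : _ - _ = - ((k.2 / k.1) * (z - y))); last by field.
  rewrite normrN normrM yz; have := normr_ge0 (k.2 / k.1).
  move: d2; rewrite mulrDr mulr1 mulrC; lra.
by rewrite yz; have := mulr_ge0 (ltW d0) (normr_ge0 (k.2 / k.1)); move: d2; rewrite mulrDr mulr1; lra.
Qed.

(** The projection [q - p] is at most the distance of the two ends. The Jacobian contributes
    [1/|k.1|], and [|k.1| <= |k|] in the cap bound contributes [|k.1|^{-1/2}], which makes the
    exponent 3/2. *)
Lemma slen_right u : - rho_star O (- k.1, - k.2) < u < rho_star O k ->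
  slen O k.1 k.2 u <= K / (`|k.1| * Num.sqrt `|k.1|) * Num.sqrt (rho_star O k - u).
Proof.
move=> hu; have [p [q [pq S]]] := slice_open_itv (slice_nonempty hu).
have [K0 hcap] := hK.
have k0 : k != (0, 0) by apply: contra k10 => /eqP kE; rewrite kE.
have [nP aP] := slice_endpoint pq S (or_introl erefl).
have [nQ aQ] := slice_endpoint pq S (or_intror erefl).
have ub : u < rho_star O k by case/andP: hu.
have := hcap k u _ _ k0 ub nP nQ aP aQ (dotE _ _) (dotE _ _).
have hd : q - p <= dist2 ((u - k.2 * p) / k.1, p) ((u - k.2 * q) / k.1, q).
  rewrite /dist2/=.
  have -> : q - p = Num.sqrt ((q - p) ^+ 2) by rewrite sqrtr_sqr gtr0_norm// subr_gt0.
  by rewrite ler_sqrt ?addr_ge0 ?sqr_ge0// -(sqrrN (p - q)) opprB lerDr sqr_ge0.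
move=> /(le_trans hd) {}hd.
rewrite (slenE pq S).
have kk : 0 < `|k.1| by rewrite normr_gt0.
have kn : `|k.1| <= nrm2 k.
  by rewrite /nrm2 -sqrtr_sqr ler_sqrt ?addr_ge0 ?sqr_ge0// lerDl sqr_ge0.
have h2 : Num.sqrt ((rho_star O k - u) / nrm2 k) <= Num.sqrt (rho_star O k - u) / Num.sqrt `|k.1|.
  rewrite -sqrtrV// -sqrtrM ?subr_ge0 ?(ltW ub)// ler_sqrt ?mulr_ge0 ?subr_ge0 ?invr_ge0 ?(ltW ub)//.
  by rewrite ler_wpM2l ?subr_ge0 ?(ltW ub)// lef_pV2// posrE (lt_le_trans kk).
have := ler_wpM2l K0 h2 => /(le_trans hd) {}hd.
rewrite mulrC ler_pdivrMr// (le_trans hd)// le_eqVlt; apply/orP; left; apply/eqP.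
by field; rewrite !gt_eqF// sqrtr_gt0.
Qed.

(** Brunn-Minkowski in dimension one: convexity puts the combination []P, Q[] of two slices inside
    the intermediate slice, whose length is therefore at least [Q - P]. *)
Lemma slen_concave u v l :
  - rho_star O (- k.1, - k.2) < u < rho_star O k ->
  - rho_star O (- k.1, - k.2) < v < rho_star O k -> 0 <= l <= 1 ->
  (1 - l) * slen O k.1 k.2 u + l * slen O k.1 k.2 v <=
  slen O k.1 k.2 ((1 - l) * u + l * v).
Proof.
move=> /slice_nonempty hu /slice_nonempty hv hl.
have [p [q [pq S]]] := slice_open_itv hu.
have [p' [q' [pq' S']]] := slice_open_itv hv.
have [l0 l1] : 0 <= l /\ l <= 1 by case/andP: hl.
pose P := (1 - l) * p + l * p'; pose Q := (1 - l) * q + l * q'.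
have PQ : 0 < Q - P.
  rewrite (_ : Q - P = (1 - l) * (q - p) + l * (q' - p')); last by rewrite /P /Q; ring.
  have [->|ln0] := eqVneq l 0; first by rewrite subr0 mul1r mul0r addr0 subr_gt0.
  by rewrite ltr_wpDl ?mulr_ge0 ?subr_ge0 ?(ltW pq)// mulr_gt0 ?subr_gt0// lt_neqAle eq_sym ln0.
have sub y : P < y < Q -> slice O k.1 k.2 ((1 - l) * u + l * v) y.
  move=> /andP[Py yQ]; pose s := (y - P) / (Q - P).
  have s01 : 0 < s < 1.
    by apply/andP; split; [rewrite divr_gt0// subr_gt0|rewrite /s ltr_pdivrMr// mul1r ltrD2r].
  case/andP: s01 => s0 s1.
  have a1 : slice O k.1 k.2 u (p + s * (q - p)).
    have h1 := mulr_gt0 s0 (ltac:(by rewrite subr_gt0) : 0 < q - p).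
    have h2 := mulr_gt0 (ltac:(by rewrite subr_gt0) : 0 < 1 - s) (ltac:(by rewrite subr_gt0) : 0 < q - p).
    by rewrite S /= in_itv/=; apply/andP; split; lra.
  have a2 : slice O k.1 k.2 v (p' + s * (q' - p')).
    have h1 := mulr_gt0 s0 (ltac:(by rewrite subr_gt0) : 0 < q' - p').
    have h2 := mulr_gt0 (ltac:(by rewrite subr_gt0) : 0 < 1 - s) (ltac:(by rewrite subr_gt0) : 0 < q' - p').
    by rewrite S' /= in_itv/=; apply/andP; split; lra.
  have := slice_conv a1 a2 hl; congr slice.
  transitivity (P + s * (Q - P)); first by rewrite /P /Q; ring.
  by rewrite /s mulfVK ?gt_eqF//; ring.
have [p2 [q2 [pq2 S2]]] : exists p q : R, p < q /\
    slice O k.1 k.2 ((1 - l) * u + l * v) = `]p, q[%classic.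
  by apply: slice_open_itv; exists ((P + Q) / 2); apply: sub; apply/andP; split; lra.
rewrite (slenE pq S) (slenE pq' S') (slenE pq2 S2).
rewrite (_ : _ + _ = `|k.1|^-1 * (Q - P)); last by rewrite /P /Q; ring.
rewrite ler_wpM2l ?invr_ge0//.
have le1 : p2 <= P.
  rewrite leNgt; apply/negP => Pp2.
  pose y := Num.min ((P + p2) / 2) ((P + Q) / 2).
  have : slice O k.1 k.2 ((1 - l) * u + l * v) y.
    by apply: sub; rewrite /y lt_min gt_min; apply/andP; split; [apply/andP; split|apply/orP; right]; lra.
  by rewrite S2 /= in_itv/= => /andP[]; rewrite /y lt_min => /andP[]; lra.
have le2 : Q <= q2.
  rewrite leNgt; apply/negP => q2Q.
  pose y := Num.max ((Q + q2) / 2) ((P + Q) / 2).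
  have : slice O k.1 k.2 ((1 - l) * u + l * v) y.
    by apply: sub; rewrite /y lt_max gt_max; apply/andP; split; [apply/orP; right|apply/andP; split]; lra.
  by rewrite S2 /= in_itv/= => /andP[_]; rewrite /y gt_max => /andP[]; lra.
lra.
Qed.

Lemma slen_neg u : slen O (- k.1) (- k.2) (- u) = slen O k.1 k.2 u.
Proof.
rewrite /slen normrN; congr (_ * fine (mu _)); rewrite /slice.
by apply/seteqP; split => y /=; congr (O (_, _)); field.
Qed.

End Profiles.

(** The bound at the left endpoint is the right one for the frequency [- k], whose slice at [- u] is
    the same segment. *)
Lemma slen_profile {R : realType} (O : set (R * R)) (c M K : R) (k : R * R) :
  body O c M -> cap_bound O K -> k.1 != 0 ->
  profile (slen O k.1 k.2) (- rho_star O (- k.1, - k.2)) (rho_star O k)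
    (K / (`|k.1| * Num.sqrt `|k.1|)).
Proof.
move=> bO hK k10; split.
- by move=> u; exact: slen_ge0.
- move=> u u0; apply: (slice_supp bO k10); apply/set0P; apply: contra u0 => /eqP h.
  by rewrite /slen h measure0 mulr0.
- by move=> u v l; exact: (slen_concave bO k10).
- by move=> u; exact: (slen_right bO hK k10).
- move=> u /andP[h1 h2]; rewrite -(slen_neg O k10).
  have k1' : (- k.1, - k.2).1 != 0 by rewrite oppr_eq0.
  have := slen_right (u := - u) bO hK k1'; rewrite /= normrN (opprK u) => h.
  rewrite opprK addrC; apply: h.
  by rewrite !opprK -surjective_pairing ltrN2 h2 ltrNl h1.
Qed.

(** * Second differences of concave profiles *)

Section GridSums.
Context {R : realType}.

(** The grid points above [A] form a final stretch of the grid, which is itself a grid starting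
    above [A]. *)
Lemma sum_filter_ge (F : R -> R) (A h C : R) : 0 <= h -> 0 <= C ->
  (forall n y, A <= y -> \sum_(i < n) F (y + i%:R * h) <= C) ->
  forall n y, \sum_(i < n | A <= y + i%:R * h) F (y + i%:R * h) <= C.
Proof.
move=> h0 C0 H; elim=> [|n IH] y; first by rewrite big_ord0.
have [Ay|Ay] := leP A y.
  rewrite (eq_bigl xpredT) ?H// => i.
  by rewrite (le_trans Ay)// lerDl mulr_ge0.
rewrite big_mkcond big_ord_recl mul0r addr0 (leNgt A y) Ay/= add0r.
rewrite -big_mkcond /=; have := IH (y + h).
congr (_ <= _); apply: eq_big => i; rewrite /bump/= -natr1.
  by congr (_ <= _); ring.
by move=> _; congr F; ring.
Qed.

Lemma sum_filter_le (F : R -> R) (B h C : R) : 0 <= h -> 0 <= C ->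
  (forall n y, y <= B -> \sum_(i < n) F (y - i%:R * h) <= C) ->
  forall n y, \sum_(i < n | y + i%:R * h <= B) F (y + i%:R * h) <= C.
Proof.
move=> h0 C0 H n y.
have H' m z : - B <= z -> \sum_(i < m) (F \o -%R) (z + i%:R * h) <= C.
  move=> Bz; have := H m (- z) (ltac:(by rewrite lerNl)).
  by congr (_ <= _); apply: eq_bigr => i _ /=; congr F; ring.
case: n => [|n]; first by rewrite big_ord0.
have := sum_filter_ge h0 C0 H' n.+1 (- (y + n%:R * h)).
congr (_ <= _); rewrite (reindex_inj rev_ord_inj) /=.
have E (i : 'I_n.+1) : - (y + n%:R * h) + (n.+1 - i.+1)%:R * h = - (y + i%:R * h).
  by rewrite subSS natrB -1?ltnS//; ring.
by apply: eq_big => i; rewrite E ?lerN2// opprK.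
Qed.

(** Cutting [F] off above [B] removes one of the two conditions, and [sum_filter_ge] handles the
    other. *)
Lemma sum_filter_itv (F : R -> R) (A B h C : R) : 0 <= h -> 0 <= C ->
  (forall n y, A <= y -> y + n%:R * h <= B -> \sum_(i < n.+1) F (y + i%:R * h) <= C) ->
  forall n y, \sum_(i < n | A <= y + i%:R * h <= B) F (y + i%:R * h) <= C.
Proof.
move=> h0 C0 H n y.
pose G z := if z <= B then F z else 0.
rewrite (eq_bigl (fun i : 'I_n => (A <= y + i%:R * h) && (y + i%:R * h <= B)))// big_mkcondr.
apply: (sum_filter_ge (F := G)) => // {n y}; elim=> [|n IH] y Ay; first by rewrite big_ord0.
have [yB|yB] := leP (y + n%:R * h) B.
  rewrite (eq_bigr (fun i : 'I_n.+1 => F (y + i%:R * h))); first exact: H.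
  move=> i _; rewrite /G ifT// (le_trans _ yB)// lerD2l ler_wpM2r// ler_nat.
  by rewrite -ltnS.
by rewrite big_ord_recr/= {2}/G (leNgt _ B) yB/= addr0; exact: IH.
Qed.

End GridSums.

Section SecondDifferences.
Context {R : realType}.

Definition diff1 (W : R -> R) (h y : R) : R := W y - W (y + h).
Definition diff2 (W : R -> R) (h y : R) : R := W (y + h) - 2 * W y + W (y - h).

Lemma diff2_reflect W h y : diff2 (fun u => W (- u)) h (- y) = diff2 W h y.
Proof.
by rewrite /diff2 opprD opprK (_ : - (- y - h) = y + h); ring.
Qed.

(** Concavity between [u] and a point [v] beyond [u + h] shows that a step loses at most the
    fraction [l = h / (v - u)] of [W u]. As [l <= 2h / (b - u)] and [W u] is at most [kap] times the
    root of [b - u], the root ends up in the denominator. *)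
Lemma profile_diff1_le W a b kap h u : profile W a b kap -> 0 <= kap -> 0 < h ->
  u + h < b -> diff1 W h u <= 2 * kap * h / Num.sqrt (b - u).
Proof.
move=> pW kap0 h0 uhb; have ub : 0 < b - u by lra.
have s0 : 0 < Num.sqrt (b - u) by rewrite sqrtr_gt0.
have rhs0 : 0 <= 2 * kap * h / Num.sqrt (b - u).
  by rewrite divr_ge0 ?sqrtr_ge0// !mulr_ge0// ltW.
have [Wu|Wu] := eqVneq (W u) 0.
  by rewrite /diff1 Wu sub0r (le_trans _ rhs0)// oppr_le0 (profile_ge0 pW).
have hu := profile_supp pW Wu; case/andP: (hu) => au _.
(* Concavity is known only inside the open support, so [v] stops halfway between [u + h] and [b];
   this costs the factor 2. *)
pose v := (u + h + b) / 2.
have hv : a < v < b by rewrite /v; apply/andP; split; lra.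
have vu : (b - u) / 2 <= v - u by rewrite /v; lra.
have vu0 : 0 < v - u by lra.
pose l := h / (v - u).
have hl : 0 <= l <= 1.
  by apply/andP; split; [rewrite divr_ge0// ltW|rewrite ler_pdivrMr// mul1r /v; lra].
have := profile_concave pW hu hv hl.
have vu1 : v - u != 0 by rewrite gt_eqF.
have lE : l * (v - u) = h by rewrite /l mulfVK.
have -> : (1 - l) * u + l * v = u + h by rewrite -lE; ring.
have lWv : 0 <= l * W v by rewrite mulr_ge0 ?(profile_ge0 pW)//; case/andP: hl.
move=> hc; have : diff1 W h u <= l * W u by rewrite /diff1; lra.
move=> /le_trans; apply.
apply: (@le_trans _ _ (l * (kap * Num.sqrt (b - u)))).
  by rewrite ler_wpM2l ?(profile_right pW)//; case/andP: hl.
rewrite ler_pdivlMr//.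
have SS : Num.sqrt (b - u) * Num.sqrt (b - u) = b - u by rewrite -expr2 sqr_sqrtr// ltW.
have lk : 0 <= l * kap by rewrite mulr_ge0//; case/andP: hl.
have := ler_wpM2l lk vu.
set S := Num.sqrt (b - u) in SS *.
have -> : l * (kap * S) * S = l * kap * (b - u) by rewrite -SS; ring.
have -> : 2 * kap * h = 2 * kap * (l * (v - u)) by rewrite lE.
clearbody l v => H; lra.
Qed.

Lemma profile_diff1_ge W a b kap h u : profile W a b kap -> 0 <= kap -> 0 < h ->
  a < u -> - diff1 W h u <= 2 * kap * h / Num.sqrt (u + h - a).
Proof.
move=> pW kap0 h0 au.
have := @profile_diff1_le _ _ _ _ h (- (u + h)) (profile_reflect pW) kap0 h0 ltac:(lra).
rewrite /diff1 (_ : - (- (u + h) + h) = u); last by ring.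
by rewrite !opprK (addrC (- a)) opprB.
Qed.

(** By concavity the second difference is nonpositive, so sums of its absolute value telescope. *)
Lemma profile_diff2_interior W a b kap h y : profile W a b kap -> 0 < h ->
  a < y - h -> y + h < b -> `|diff2 W h y| = diff1 W h y - diff1 W h (y - h).
Proof.
move=> pW h0 ay yb.
have := @profile_concave _ _ _ _ _ pW (y - h) (y + h) (1/2).
have -> : (1 - 1 / 2) * (y - h) + 1 / 2 * (y + h) = y by field.
move=> /(_ ltac:(apply/andP; split; lra) ltac:(apply/andP; split; lra) ltac:(apply/andP; split; lra)) hc.
by rewrite /diff2 /diff1 subrK ler0_norm; lra.
Qed.

Variables (W : R -> R) (a b kap h s : R).
Hypothesis pW : profile W a b kap.
Hypothesis kap0 : 0 <= kap.
Hypothesis h0 : 0 < h.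
Hypothesis hs : 2 * h <= s.
Hypothesis sab : 4 * s <= b - a.

Let Q := kap * Num.sqrt h.
Let sh0 : 0 < Num.sqrt h. Proof. by rewrite sqrtr_gt0. Qed.
Let Q0 : 0 <= Q. Proof. by rewrite mulr_ge0// ltW. Qed.

Let hdivsqrt x : h <= x -> 2 * kap * h / Num.sqrt x <= 2 * Q.
Proof.
move=> hx; have x0 : 0 < x by exact: lt_le_trans hx.
rewrite ler_pdivrMr ?sqrtr_gt0// /Q -{1}(sqr_sqrtr (ltW h0)) expr2 -!mulrA.
by rewrite !ler_wpM2l// ?(ltW sh0)// ler_sqrt// ltW.
Qed.

Let Wbound m y : b <= y + m%:R * h -> W y <= kap * Num.sqrt (m%:R * h).
Proof.
move=> by_; have [->|Wy] := eqVneq (W y) 0; first by rewrite mulr_ge0// sqrtr_ge0.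
have hy := profile_supp pW Wy.
apply: (le_trans (profile_right pW hy)); rewrite ler_wpM2l//.
by rewrite ler_sqrt; [lra|rewrite mulr_ge0// ltW].
Qed.

Let sqrt2h : Num.sqrt (2%:R * h) <= 2 * Num.sqrt h.
Proof.
rewrite sqrtrM// ler_wpM2r ?(ltW sh0)//.
have {2}-> : (2 : R) = Num.sqrt (2 ^+ 2) by rewrite sqrtr_sqr ger0_norm.
by rewrite ler_sqrt//; lra.
Qed.

Let W1 y : b <= y + h -> W y <= Q.
Proof. by move=> hy; have := @Wbound 1 y; rewrite mul1r; apply. Qed.

Let W2 y : b <= y + 2 * h -> W y <= 2 * Q.
Proof.
move=> hy; have := @Wbound 2 y hy => /le_trans; apply.
by rewrite /Q mulrCA ler_wpM2l.
Qed.

Let W0 y : b <= y -> W y = 0.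
Proof.
move=> hy; apply/eqP; apply: contraT => /(profile_supp pW)/andP[_].
by rewrite ltNge hy.
Qed.

Lemma diff2_sum_right n y : b - s <= y ->
  \sum_(i < n) `|diff2 W h (y + i%:R * h)| <= 9 * Q.
Proof.
have [[h0' hs'] sab'] := (h0, hs, sab).
(* Psi is a potential: each step of the grid towards b costs at most its decrease.
   In the interior |diff2| telescopes by concavity; the last steps are bounded by W itself. *)
pose Psi z := if z + h < b then 7 * Q - diff1 W h (z - h)
  else if z < b then 5 * Q else if z < b + h then Q else 0.
have Wge := profile_ge0 pW.
have e2Q z : z < b -> diff1 W h (z - h) <= 2 * Q.
  move=> zb; apply: le_trans (profile_diff1_le pW kap0 h0 _) (hdivsqrt _); lra.
have Psi0 z : 0 <= Psi z.
  rewrite /Psi; case: ifPn => [h1|_].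
    have zb : z < b by apply: lt_trans h1; rewrite ltrDl.
    have := e2Q z zb; have := Q0; lra.
  by case: ifP => _; [|case: ifP => _]; rewrite ?mulr_ge0.
(* The constants of [Psi] add up backwards: [Q] for a grid point just beyond [b], [4 * Q] for the
   last one before [b], and [2 * Q] for the first difference left over when the interior formula
   stops. *)
have step z : b - s <= z -> `|diff2 W h z| + Psi (z + h) <= Psi z.
  move=> bz; rewrite /Psi.
  have [h1|h1] := ltP (z + h) b.
    rewrite (profile_diff2_interior pW h0 _ h1); last by lra.
    rewrite addrK; case: ifPn => [_|h2]; first by lra.
    rewrite -leNgt in h2.
    have := @W2 z ltac:(lra); have := Wge (z + h); rewrite /diff1; lra.
  rewrite [z + h + h < b]ltNge (le_trans h1 (ltac:(by rewrite lerDl ltW) : z + h <= z + h + h))/=.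
  rewrite ltrD2r.
  have e1 : W (z + h) = 0 by exact: W0.
  have [h2|h2] := ltP z b.
    rewrite /diff2 e1.
    have := @W1 z h1; have := @W2 (z - h) ltac:(lra); have := Wge z; have := Wge (z - h).
    by move=> ? ? ? ?; rewrite sub0r; have : `|- (2 * W z) + W (z - h)| <= 4 * Q; [rewrite ler_norml; apply/andP; split|]; lra.
  rewrite /diff2 e1 (W0 h2) mulr0 subr0 add0r addr0 ger0_norm//.
  case: ifPn => [h3|]; first by apply: W1; lra.
  by rewrite -leNgt => h3; rewrite W0//; lra.
have main m z : b - s <= z -> \sum_(i < m) `|diff2 W h (z + i%:R * h)| <= Psi z.
  elim: m z => [|m IH] z bz; first by rewrite big_ord0.
  rewrite big_ord_recl mul0r addr0; apply: le_trans (step z bz); rewrite lerD2l.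
  have := IH (z + h) ltac:(lra); congr (_ <= _); apply: eq_bigr => i _.
  by rewrite /bump/= -natr1; congr (`|diff2 _ _ _|); ring.
move=> bz; apply: (le_trans (main n y bz)); rewrite /Psi.
case: ifPn => [h1|_]; last by case: ifP => _; [|case: ifP => _]; have := Q0; lra.
(* [Psi y] still contains [- diff1 W h (y - h)]. Since [y] is far from [a], this is at most [2 * Q],
   and 7 + 2 = 9. *)
have := @profile_diff1_ge _ _ _ _ h (y - h) pW kap0 h0 ltac:(lra).
by have := @hdivsqrt (y - h + h - a) ltac:(lra); lra.
Qed.

(** The sum telescopes to two first differences, each bounded through an endpoint at distance at
    least [s]; hence the order [h] in place of the root of [h]. *)
Lemma diff2_sum_mid n y : a + s <= y -> y + n%:R * h <= b - s ->
  \sum_(i < n.+1) `|diff2 W h (y + i%:R * h)| <= 4 * kap * h / Num.sqrt s.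
Proof.
have [[h0' hs'] sab'] := (h0, hs, sab).
move=> ay yb.
have s0 : 0 < s by lra.
have tel m : (m <= n)%N -> \sum_(i < m.+1) `|diff2 W h (y + i%:R * h)| =
    diff1 W h (y + m%:R * h) - diff1 W h (y - h).
  elim: m => [|m IH] mn.
    rewrite big_ord_recr big_ord0 /= add0r mul0r addr0.
    rewrite (profile_diff2_interior pW h0)//; first by lra.
    by have := mulr_ge0 (ler0n R n) (ltW h0); lra.
  rewrite big_ord_recr/= IH 1?ltnW// (profile_diff2_interior pW h0).
  - rewrite -natr1 (_ : y + (m%:R + 1) * h - h = y + m%:R * h); first by ring.
    by ring.
  - by rewrite -natr1; have := mulr_ge0 (ler0n R m) (ltW h0); lra.
  - have : m.+1%:R * h <= n%:R * h by rewrite ler_wpM2r ?ler_nat// ltW.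
    by lra.
rewrite tel//.
have mon x : s <= x -> 2 * kap * h / Num.sqrt x <= 2 * kap * h / Num.sqrt s.
  move=> sx; rewrite ler_wpM2l ?mulr_ge0 ?(ltW h0)// lef_pV2 ?posrE ?sqrtr_gt0//.
    by rewrite ler_sqrt//; lra.
  by lra.
have := @profile_diff1_ge _ _ _ _ h (y - h) pW kap0 h0 ltac:(lra).
have := mon (y - h + h - a) ltac:(lra).
have := @profile_diff1_le _ _ _ _ h (y + n%:R * h) pW kap0 h0 ltac:(lra).
have := mon (b - (y + n%:R * h)) ltac:(lra).
have -> : 4 * kap * h / Num.sqrt s = 2 * kap * h / Num.sqrt s + 2 * kap * h / Num.sqrt s.
  by ring.
lra.
Qed.

End SecondDifferences.

Section DiffSums.
Context {R : realType}.
Variables (W : R -> R) (a b kap h s : R).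
Hypothesis pW : profile W a b kap.
Hypothesis kap0 : 0 <= kap.
Hypothesis h0 : 0 < h.
Hypothesis hs : 2 * h <= s.
Hypothesis sab : 4 * s <= b - a.

Lemma diff2_filter_right n y :
  \sum_(i < n | b - s <= y + i%:R * h) `|diff2 W h (y + i%:R * h)| <= 9 * (kap * Num.sqrt h).
Proof.
apply: (@sum_filter_ge R (fun z => `|diff2 W h z|)); first exact: ltW.
- by rewrite !mulr_ge0// sqrtr_ge0.
- by move=> m z; exact: (diff2_sum_right pW).
Qed.

Lemma diff2_filter_left n y :
  \sum_(i < n | y + i%:R * h <= a + s) `|diff2 W h (y + i%:R * h)| <= 9 * (kap * Num.sqrt h).
Proof.
have [[h0' hs'] sab'] := (h0, hs, sab).
apply: (@sum_filter_le R (fun z => `|diff2 W h z|)); first exact: ltW.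
- by rewrite !mulr_ge0// sqrtr_ge0.
- move=> m z za.
  have := @diff2_sum_right R _ _ _ _ h s (profile_reflect pW) kap0 h0 hs ltac:(lra) m (- z) ltac:(lra).
  congr (_ <= _); apply: eq_bigr => i _; rewrite -(diff2_reflect W).
  by congr (`|diff2 _ _ _|); ring.
Qed.

Lemma diff2_filter_mid n y :
  \sum_(i < n | a + s <= y + i%:R * h <= b - s) `|diff2 W h (y + i%:R * h)| <=
  4 * kap * h / Num.sqrt s.
Proof.
apply: (@sum_filter_itv R (fun z => `|diff2 W h z|)); first exact: ltW.
- by rewrite divr_ge0 ?sqrtr_ge0// !mulr_ge0// ltW.
- by move=> m z; exact: (diff2_sum_mid pW).
Qed.

End DiffSums.

(** * Mean squares of cosine sums *)

Section CosineIntegrals.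
Context {R : realType}.
Local Notation mu := (@lebesgue_measure R).

Lemma continuous_lin (a b : R) : continuous (fun t : R => a * t + b).
Proof.
move=> t; apply: cvgD; last exact: cvg_cst.
by apply: cvgM; [exact: cvg_cst|exact: cvg_id].
Qed.

Lemma continuous_cos_lin (a b : R) : continuous (fun t : R => cos (a * t + b)).
Proof.
move=> t; apply: (@continuous_comp _ _ _ (fun t => a * t + b) cos).
  exact: continuous_lin.
exact: continuous_cos.
Qed.

Lemma is_derive_sin_lin (a b t : R) :
  is_derive t 1 (fun t : R => sin (a * t + b)) (a * cos (a * t + b)).
Proof.
have h1 : is_derive t 1 (fun t : R => a * t + b) a.
  by apply: is_derive_eq; rewrite /GRing.scale/=; ring.
have := @is_derive1_comp R sin (fun t : R => a * t + b) t _ _ (is_derive_sin _) h1.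
by rewrite mulrC.
Qed.

Lemma continuous_integrable (f : R -> R) (p q : R) : continuous f ->
  mu.-integrable `[p, q] (EFin \o f).
Proof.
move=> cf; apply: continuous_compact_integrable; first exact: segment_compact.
exact: continuous_subspaceT.
Qed.

Lemma Rintegral_cos_lin (a b p q : R) : a != 0 -> p < q ->
  \int[mu]_(t in `[p, q]) cos (a * t + b) = (sin (a * q + b) - sin (a * p + b)) / a.
Proof.
move=> a0 pq.
pose F t := a^-1 * sin (a * t + b).
have dF (t : R) : is_derive t (1 : R) F (cos (a * t + b)).
  have h := is_derive_sin_lin a b t.
  by apply: is_derive_eq; rewrite /GRing.scale/=; field.
rewrite /Rintegral (@continuous_FTC2 R _ F)//.
- by rewrite -EFinB /= /F; ring.
- by apply: continuous_subspaceT; exact: continuous_cos_lin.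
- have cF : continuous F by move=> t; apply/differentiable_continuous/derivable1_diffP; case: (dF t).
  split; first by move=> t _; case: (dF t).
  + by apply: cvg_at_right_filter; exact: cF.
  + by apply: cvg_at_left_filter; exact: cF.
- by move=> t _; rewrite derive1E; case: (dF t).
Qed.

Lemma Rintegral_sum_continuous (I : Type) (s : seq I) (P : pred I) (f : I -> R -> R) (p q : R) :
  (forall i, continuous (f i)) ->
  \int[mu]_(t in `[p, q]) (\sum_(i <- s | P i) f i t) =
  \sum_(i <- s | P i) \int[mu]_(t in `[p, q]) f i t.
Proof.
move=> cf; elim: s => [|i s IH].
  rewrite big_nil; under eq_Rintegral do rewrite big_nil.
  by rewrite Rintegral_cst// mul0r.
have cs : continuous (fun t => \sum_(j <- s | P j) f j t).
  by move=> t; apply: cvg_big => [|j _]; [exact: add_continuous|exact: cf].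
rewrite big_cons; case: ifPn => Pi; last first.
  by rewrite -IH; apply: eq_Rintegral => t _; rewrite big_cons (negbTE Pi).
rewrite -IH -RintegralD//; [|exact: continuous_integrable|exact: continuous_integrable].
by apply: eq_Rintegral => t _; rewrite big_cons Pi.
Qed.

Lemma Rintegral_scale_continuous (f : R -> R) (p q a : R) : continuous f ->
  \int[mu]_(t in `[p, q]) (a * f t) = a * \int[mu]_(t in `[p, q]) f t.
Proof. by move=> cf; rewrite RintegralZl//; exact: continuous_integrable. Qed.

(* A nonnegative window that is at least 1 on [c + 1/4, c + 3/4] and whose transform
   over [c, c + 1] decays quadratically. *)
Definition hann (c t : R) : R := 1 - cos (2 * pi * t - 2 * pi * c).

Definition hann_hat (c x : R) : R :=
  \int[mu]_(t in `[c, c + 1]) (hann c t * cos (2 * pi * x * t)).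

Lemma continuous_hann c : continuous (hann c).
Proof.
move=> t; apply: cvgB; first exact: cvg_cst.
exact: continuous_cos_lin.
Qed.

Lemma hann_ge0 c t : 0 <= hann c t.
Proof. by rewrite subr_ge0 cos_le1. Qed.

Lemma hann_le2 c t : hann c t <= 2.
Proof. by rewrite /hann; have := cos_geN1 (2 * pi * t - 2 * pi * c); lra. Qed.

Lemma hann_ge1 c t : c + 1/4 <= t <= c + 3/4 -> 1 <= hann c t.
Proof.
move=> /andP[h1 h2]; rewrite /hann lerBrDr gerDl.
have -> : 2 * pi * t - 2 * pi * c = (2 * pi * (t - c) - pi) + pi by ring.
rewrite (cosDpi (2 * pi * (t - c) - pi)) oppr_le0.
have p0 : 0 < pi :> R := pi_gt0 R.
have h3 : pi * (1/4) <= pi * (t - c) by rewrite ler_pM2l//; lra.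
have h4 : pi * (t - c) <= pi * (3/4) by rewrite ler_pM2l//; lra.
by apply: cos_ge0_pihalf; apply/andP; split; lra.
Qed.

(** For [|x| >= 2] the integral is explicit: the phase of the window makes the sines of the
    frequencies [x - 1], [x], [x + 1] agree at both ends of the unit interval, so the three terms
    combine into one with denominator [x (x - 1) (x + 1)]. For smaller [x] the trivial bound 2
    suffices. *)
Lemma hann_hat_bound (c x : R) : `|hann_hat c x| <= 10 / (1 + x ^+ 2).
Proof.
have p0 : 0 < pi :> R := pi_gt0 R.
have d0 : 0 < 1 + x ^+ 2 by rewrite ltr_pwDl// sqr_ge0.
have cx : continuous (fun t => hann c t * cos (2 * pi * x * t)).
  move=> t; apply: cvgM; first exact: continuous_hann.
  by have := @continuous_cos_lin (2 * pi * x) 0 t; under [X in continuous_at _ X -> _]eq_fun do rewrite addr0.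
have [x2|x2] := ltP `|x| 2.
  apply: (@le_trans _ _ 2).
    apply: (le_trans (le_normr_Rintegral _ _)) => //; first exact: continuous_integrable.
    apply: (@le_trans _ _ (\int[mu]_(t in `[c, c + 1]) (2 : R))); last first.
      rewrite Rintegral_cst//= lebesgue_measure_itv/= lte_fin ltrDl ltr01 -EFinB /=.
      by rewrite addrAC subrr add0r mulr1.
    apply: le_Rintegral => //.
    - by apply: continuous_integrable => t; apply: cvg_norm; exact: cx.
    - by apply: continuous_integrable => t; exact: cvg_cst.
    - move=> t _; rewrite normrM ger0_norm ?hann_ge0//.
      rewrite -[X in _ <= X]mulr1; apply: ler_pM => //; [exact: hann_ge0|exact: hann_le2|exact: cos_max].
  rewrite ler_pdivlMr//.
  have : x ^+ 2 <= 4 by move: x2; rewrite ltr_norml => /andP[h1 h2]; nra.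
  by lra.
have x0 : x != 0 by rewrite -normr_gt0; lra.
have [x1 x1'] : x + 1 != 0 /\ x - 1 != 0.
  split; apply/eqP => h; move: x2.
    by rewrite (_ : x = -1); [rewrite normrN normr1; lra|lra].
  by rewrite (_ : x = 1); [rewrite normr1; lra|lra].
have pi0 : (pi : R) != 0 by rewrite gt_eqF.
have E : hann_hat c x = sin (2 * pi * x * (c + 1)) * (- (2 * pi * (x * (x - 1) * (x + 1)))^-1) +
     sin (2 * pi * x * c) * (2 * pi * (x * (x - 1) * (x + 1)))^-1.
  rewrite /hann_hat.
  transitivity (\int[mu]_(t in `[c, c + 1])
    (cos (2 * pi * x * t + 0) - (2^-1 * cos (2 * pi * (x + 1) * t + - (2 * pi * c)) +
      2^-1 * cos (2 * pi * (x - 1) * t + 2 * pi * c)))).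
    apply: eq_Rintegral => t _.
    have -> : 2 * pi * (x + 1) * t + - (2 * pi * c) = 2 * pi * x * t + (2 * pi * t - 2 * pi * c) by ring.
    have -> : 2 * pi * (x - 1) * t + 2 * pi * c = 2 * pi * x * t - (2 * pi * t - 2 * pi * c) by ring.
    by rewrite addr0 cosB cosD /hann; field.
  have cc := continuous_cos_lin.
  have c1 a b : continuous (fun t : R => 2^-1 * cos (a * t + b)).
    by move=> t; apply: cvgM; [exact: cvg_cst|exact: cc].
  rewrite RintegralB//; [|exact: continuous_integrable|]; last first.
    by apply: continuous_integrable => t; apply: cvgD; exact: c1.
  rewrite RintegralD//; [|exact: continuous_integrable|exact: continuous_integrable].
  rewrite !Rintegral_scale_continuous//.
  rewrite !Rintegral_cos_lin ?mulf_neq0 ?ltrDl//.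
  have s1 : sin (2 * pi * (x + 1) * (c + 1) - 2 * pi * c) = sin (2 * pi * x * (c + 1)).
    rewrite (_ : _ - _ = 2 * pi * x * (c + 1) + pi *+ 2); last by rewrite mulr2n; ring.
    by rewrite sinD2pi.
  have s2 : sin (2 * pi * (x - 1) * (c + 1) + 2 * pi * c) = sin (2 * pi * x * (c + 1)).
    rewrite -[LHS]sinD2pi; congr sin; rewrite mulr2n; ring.
  have s3 : sin (2 * pi * (x + 1) * c - 2 * pi * c) = sin (2 * pi * x * c) by congr sin; ring.
  have s4 : sin (2 * pi * (x - 1) * c + 2 * pi * c) = sin (2 * pi * x * c) by congr sin; ring.
  rewrite s1 s2 s3 s4 !addr0; move: (pi : R) pi0 => P P0; field.
  by rewrite x0 x1 x1' P0.
rewrite E (le_trans (ler_normD _ _))// !normrM normrN.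
have D0 : 0 < `|(2 * pi * (x * (x - 1) * (x + 1)))|.
  by rewrite normr_gt0 !mulf_neq0.
rewrite normfV.
have hD : 1 + x ^+ 2 <= `|(2 * pi * (x * (x - 1) * (x + 1)))|.
  have xx : 4 <= x ^+ 2.
    by rewrite -(real_normK (num_real x)); nra.
  rewrite -(mulrA x) (_ : (x - 1) * (x + 1) = x ^+ 2 - 1); last by ring.
  rewrite !normrM (ger0_norm (_ : 0 <= x ^+ 2 - 1)); last by lra.
  rewrite (ger0_norm (ltW p0)) ger0_norm//.
  have p2 : 2 <= pi :> R := pi_ge2 R.
  have h1 : 2 * 2 <= pi * `|x| by apply: ler_pM.
  have h2 : 2 * 2 * (x ^+ 2 - 1) <= pi * `|x| * (x ^+ 2 - 1) by rewrite ler_wpM2r//; lra.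
  lra.
apply: (@le_trans _ _ (1 / (1 + x ^+ 2) + 1 / (1 + x ^+ 2))); last first.
  by rewrite -mulrDl ler_pM2r ?invr_gt0//; lra.
have h a : `|sin a| / `|2 * pi * (x * (x - 1) * (x + 1))| <= 1 / (1 + x ^+ 2).
  by apply: ler_pM; rewrite ?invr_ge0 ?sin_max ?lef_pV2 ?posrE.
by apply: lerD; exact: h.
Qed.

End CosineIntegrals.

(** * Mean value inequality for cosine sums *)

Section LargeSieve.
Context {R : realType}.
Local Notation mu := (@lebesgue_measure R).

Lemma continuous_cosine_sum (I : finType) (P : pred I) (a y : I -> R) :
  continuous (fun t : R => \sum_(p | P p) a p * cos (2 * pi * y p * t)).
Proof.
move=> t; apply: cvg_big => [|p _]; first exact: add_continuous.
apply: cvgM; first exact: cvg_cst.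
have := @continuous_cos_lin R (2 * pi * y p) 0 t.
by under [X in continuous_at _ X -> _]eq_fun do rewrite addr0.
Qed.

(** Under the Hann window each product of cosines yields a difference and a sum frequency. For
    nonnegative [y] the sum is at least the difference in absolute value, so both obey the same
    bound, and the factor 1/2 cancels their number. *)
Lemma cosine_sum_mean_square (I : finType) (P : pred I) (a y : I -> R) (c : R) :
  (forall p, P p -> 0 <= y p) ->
  (\int[mu]_(t in `[(c + 1/4)%R, (c + 3/4)%R]) ((\sum_(p | P p) a p * cos (2 * pi * y p * t)) ^+ 2)%R%:E <=
  (10 * \sum_(p | P p) \sum_(q | P q) `|a p| * `|a q| / (1 + (y p - y q) ^+ 2))%:E)%E.
Proof.
move=> y0; set f := fun t => \sum_(p | P p) a p * cos (2 * pi * y p * t).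
have cf : continuous f by exact: continuous_cosine_sum.
have cf2 : continuous (fun t => f t ^+ 2) by move=> t; apply: cvgM; exact: cf.
have cg : continuous (fun t => hann c t * f t ^+ 2).
  by move=> t; apply: cvgM; [exact: continuous_hann|exact: cf2].
have mcont (g : R -> R) (D : set R) : continuous g -> measurable_fun D (fun t => (g t)%:E).
  by move=> cg'; apply/measurable_EFinP; apply: measurable_funTS; exact: continuous_measurable_fun.
apply: (@le_trans _ _ (\int[mu]_(t in `[c, (c + 1)%R]) (hann c t * f t ^+ 2)%:E)%E).
  apply: (@le_trans _ _ (\int[mu]_(t in `[(c + 1/4)%R, (c + 3/4)%R]) (hann c t * f t ^+ 2)%:E)%E).
    apply: ge0_le_integral => //.
    - by move=> t _; rewrite lee_fin sqr_ge0.
    - exact: mcont.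
    - exact: mcont.
    - move=> t /=; rewrite in_itv/= => ht; rewrite lee_fin ler_peMl ?sqr_ge0//.
      exact: hann_ge1.
  apply: ge0_subset_integral => //; first exact: mcont.
    by move=> t _; rewrite lee_fin mulr_ge0 ?sqr_ge0// hann_ge0.
  by move=> t /=; rewrite !in_itv/= => /andP[h1 h2]; apply/andP; split; lra.
have -> : (\int[mu]_(t in `[c, (c + 1)%R]) (hann c t * f t ^+ 2)%:E)%E =
  (\int[mu]_(t in `[c, (c + 1)%R]) (hann c t * f t ^+ 2))%:E.
  by rewrite /Rintegral fineK//; apply: integrable_fin_num => //; exact: continuous_integrable.
rewrite lee_fin.
have cc (x : R) : continuous (fun t => cos (2 * pi * x * t)).
  move=> t; have := @continuous_cos_lin R (2 * pi * x) 0 t.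
  by under [X in continuous_at _ X -> _]eq_fun do rewrite addr0.
have ch (x : R) : continuous (fun t => hann c t * cos (2 * pi * x * t)).
  by move=> t; apply: cvgM; [exact: continuous_hann|exact: cc].
have -> : \int[mu]_(t in `[c, (c + 1)%R]) (hann c t * f t ^+ 2) =
  \sum_(p | P p) \sum_(q | P q) (a p * a q / 2) *
     (hann_hat c (y p - y q) + hann_hat c (y p + y q)).
  transitivity (\int[mu]_(t in `[c, (c + 1)%R]) (\sum_(p | P p) \sum_(q | P q)
     (a p * a q / 2) * (hann c t * cos (2 * pi * (y p - y q) * t) + hann c t * cos (2 * pi * (y p + y q) * t)))).
    apply: eq_Rintegral => t _; rewrite /f expr2 big_distrlr/= big_distrr/=.
    apply: eq_bigr => p _; rewrite big_distrr/=; apply: eq_bigr => q _.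
    rewrite (_ : 2 * pi * (y p - y q) * t = 2 * pi * y p * t - 2 * pi * y q * t); last by ring.
    rewrite (_ : 2 * pi * (y p + y q) * t = 2 * pi * y p * t + 2 * pi * y q * t); last by ring.
    by rewrite cosB cosD; field.
  have cpq p q : continuous (fun t => (hann c t * cos (2 * pi * (y p - y q) * t) + hann c t * cos (2 * pi * (y p + y q) * t))).
    by move=> t; apply: cvgD; exact: ch.
  rewrite Rintegral_sum_continuous; last first.
    move=> p t; apply: cvg_big => [|q _]; first exact: add_continuous.
    by apply: cvgM; [exact: cvg_cst|exact: cpq].
  apply: eq_bigr => p _; rewrite Rintegral_sum_continuous; last first.
    by move=> q t; apply: cvgM; [exact: cvg_cst|exact: cpq].
  apply: eq_bigr => q _; rewrite Rintegral_scale_continuous//; congr (_ * _).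
  by rewrite RintegralD//; exact: continuous_integrable.
rewrite mulr_sumr; apply: ler_sum => p Pp; rewrite mulr_sumr; apply: ler_sum => q Pq.
have d0 (x : R) : 0 < 1 + x ^+ 2 by rewrite ltr_pwDl// sqr_ge0.
apply: (le_trans (ler_norm _)); rewrite !normrM normfV (ger0_norm (_ : (0 : R) <= 2))//.
have h1 := hann_hat_bound c (y p - y q).
have h2 := hann_hat_bound c (y p + y q).
have h3 : 10 / (1 + (y p + y q) ^+ 2) <= 10 / (1 + (y p - y q) ^+ 2).
  rewrite ler_wpM2l// lef_pV2 ?posrE// lerD2l.
  by have := mulr_ge0 (y0 _ Pp) (y0 _ Pq); rewrite !expr2; lra.
have h4 : `|hann_hat c (y p - y q) + hann_hat c (y p + y q)| <= 2 * (10 / (1 + (y p - y q) ^+ 2)).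
  by apply: le_trans (ler_normD _ _) _; lra.
have := ler_wpM2l (mulr_ge0 (normr_ge0 (a p)) (normr_ge0 (a q))) h4.
by set A := `|hann_hat c _ + _|; set B := _^-1; set C := `|a p| * `|a q|; lra.
Qed.

(** The frequencies of one group lie within 1 of [beta k] and may be replaced by it:
    [1 + (|d| + 2)^2 <= 9 (1 + d^2)], where [d] is the difference of two frequencies. Hence 90,
    which is 9 times the earlier 10. Only the total mass [A k] of a group matters then. *)
Lemma grouped_cosine_sum_mean_square (K J : finType) (P : K -> J -> bool)
    (a y : K -> J -> R) (beta A : K -> R) (c : R) :
  (forall k j, P k j -> 0 <= y k j) ->
  (forall k j, P k j -> `|y k j - beta k| <= 1) ->
  (forall k, \sum_(j | P k j) `|a k j| <= A k) ->
  (\int[mu]_(t in `[(c + 1/4)%R, (c + 3/4)%R])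
     ((\sum_k \sum_(j | P k j) a k j * cos (2 * pi * y k j * t)) ^+ 2)%R%:E <=
  (90 * \sum_k \sum_l A k * A l / (1 + (beta k - beta l) ^+ 2))%:E)%E.
Proof.
move=> y0 yb aA.
have d0 (x : R) : 0 < 1 + x ^+ 2 by rewrite ltr_pwDl// sqr_ge0.
under eq_integral do rewrite pair_big_dep/=.
apply: (le_trans (@cosine_sum_mean_square (K * J)%type (fun p => P p.1 p.2)
  (fun p => a p.1 p.2) (fun p => y p.1 p.2) c _)); first by move=> p; exact: y0.
rewrite lee_fin -(pair_big_dep xpredT P (fun k j => \sum_(q | P q.1 q.2)
  `|a k j| * `|a q.1 q.2| / (1 + (y k j - y q.1 q.2) ^+ 2)))/=.
rewrite (_ : 90 = 10 * 9); last by lra.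
rewrite -mulrA ler_wpM2l// mulr_sumr; apply: ler_sum => k _.
under eq_bigr => j _ do rewrite -(pair_big_dep xpredT P (fun l i =>
  `|a k j| * `|a l i| / (1 + (y k j - y l i) ^+ 2)))/=.
rewrite exchange_big/= mulr_sumr; apply: ler_sum => l _.
apply: (@le_trans _ _ (\sum_(j | P k j) \sum_(i | P l i) `|a k j| * `|a l i| * (9 / (1 + (beta k - beta l) ^+ 2)))).
  apply: ler_sum => j Pj; apply: ler_sum => i Pi.
  rewrite ler_wpM2l ?mulr_ge0// ler_pdivlMr// mulrC ler_pdivrMr//.
  have := yb _ _ Pj; have := yb _ _ Pi; rewrite !ler_norml => /andP[h1 h2] /andP[h3 h4].
  have : (beta k - beta l) ^+ 2 <= (`|y k j - y l i| + 2) ^+ 2.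
    rewrite -[X in X <= _](real_normK (num_real _)) lerXn2r ?nnegrE ?addr_ge0//.
    rewrite ler_norml; have := ler_norm (y k j - y l i); have := ler_norm (- (y k j - y l i)).
    by rewrite normrN => g1 g2; apply/andP; split; lra.
  rewrite -[(y k j - y l i) ^+ 2](real_normK (num_real _)).
  set d := `|y k j - y l i|; set u := (beta k - beta l) ^+ 2.
  by have := sqr_ge0 (d - 1); have := sqr_ge0 d; rewrite !expr2; lra.
rewrite (eq_bigr (fun j => `|a k j| * ((\sum_(i | P l i) `|a l i|) * (9 / (1 + (beta k - beta l) ^+ 2))))); last first.
  by move=> j _; rewrite mulrA mulr_sumr mulr_suml; apply: eq_bigr => i _; rewrite mulrA.
rewrite -mulr_suml mulrA [X in _ <= X]mulrCA -mulrA (mulrC 9) !mulrA.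
rewrite ler_wpM2r// ler_wpM2r// ?invr_ge0 ?(ltW (d0 _))//.
by apply: ler_pM => //; exact: sumr_ge0.
Qed.

End LargeSieve.

(** * Comparing lattice counts with integrals *)

Section Squares.
Context {R : realType}.
Local Notation mu := (@lebesgue_measure R).
Local Notation mu2 := (mu \x mu)%E.
Local Notation T := (measurableTypeR R).
Local Notation TT := (measurableTypeR R * measurableTypeR R)%type.

Definition ipt (n : int * int) : R * R := (n.1%:~R, n.2%:~R).

(** Half-open, so that the squares partition the plane. *)
Definition cell (n : int) : set T := `[n%:~R - 1/2, n%:~R + 1/2[%classic.
Definition square (n : int * int) : set TT := cell n.1 `*` cell n.2.

Lemma measurable_square n : measurable (square n).
Proof. by apply: measurableX; exact: measurable_itv. Qed.

Lemma cell_inj (m n : int) (x : R) : cell m x -> cell n x -> m = n.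
Proof.
rewrite /cell/= !in_itv/= => /andP[h1 h2] /andP[h3 h4].
have h5 : m%:~R < n%:~R + 1 :> R by lra.
have h6 : n%:~R < m%:~R + 1 :> R by lra.
by move: h5 h6; rewrite -!intrD1 !ltr_int; lia.
Qed.

Lemma square_inj m n x : square m x -> square n x -> m = n.
Proof.
move=> [h1 h2] [h3 h4]; rewrite (surjective_pairing m) (surjective_pairing n).
by rewrite (cell_inj h1 h3) (cell_inj h2 h4).
Qed.

Lemma cell_ex (x : R) : exists n : int, cell n x.
Proof.
exists (Num.floor (x + 1/2)); rewrite /cell/= in_itv/=.
have := Num.Theory.floor_le (x + 1/2); have := floorD1_gt (x + 1/2); rewrite intrD1.
by move=> h1 h2; apply/andP; split; lra.
Qed.

Lemma square_ex (x : R * R) : exists n : int * int, square n x.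
Proof.
have [m hm] := cell_ex x.1; have [n hn] := cell_ex x.2.
by exists (m, n).
Qed.

Lemma square_dist n x : square n x -> `|(ipt n).1 - x.1| <= 1/2 /\ `|(ipt n).2 - x.2| <= 1/2.
Proof.
rewrite /square/cell/= !in_itv/= => -[/andP[h1 h2] /andP[h3 h4]].
by split; rewrite ler_norml; apply/andP; split; lra.
Qed.

Section PackCover.
Variables (K : TT -> R) (S : int * int -> set TT).
Hypothesis mK : measurable_fun setT K.
Hypothesis K0 : forall x, 0 <= K x.
Hypothesis mS : forall n, measurable (S n).
Hypothesis Ssub : forall n, S n `<=` square n.
Local Open Scope ereal_scope.

Let mKE D : measurable D -> measurable_fun D (fun z => (K z)%:E).
Proof. by move=> mD; apply/measurable_EFinP; exact: measurable_funTS. Qed.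

Lemma integral_cells (s : seq (int * int)) : uniq s ->
  \int[mu2]_(z in \big[setU/set0]_(n <- s) S n) (K z)%:E =
  \sum_(n <- s) \int[mu2]_(z in S n) (K z)%:E.
Proof.
move=> us; rewrite ge0_integral_bigsetU//.
- apply/trivIsetP => i j _ _ ij; apply/seteqP; split => // x [/Ssub h1 /Ssub h2].
  by move: ij; rewrite (square_inj h1 h2) eqxx.
- by apply: mKE; apply: bigsetU_measurable.
- by move=> z _; rewrite lee_fin.
Qed.

Lemma pack_lower (A : set TT) (s : seq (int * int)) : measurable A -> uniq s ->
  (forall n, n \in s -> S n `<=` A) ->
  \sum_(n <- s) \int[mu2]_(z in S n) (K z)%:E <= \int[mu2]_(z in A) (K z)%:E.
Proof.
move=> mA us sA; rewrite -integral_cells//; apply: ge0_subset_integral => //.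
- exact: bigsetU_measurable.
- exact: mKE.
- by move=> z _; rewrite lee_fin.
- by rewrite -bigcup_seq => z [n /= ns]; exact: sA.
Qed.

Lemma cover_upper (A : set TT) (s : seq (int * int)) : measurable A -> uniq s ->
  (forall x, A x -> exists2 n, n \in s & S n x) ->
  \int[mu2]_(z in A) (K z)%:E <= \sum_(n <- s) \int[mu2]_(z in S n) (K z)%:E.
Proof.
move=> mA us As; rewrite -integral_cells//; apply: ge0_subset_integral => //.
- exact: bigsetU_measurable.
- by apply: mKE; exact: bigsetU_measurable.
- by move=> z _; rewrite lee_fin.
- by rewrite -bigcup_seq => z /As[n ns Sz]; exists n.
Qed.

End PackCover.

Lemma square_measure n : mu2 (square n) = 1%E.
Proof.
rewrite product_measure1E /cell; [|exact: measurable_itv|exact: measurable_itv].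
rewrite /= !lebesgue_measure_itv/= !lte_fin.
rewrite !ifT; [|lra|lra].
by rewrite -!EFinB -EFinM; congr (_%:E); lra.
Qed.

Lemma square_integral1 n : (\int[mu2]_(z in square n) (1 : R)%:E = 1)%E.
Proof.
by rewrite integral_cst; [rewrite mul1e; exact: square_measure|exact: measurable_square].
Qed.

End Squares.

Section LatticeCount.
Context {R : realType}.
Local Notation mu := (@lebesgue_measure R).
Local Notation mu2 := (mu \x mu)%E.
Local Notation T := (measurableTypeR R).
Local Notation TT := (measurableTypeR R * measurableTypeR R)%type.
Variables (O : set (R * R)) (c M : R).
Hypothesis bO : body O c M.

Lemma finite_int_box (N : nat) : finite_set [set z : int | `|z| <= N%:Z].
Proof.
apply: (@sub_finite_set _ _ ((fun i : nat => i%:Z - N%:Z) @` `I_(N + N).+1)).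
  move=> z /= hz; exists (absz (z + N%:Z)) => /=; lia.
by apply: finite_image; exact: finite_II.
Qed.

Lemma lattice_ptsE t n : 0 < t -> lattice_pts O t n <-> dil t O (ipt n).
Proof.
move=> t0; rewrite /lattice_pts /dil /ipt/=; split=> [[x [Ox [<- <-]]]|Ox].
  by rewrite !mulKf ?gt_eqF// -surjective_pairing.
by eexists; split; first exact: Ox; rewrite /= !mulVKf ?gt_eqF.
Qed.

(** [fset_set] enumerates a set only when it is finite; this makes [Ncount] the true count. *)
Lemma lattice_finite t : 0 < t -> finite_set (lattice_pts O t).
Proof.
move=> t0; have [_ _ _ OM _] := bO.
pose N := (Num.truncn (t * M)).+1.
have hN : t * M < N%:R by exact: truncnS_gt.
have bx := finite_setX (finite_int_box N) (finite_int_box N).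
apply: sub_finite_set bx => n [x [/OM[h1 h2] [e1 e2]]].
have hz (x' : R) (z : int) : `|x'| <= M -> t * x' = z%:~R -> `|z| <= N%:Z.
  move=> hx e; rewrite -(ler_int R) intr_norm -e normrM (gtr0_norm t0).
  by rewrite (le_trans _ (ltW hN))// ler_wpM2l// ltW.
by split => /=; [exact: hz h1 e1|exact: hz h2 e2].
Qed.

Definition lat (t : R) : seq (int * int) := fset_set (lattice_pts O t).

Lemma lat_uniq t : uniq (lat t). Proof. exact: fset_uniq. Qed.

Lemma latP t n : 0 < t -> n \in lat t <-> dil t O (ipt n).
Proof.
move=> t0; rewrite -lattice_ptsE// /lat.
have -> : (n \in (fset_set (lattice_pts O t) : seq _)) = (n \in fset_set (lattice_pts O t)) by [].
by rewrite (in_fset_set (lattice_finite t0)); split => [/set_mem|/mem_set].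
Qed.

Lemma Ncount_size t : Ncount O t = (size (lat t))%:R.
Proof. by []. Qed.

Lemma measurable_dil_body t : measurable (dil t O : set TT).
Proof. by apply: measurable_dil; exact: measurable_body bO. Qed.

Lemma body_measure_fin : mu2 O \is a fin_num.
Proof.
rewrite ge0_fin_numE//.
have [_ _ _ OM _] := bO.
pose bx : set TT := `[-M, M]%classic `*` `[-M, M]%classic.
apply: (@le_lt_trans _ _ (mu2 bx)).
  apply: le_measure.
  - by apply/mem_set; exact: measurable_body bO.
  - by apply/mem_set; apply: measurableX; exact: measurable_itv.
  - by move=> x /OM[]; rewrite !ler_norml; split; rewrite /= in_itv.
rewrite /bx product_measure1E//= !lebesgue_measure_itv/=.
by case: ifP => _; rewrite ?mule0 ?ltry// -!EFinB -EFinM ltry.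
Qed.

(** Slicing with [k = (1, 0)] and [phi = 1] gives [s ^+ 2] times an integral independent of [s],
    which is identified at [s = 1]. *)
Lemma dil_measure t : 0 < t -> mu2 (dil t O) = (t ^+ 2 * area2 O)%:E.
Proof.
move=> t0; have [_ _ _ OM _] := bO.
have mO := measurable_body bO.
have one0 : (1 : R) != 0 by [].
have E s : 0 < s -> mu2 (dil s O) = ((s ^+ 2)%:E * \int[mu]_u (slen O 1%R 0%R u)%:E)%E.
  move=> s0; rewrite -[LHS]mul1e -(integral_cst mu2 (measurable_dil_body s)).
  have := dil_slice_integral (phi := fun=> 1) 0 mO OM s0 one0 (@measurable_cst _ _ _ _ _ _) (fun=> ler01).
  rewrite /= => ->.
  rewrite -ge0_integralZl//; last 3 first.
  - by apply/measurable_EFinP; exact: measurable_slen.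
  - by move=> u _; rewrite lee_fin slen_ge0.
  - by rewrite lee_fin sqr_ge0.
  by apply: eq_integral => u _; rewrite mul1r EFinM.
have d1 : dil 1 O = O.
  by apply/seteqP; split => -[x y]; rewrite /dil/= invr1 !mul1r.
have := E 1 ltr01; rewrite d1 expr1n mul1e => A.
by rewrite E// -A -(fineK body_measure_fin) -EFinM.
Qed.

Lemma area2_ge0 : 0 <= area2 O.
Proof. by rewrite fine_ge0. Qed.

Let c0 : 0 < c := body_c_gt0 bO.

Lemma lat_mono s t : 0 < s -> s <= t -> {subset lat s <= lat t}.
Proof.
move=> s0 st n; have t0 : 0 < t := lt_le_trans s0 st.
by move=> /(latP n s0) h; apply/(latP n t0); exact: (dil_mono bO s0 st).
Qed.

Lemma size_lat_mono s t : 0 < s -> s <= t -> (size (lat s) <= size (lat t))%N.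
Proof. by move=> s0 st; apply: uniq_leq_size (lat_uniq s) _; exact: lat_mono. Qed.

Lemma count_lat s t : 0 < s -> s <= t -> count (mem (lat s)) (lat t) = size (lat s).
Proof.
move=> s0 st; rewrite -size_filter; apply: perm_size; apply: uniq_perm.
- exact: filter_uniq (lat_uniq t).
- exact: lat_uniq.
- move=> n; rewrite mem_filter/=; case E : (n \in lat s) => //=.
  exact: (lat_mono s0 st).
Qed.

Section Sandwich.
Variables (K : TT -> R) (a tau : R).
Hypothesis mK : measurable_fun setT K.
Hypothesis K0 : forall x, 0 <= K x.
Hypothesis a0 : 0 <= a.

Definition near_square (n : int * int) : set TT :=
  square n `&` ([set x : T | `|(ipt n).1 - x| <= a] `*` [set x : T | `|(ipt n).2 - x| <= a]).

Lemma measurable_near_square n : measurable (near_square n).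
Proof.
apply: measurableI; first exact: measurable_square.
have h (p : R) : measurable ([set x : T | `|p - x| <= a]).
  rewrite (_ : [set x : T | `|p - x| <= a] = `[p - a, p + a]%classic); first exact: measurable_itv.
  by apply/seteqP; split => x /=; rewrite in_itv/= ler_distlC.
by apply: measurableX; exact: h.
Qed.

Hypothesis Ksq : forall n, (\int[mu2]_(z in square n) (K z)%:E = 1)%E.
Hypothesis Knear : forall n, ((1 - tau)%:E <= \int[mu2]_(z in near_square n) (K z)%:E)%E.
Hypothesis Kfar : forall n, (\int[mu2]_(z in square n `\` near_square n) (K z)%:E <= tau%:E)%E.

Lemma sum_count_if (s : seq (int * int)) (P : pred (int * int)) (x y : R) :
  \sum_(n <- s) (if P n then x else y) = (size s)%:R * y + (count P s)%:R * (x - y).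
Proof.
elim: s => [|n s IH]; first by rewrite big_nil !mul0r addr0.
by rewrite big_cons IH /= natrD -natr1; case: (P n); rewrite /= ?mulr1n ?mulr0n; ring.
Qed.

(** A lattice point of [(t - 1/c) O] has its whole square inside [t O] and counts fully; only the
    remaining points near the boundary lose the mass [tau]. As [tau] will be of order [1/r], losing
    it at all of the about [r^2] points would be too much. *)
Lemma sandwich_upper t : c^-1 < t ->
  (((size (lat t))%:R - tau * ((size (lat t))%:R - (size (lat (t - c^-1)))%:R))%:E <=
  \int[mu2]_(z in dil (t + a / c) O) (K z)%:E)%E.
Proof.
move=> ct; have ci0 : 0 < c^-1 by rewrite invr_gt0.
have t0 : 0 < t by apply: lt_trans ct.
have tc0 : 0 < t - c^-1 by rewrite subr_gt0.
have tct : t - c^-1 <= t by rewrite gerBl ltW.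
have ac0 : 0 <= a / c by rewrite divr_ge0// ltW.
pose S n := if n \in lat (t - c^-1) then square n else near_square n.
have mS n : measurable (S n).
  by rewrite /S; case: ifP => _; [exact: measurable_square|exact: measurable_near_square].
have Ss n : S n `<=` square n by rewrite /S; case: ifP => _ // x [].
apply: le_trans (pack_lower mK K0 mS Ss (measurable_dil_body _) (lat_uniq t) _); last first.
  move=> n nt x; rewrite /S; case: ifP => [/(latP n tc0) nO /square_dist[h1 h2]|_ [_ [h1 h2]]].
    apply: (dil_mono bO t0); first by rewrite lerDl.
    rewrite (_ : t = t - c^-1 + 1 / c); last by rewrite div1r subrK.
    by apply: (dil_shift bO tc0 _ nO); lra.
  by apply: (dil_shift bO t0 a0 _ h1 h2); apply/(latP n t0).
rewrite [X in (X%:E <= _)%E](_ : _ = \sum_(n <- lat t) (if n \in lat (t - c^-1) then 1 else 1 - tau)); last first.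
  by rewrite sum_count_if count_lat//; ring.
rewrite -sumEFin; apply: lee_sum => n _; rewrite /S; case: ifP => _; last exact: Knear.
by rewrite Ksq.
Qed.

(** A point of [(t - a/c) O] lies in the square of some lattice point of [(t + 1/c) O]. If that
    lattice point is outside [t O], the point cannot be within [a] of it, so such a square
    contributes only its far mass. *)
Lemma sandwich_lower t : c^-1 < t -> a <= 1/2 ->
  (\int[mu2]_(z in dil (t - a / c) O) (K z)%:E <=
   ((size (lat t))%:R + tau * ((size (lat (t + c^-1)))%:R - (size (lat t))%:R))%:E)%E.
Proof.
move=> ct a1; have ci0 : 0 < c^-1 by rewrite invr_gt0.
have t0 : 0 < t by apply: lt_trans ct.
have ac1 : a / c < t.
  apply: le_lt_trans ct; rewrite -[X in _ <= X]mul1r ler_wpM2r ?ltW//; lra.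
have tc0 : 0 < t - a / c by rewrite subr_gt0.
have ac0 : 0 <= a / c by rewrite divr_ge0// ltW.
have tct : t <= t + c^-1 by rewrite lerDl ltW.
have tcc : 0 < t + c^-1 by rewrite addr_gt0.
pose S n := if n \in lat t then square n else square n `\` near_square n.
have mS n : measurable (S n).
  rewrite /S; case: ifP => _; first exact: measurable_square.
  by apply: measurableD; [exact: measurable_square|exact: measurable_near_square].
have Ss n : S n `<=` square n by rewrite /S; case: ifP => _ // x [].
apply: (le_trans (cover_upper mK K0 mS Ss (measurable_dil_body _) (lat_uniq (t + c^-1)) _)).
  move=> x xO; have [n nx] := square_ex x; have [h1 h2] := square_dist nx.
  exists n.
    apply/(latP n tcc); apply: (@dil_mono _ _ _ _ bO (t - a / c + 1 / c)).
    - by rewrite addr_gt0// div1r.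
    - by rewrite div1r lerD2r gerBl.
    - by apply: (dil_shift bO tc0 _ xO); rewrite 1?distrC; lra.
  rewrite /S; case: ifPn => // nt; split => // -[_ [/= h3 h4]].
  move/negP: nt; apply; apply/(latP n t0).
  rewrite (_ : t = t - a / c + a / c); last by rewrite subrK.
  by apply: (dil_shift bO tc0 a0 xO); rewrite distrC.
rewrite [X in (_ <= X%:E)%E](_ : _ = \sum_(n <- lat (t + c^-1)) (if n \in lat t then 1 else tau)); last first.
  by rewrite sum_count_if count_lat//; ring.
rewrite -sumEFin; apply: lee_sum => n _; rewrite /S; case: ifP => _; last exact: Kfar.
by rewrite Ksq.
Qed.

End Sandwich.

Lemma lat_size_upper t : c^-1 < t -> (size (lat t))%:R <= (t + c^-1) ^+ 2 * area2 O.
Proof.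
move=> ct; have ci0 : 0 < c^-1 by rewrite invr_gt0.
have t0 : 0 < t by apply: lt_trans ct.
rewrite -lee_fin -dil_measure ?addr_gt0// -[leRHS]mul1e -(integral_cst mu2 (measurable_dil_body _)).
apply: le_trans (@pack_lower _ (fun=> 1) (@square R) _ _ _ _ _ (lat t) (measurable_dil_body _) (lat_uniq t) _) => //.
- rewrite (eq_bigr (fun=> 1%E)) => [|n _]; last first.
    exact: square_integral1.
  by rewrite sumEFin lee_fin big_const_seq count_predT iter_addr_0.
- exact: measurable_square.
- by move=> n; exact: subset_refl.
- move=> n /(latP n t0) nO x /square_dist[h1 h2].
  by rewrite -(div1r c); apply: (dil_shift bO t0 _ nO); lra.
Qed.

Lemma lat_size_lower t : c^-1 < t -> (t - c^-1) ^+ 2 * area2 O <= (size (lat t))%:R.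
Proof.
move=> ct; have ci0 : 0 < c^-1 by rewrite invr_gt0.
have t0 : 0 < t by apply: lt_trans ct.
have tc0 : 0 < t - c^-1 by rewrite subr_gt0.
rewrite -lee_fin -dil_measure// -[leLHS]mul1e -(integral_cst mu2 (measurable_dil_body _)).
apply: (le_trans (@cover_upper _ (fun=> 1) (@square R) _ _ _ _ _ (lat t) (measurable_dil_body _) (lat_uniq t) _)) => //.
- exact: measurable_square.
- by move=> n; exact: subset_refl.
- move=> x xO; have [n nx] := square_ex x; have [h1 h2] := square_dist nx.
  exists n => //; apply/(latP n t0).
  rewrite (_ : t = t - c^-1 + 1 / c); last by rewrite div1r subrK.
  by apply: (dil_shift bO tc0 _ xO); rewrite 1?distrC; lra.
- rewrite (eq_bigr (fun=> 1%E)) => [|n _]; last first.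
    exact: square_integral1.
  by rewrite sumEFin lee_fin big_const_seq count_predT iter_addr_0.
Qed.

(** The squares of these points are disjoint and lie in a slightly thicker annulus, whose area is
    linear in [m]. *)
Lemma annulus_count (m : R) (s : seq (int * int)) : c^-1 < m -> uniq s ->
  (forall n, n \in s -> dil (m + 1) O (ipt n) /\ ~ dil m O (ipt n)) ->
  (size s)%:R <= ((m + 1 + c^-1) ^+ 2 - (m - c^-1) ^+ 2) * area2 O.
Proof.
move=> cm us hs; have ci0 : 0 < c^-1 by rewrite invr_gt0.
have m0 : 0 < m by apply: lt_trans cm.
have m1 : 0 < m + 1 by rewrite addr_gt0.
have mc0 : 0 < m - c^-1 by rewrite subr_gt0.
have sub : dil (m - c^-1) O `<=` dil (m + 1 + c^-1) O.
  by move=> x; apply: (dil_mono bO) => //; lra.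
have mD := measurable_dil_body.
have mc1 : 0 < m + 1 + c^-1 by rewrite addr_gt0.
rewrite -lee_fin mulrBl EFinB -!dil_measure//.
have -> : (mu2 (dil (m + 1 + c^-1) O) - mu2 (dil (m - c^-1) O) =
    \int[mu2]_(z in dil (m + 1 + c^-1) O `\` dil (m - c^-1) O) (1 : R)%:E)%E.
  rewrite integral_cst; last exact: measurableD.
  rewrite mul1e measureD; [|exact: mD|exact: mD|by have := dil_measure mc1 => /= ->; rewrite ltry].
  by rewrite (setIidr sub).
apply: le_trans (@pack_lower _ (fun=> 1) (@square R) _ _ _ _ _ s _ us _) => //.
- rewrite (eq_bigr (fun=> 1%E)) => [|n _]; last exact: square_integral1.
  by rewrite sumEFin lee_fin big_const_seq count_predT iter_addr_0.
- exact: measurable_square.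
- by move=> n; exact: subset_refl.
- exact: measurableD.
- move=> n /hs[h1 h2] x /square_dist[d1 d2]; split.
    by rewrite -(div1r c); apply: (dil_shift bO m1 _ h1); lra.
  move=> xO; apply: h2; rewrite (_ : m = m - c^-1 + 1 / c); last by rewrite div1r subrK.
  by apply: (dil_shift bO mc0 _ xO); rewrite 1?distrC; lra.
Qed.

End LatticeCount.

(** * The double sum over lattice points *)

Section ElementarySums.
Context {R : realType}.

(** Induction needs the sharper bound [3 - 2 / N.+1%:R], whose increments dominate the terms. *)
Lemma sum_inv_sq_le (N : nat) : \sum_(d < N) (1 + d%:R ^+ 2)^-1 <= 3 :> R.
Proof.
suff h : \sum_(d < N.+1) (1 + d%:R ^+ 2)^-1 <= 3 - 2 / N.+1%:R :> R.
  apply: le_trans (_ : \sum_(d < N.+1) (1 + d%:R ^+ 2)^-1 <= 3).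
    by rewrite big_ord_recr/= lerDl invr_ge0 addr_ge0// sqr_ge0.
  by apply: (le_trans h); rewrite gerBl divr_ge0.
elim: N => [|N IH]; first by rewrite big_ord_recr big_ord0/= expr0n/= add0r addr0 invr1; lra.
rewrite big_ord_recr/=; apply: (le_trans (lerD IH (lexx _))).
rewrite -!natr1; have n0 : 0 <= N%:R :> R by [].
set n : R := N%:R in n0 *.
have h1 : 0 < n + 1 by lra.
have h2 : 0 < n + 1 + 1 by lra.
have h3 : 0 < 1 + (n + 1) ^+ 2 by rewrite ltr_pwDl// sqr_ge0.
rewrite -subr_ge0 (_ : _ - _ = ((2 * (1 + (n + 1) ^+ 2) - (n + 1) * (n + 2)) / ((n + 1) * (n + 1 + 1) * (1 + (n + 1) ^+ 2)))).
  by rewrite divr_ge0 ?mulr_ge0 ?(ltW h1) ?(ltW h2) ?(ltW h3)//; nra.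
by field; rewrite !gt_eqF.
Qed.

Lemma sum_inv_dist_sq_le (N B : nat) :
  \sum_(m < N) (1 + (B%:R - m%:R) ^+ 2)^-1 <= 6 :> R.
Proof.
have ge0 (x : R) : 0 <= (1 + x ^+ 2)^-1 by rewrite invr_ge0 addr_ge0// sqr_ge0.
apply: (@le_trans _ _ (\sum_(m < B.+1 + N) (1 + (B%:R - m%:R) ^+ 2)^-1)).
  rewrite addnC big_split_ord/= lerDl; exact: sumr_ge0.
rewrite big_split_ord/= (_ : 6 = 3 + 3); last by lra.
apply: lerD.
  rewrite (reindex_inj rev_ord_inj)/=; apply: le_trans (sum_inv_sq_le B.+1).
  apply: ler_sum => i _; rewrite subSS natrB; last by rewrite -ltnS.
  by rewrite subKr.
apply: le_trans (sum_inv_sq_le N.+1); rewrite big_ord_recl/=.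
rewrite ler_wpDl//; apply: ler_sum => i _; rewrite /bump/= add1n addSnnS natrD.
by rewrite opprD addrA subrr sub0r sqrrN.
Qed.

Lemma sum_inv_le_ln (N : nat) : \sum_(m < N.+1) m.+1%:R^-1 <= 1 + ln N.+1%:R :> R.
Proof.
elim: N => [|N IH]; first by rewrite big_ord_recr big_ord0/= add0r invr1 ln1 addr0.
rewrite big_ord_recr/=; apply: (le_trans (lerD IH (lexx _))); rewrite -addrA lerD2l.
have : ln (N.+1%:R / N.+2%:R) <= N.+1%:R / N.+2%:R - 1 :> R.
  have := expR_ge1Dx (ln (N.+1%:R / N.+2%:R) : R); rewrite lnK ?posrE//.
  set q : R := _ / _; set w := ln q; lra.
rewrite ln_div ?posrE//.
have -> : N.+1%:R / N.+2%:R - 1 = - N.+2%:R^-1 :> R.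
  have -> : N.+1%:R = N.+2%:R - 1 :> R by rewrite -[N.+2%:R]natr1 addrK.
  by rewrite mulrBl mulfV ?gt_eqF//; ring.
set L1 := ln N.+1%:R; set L2 := ln N.+2%:R; set L3 := N.+2%:R^-1; lra.
Qed.

(** Multiplied by the new root [y], the induction step is [2 x y <= x^2 + y^2]. *)
Lemma sum_inv_sqrt_le (N : nat) : \sum_(m < N) (Num.sqrt m.+1%:R)^-1 <= 2 * Num.sqrt N%:R :> R.
Proof.
elim: N => [|N IH]; first by rewrite big_ord0 mulr_ge0// sqrtr_ge0.
rewrite big_ord_recr/=; apply: (le_trans (lerD IH (lexx _))).
set x : R := Num.sqrt N%:R; set y : R := Num.sqrt N.+1%:R.
have y0 : 0 < y by rewrite sqrtr_gt0.
have xy : y ^+ 2 = x ^+ 2 + 1 by rewrite !sqr_sqrtr// natr1.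
rewrite -(ler_pM2r y0) mulrDl mulVf ?gt_eqF//.
by have := sqr_ge0 (x - y); rewrite !expr2 in xy *; lra.
Qed.

End ElementarySums.

(** * Counting frequencies by the value of [rho_star] *)

Section PolarBody.
Context {R : realType}.
Variables (O : set (R * R)) (c M : R).
Hypothesis bO : body O c M.

(* Its dilates are the sets {rho^* < t}, so lattice counts for convex bodies also count
   frequencies by the value of rho^*. *)
Definition polar : set (R * R) := [set x | rho_star O x < 1].

(** The upper and lower linear bounds on [rho_star] exchange their roles. On the square of half-side
    [(4 * M)^-1] the value is at most 1/2, which leaves the inequality strict. *)
Lemma body_polar : body polar (4 * M)^-1 c^-1.
Proof.
have c0 := body_c_gt0 bO; have cM := body_cM bO.
have M0 : 0 < M by exact: lt_le_trans cM.
split.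
- by rewrite invr_gt0 mulr_gt0.
- apply/open2P => x x1; have x1' : rho_star O x < 1 := x1.
  exists ((1 - rho_star O x) / (2 * M)); first by rewrite divr_gt0 ?subr_gt0// mulr_gt0.
  move=> y; rewrite !ltr_pdivlMr ?mulr_gt0// => h1 h2; rewrite /polar/=.
  have := rhoD bO x (y.1 - x.1, y.2 - x.2); rewrite /= !subrKC -surjective_pairing => /le_lt_trans; apply.
  have := rho_le bO (y.1 - x.1, y.2 - x.2); rewrite /= distrC (distrC y.2); lra.
- move=> x y l; rewrite /polar/= => hx hy /andP[l0 l1].
  apply: (@le_lt_trans _ _ ((1 - l) * rho_star O x + l * rho_star O y)).
    apply: (rho_lub bO) => z Oz; have h1 := rho_ub bO x Oz; have h2 := rho_ub bO y Oz.
    have l2 : 0 <= 1 - l by lra.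
    have := ler_wpM2l l0 h2; have := ler_wpM2l l2 h1; rewrite /dot2/=; lra.
  have [->|ln0] := eqVneq l 0; first by lra.
  have lp : 0 < l by rewrite lt_neqAle eq_sym ln0.
  have l2 : 0 <= 1 - l by lra.
  have := ler_wpM2l l2 (ltW hx); have : l * rho_star O y < l * 1 by rewrite ltr_pM2l.
  lra.
- move=> x; rewrite /polar/= => hx; have := rho_ge bO x => h.
  have : c * (`|x.1| + `|x.2|) <= 1 by lra.
  rewrite mulrC -ler_pdivlMr// div1r => h2.
  by split; apply: le_trans h2; rewrite ?lerDl ?lerDr.
- move=> x h1 h2; rewrite /polar/=; apply: (le_lt_trans (rho_le bO x)).
  have : `|x.1| + `|x.2| <= (4 * M)^-1 + (4 * M)^-1 by exact: lerD.
  move=> /(ler_wpM2l (ltW M0)) /le_lt_trans; apply.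
  rewrite (_ : M * _ = 1/2); first by lra.
  by field; rewrite gt_eqF.
Qed.

Lemma dil_polar (t : R) x : 0 < t -> dil t polar x <-> rho_star O x < t.
Proof.
move=> t0; rewrite /dil /polar/= (rhoZ bO) ?invr_gt0//.
by rewrite mulrC ltr_pdivrMr// mul1r.
Qed.

(** A shell is an annulus of lattice points for the polar body. The annulus estimate requires [m]
    above [B]; the finitely many smaller shells lie in a dilate of bounded size. *)
Lemma shell_count : exists2 C : R, 0 <= C &
  forall (m : nat) (s : seq (int * int)), uniq s ->
    (forall n, n \in s -> m%:R <= rho_star O (ipt n) < m.+1%:R) ->
    (size s)%:R <= C * m.+1%:R.
Proof.
have bP := body_polar; set B := ((4 * M)^-1)^-1.
have B0 : 0 < B by rewrite invr_gt0 (body_c_gt0 bP).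
have A0 := area2_ge0 polar.
set A := area2 polar in A0.
exists (((1 + 2 * B) * 2 + (2 + 3 * B) ^+ 2) * A).
  by rewrite mulr_ge0// addr_ge0 ?sqr_ge0// mulr_ge0// addr_ge0// mulr_ge0// ltW.
move=> m s us hs.
have m0 : 0 <= m%:R :> R by [].
rewrite -natr1.
have q0 : 0 <= (2 + 3 * B) ^+ 2 * A by rewrite mulr_ge0// sqr_ge0.
have q1 : 0 <= (1 + 2 * B) * A by rewrite mulr_ge0//; lra.
have q2 := mulr_ge0 q0 m0; have q3 := mulr_ge0 q1 m0.
have [mB|mB] := ltP B m%:R.
  apply: (le_trans (annulus_count bP mB us _)).
    move=> n /hs /andP[h1 h2]; rewrite !dil_polar; [|lra|lra].
    by rewrite natr1 h2; split => //; rewrite ltNge h1.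
  rewrite -/B -/A (_ : (m%:R + 1 + B) ^+ 2 - (m%:R - B) ^+ 2 = (1 + 2 * B) * (2 * m%:R + 1)); last by ring.
  lra.
have tB : B < m%:R + 1 + B by lra.
apply: (@le_trans _ _ (size (lat polar (m%:R + 1 + B)))%:R).
  rewrite ler_nat; apply: uniq_leq_size => // n /hs/andP[h1 h2].
  by apply/(latP bP n); [lra|apply/dil_polar; [lra|rewrite -natr1 in h2; lra]].
apply: (le_trans (lat_size_upper bP tB)); rewrite -/B -/A.
have : (m%:R + 1 + B + B) ^+ 2 * A <= (2 + 3 * B) ^+ 2 * A.
  by rewrite ler_wpM2r// lerXn2r ?nnegrE; lra.
lra.
Qed.

Lemma sum_over_shells : exists2 C : R, 0 <= C &
  forall (N : nat) (s : seq (int * int)) (F : int * int -> R) (f : nat -> R), uniq s ->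
    (forall m, 0 <= f m) ->
    (forall n, n \in s -> 0 <= rho_star O (ipt n) < N%:R) ->
    (forall n, n \in s -> F n <= f (Num.truncn (rho_star O (ipt n)))) ->
    \sum_(n <- s) F n <= C * \sum_(m < N) m.+1%:R * f m.
Proof.
have [C C0 hC] := shell_count; exists C => // N s F f us f0 sN sF.
pose tr n := Num.truncn (rho_star O (ipt n)).
have trN n : n \in s -> (tr n < N)%N.
  move=> /sN/andP[h1 h2]; rewrite -(ltr_nat R); apply: le_lt_trans h2.
  by have /andP[] := truncn_itv h1.
apply: (@le_trans _ _ (\sum_(n <- s) f (tr n))).
  by rewrite big_seq [X in _ <= X]big_seq; apply: ler_sum => n ns; exact: sF.
have -> : \sum_(n <- s) f (tr n) = \sum_(m < N) \sum_(n <- s | tr n == m) f m.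
  rewrite (exchange_big_dep xpredT)//= big_seq [RHS]big_seq; apply: eq_bigr => n ns.
  rewrite (bigD1 (Ordinal (trN n ns)))//= big1 ?addr0// => i /andP[/eqP h1 h2].
  by move: h2; rewrite -val_eqE/= h1 eqxx.
rewrite mulr_sumr; apply: ler_sum => m _.
rewrite big_const_seq iter_addr_0 -[f m *+ _]mulr_natl mulrA ler_wpM2r//.
rewrite -size_filter; apply: hC; first exact: filter_uniq.
move=> n; rewrite mem_filter => /andP[/eqP <- ns].
by have /andP[h _] := sN _ ns; exact: truncn_itv.
Qed.

Definition nmax (n : int * int) : R := Num.max `|n.1%:~R| `|n.2%:~R|.
(** The weight [|n|^{-3/2}] in the sup norm: the decay that the cap hypothesis gives to the slices
    in direction [n]. *)
Definition qwt (n : int * int) : R := (nmax n * Num.sqrt (nmax n))^-1.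

Lemma nmax_ge1 n : n != (0, 0) -> 1 <= nmax n.
Proof.
move=> n0; rewrite /nmax le_max -!intr_norm -[1]/(1%:~R) !ler_int.
by move: n0; rewrite -pair_eqE /= negb_and; case/orP; lia.
Qed.

Lemma rho_nmax n : rho_star O (ipt n) <= 2 * M * nmax n.
Proof.
have c0 := body_c_gt0 bO; have cM := body_cM bO.
apply: (le_trans (rho_le bO _)).
have h1 : `|(ipt n).1| <= nmax n :> R by rewrite /nmax le_max lexx.
have h2 : `|(ipt n).2| <= nmax n :> R by rewrite /nmax le_max lexx orbT.
have M0 : 0 <= M by lra.
by have := ler_wpM2l M0 (lerD h1 h2); lra.
Qed.

Lemma nmax_rho n : c * nmax n <= rho_star O (ipt n).
Proof.
have c0 := body_c_gt0 bO; apply: le_trans (rho_ge bO _); rewrite ler_wpM2l ?(ltW c0)//.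
by rewrite /nmax ge_max lerDl lerDr !normr_ge0.
Qed.

Lemma nmax_shell n (m := Num.truncn (rho_star O (ipt n))) : n != (0, 0) ->
  m.+1%:R / (2 * M + 1) <= nmax n.
Proof.
move=> n0; have c0 := body_c_gt0 bO; have cM := body_cM bO.
have n1 := nmax_ge1 n0; have h := nmax_rho n; have h2 := rho_nmax n.
have r0 : 0 <= rho_star O (ipt n).
  by apply: le_trans h; rewrite mulr_ge0//; lra.
have /andP[h3 _] := truncn_itv r0.
by rewrite ler_pdivrMr -?natr1; [rewrite -/m in h3; lra|lra].
Qed.

(** Shell [m] carries at most of the order of [m] points, each of weight about [1/m], so what
    remains is the bounded sum of [1 / (1 + (B - m)^2)]. The 3 pays for replacing [b] and [rho_star]
    by their integer parts. *)
Lemma sum_rho_inv : exists2 C : R, 0 <= C & forall (N : nat) (s : seq (int * int)) (b : R),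
  uniq s -> 0 <= b ->
  (forall n, n \in s -> n != (0, 0) /\ rho_star O (ipt n) < N%:R) ->
  \sum_(n <- s) (nmax n)^-1 / (1 + (b - rho_star O (ipt n)) ^+ 2) <= C.
Proof.
have c0 := body_c_gt0 bO; have cM := body_cM bO.
have [C C0 hC] := sum_over_shells.
set D := 2 * M + 1; have D0 : 0 < D by rewrite /D; lra.
exists (C * (D * 3 * 6)); first by rewrite !mulr_ge0// ltW.
move=> N s b us b0 hs.
pose B := Num.truncn b.
pose f (m : nat) := D / m.+1%:R * (3 / (1 + (B%:R - m%:R) ^+ 2)).
have d0 (x : R) : 0 < 1 + x ^+ 2 by rewrite ltr_pwDl// sqr_ge0.
have f0 m : 0 <= f m by rewrite /f mulr_ge0// divr_ge0// ltW.
apply: (le_trans (hC N s _ f us f0 _ _)).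
- move=> n /hs[n0 ->]; rewrite andbT; apply: le_trans (nmax_rho n).
  by rewrite mulr_ge0 ?(ltW c0)// (le_trans ler01)// nmax_ge1.
- move=> n /hs[n0 hn]; have h1 := nmax_shell n0; have n1 := nmax_ge1 n0.
  have r0 : 0 <= rho_star O (ipt n).
    by apply: le_trans (nmax_rho n); rewrite mulr_ge0 ?(ltW c0)//; lra.
  rewrite /f; apply: ler_pM; rewrite ?invr_ge0 ?(ltW (d0 _))//; first by lra.
    by rewrite -[leRHS]invrK lef_pV2 ?posrE ?invf_div//; [lra|rewrite divr_gt0].
  rewrite ler_pdivlMr// mulrC ler_pdivrMr//.
  have /andP[g1 g2] := truncn_itv r0; have /andP[g3 g4] := truncn_itv b0.
  rewrite -/B in g3 g4; move: g1 g2 g3 g4; rewrite -!natr1.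
  set m : R := (Num.truncn _)%:R; set rr := rho_star _ _; set bb : R := B%:R => g1 g2 g3 g4.
  have : (bb - m) ^+ 2 <= (`|b - rr| + 1) ^+ 2.
    rewrite -[X in X <= _](real_normK (num_real _)) lerXn2r ?nnegrE ?addr_ge0//.
    rewrite ler_norml; have := ler_norm (b - rr); have := ler_norm (- (b - rr)).
    by rewrite normrN => g5 g6; apply/andP; split; lra.
  rewrite -[(b - rr) ^+ 2](real_normK (num_real _)); set d := `|b - rr|.
  by set u := (bb - m) ^+ 2; have := sqr_ge0 (d - 1); have := sqr_ge0 d; rewrite !expr2; lra.
rewrite ler_wpM2l//.
rewrite (eq_bigr (fun m : 'I_N => D * 3 * (1 + (B%:R - m%:R) ^+ 2)^-1)); last first.
  by move=> m _; rewrite /f; field; rewrite gt_eqF//= natr1 pnatr_eq0.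
by rewrite -mulr_sumr ler_wpM2l ?mulr_ge0 ?(ltW D0)//; exact: sum_inv_dist_sq_le.
Qed.

(** By AM-GM and symmetry the weight becomes [|k|^{-2} |l|^{-1}]. The sum over [l] is then bounded
    uniformly by [sum_rho_inv], and the sum of [|k|^{-2}] over shells is harmonic, which is where
    the logarithm comes from. *)
Lemma lattice_double_sum : exists2 C : R, 0 <= C & forall (N : nat) (s : seq (int * int)),
  uniq s -> (forall n, n \in s -> n != (0, 0) /\ rho_star O (ipt n) < N.+1%:R) ->
  \sum_(k <- s) \sum_(l <- s) qwt k * qwt l / (1 + (rho_star O (ipt k) - rho_star O (ipt l)) ^+ 2)
    <= C * (1 + ln N.+1%:R) /\
  \sum_(k <- s) qwt k <= C * Num.sqrt N.+1%:R.
Proof.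
have c0 := body_c_gt0 bO; have cM := body_cM bO.
have [C1 C10 h1] := sum_over_shells.
have [C2 C20 h2] := sum_rho_inv.
set D := 2 * M + 1; have D0 : 0 < D by rewrite /D; lra.
have d0 (x : R) : 0 < 1 + x ^+ 2 by rewrite ltr_pwDl// sqr_ge0.
exists (C2 * (C1 * D ^+ 2) + C1 * (D * Num.sqrt D) * 2).
  by rewrite addr_ge0// !mulr_ge0// ltW.
move=> N s us hs.
have ln0 : 0 <= ln N.+1%:R :> R by rewrite ln_ge0// ler1n.
have sN n : n \in s -> 0 <= rho_star O (ipt n) < N.+1%:R.
  move=> /hs[n0 ->]; rewrite andbT; apply: le_trans (nmax_rho n).
  by rewrite mulr_ge0 ?(ltW c0)// (le_trans ler01)// nmax_ge1.
have t1 : 0 <= C2 * (C1 * D ^+ 2) by rewrite !mulr_ge0// ltW.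
have t2 : 0 <= C1 * (D * Num.sqrt D) * 2 by rewrite !mulr_ge0// ltW.
split; last first.
  apply: (@le_trans _ _ (C1 * (D * Num.sqrt D) * 2 * Num.sqrt N.+1%:R)); last first.
    by rewrite ler_wpM2r ?sqrtr_ge0// lerDr.
  pose f (m : nat) : R := (D * Num.sqrt D) / (m.+1%:R * Num.sqrt m.+1%:R).
  apply: (le_trans (h1 N.+1 s _ f us _ sN _)).
  - by move=> m; rewrite /f divr_ge0// mulr_ge0// ?sqrtr_ge0// ltW.
  - move=> n /hs[n0 _]; have hn := nmax_shell n0; have n1 := nmax_ge1 n0.
    rewrite -/D ler_pdivrMr// in hn.
    set m := Num.truncn _ in hn *; rewrite /qwt /f ler_pdivlMr ?mulr_gt0 ?sqrtr_gt0//.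
    rewrite mulrC ler_pdivrMr ?mulr_gt0 ?sqrtr_gt0//; try lra.
    have : Num.sqrt m.+1%:R <= Num.sqrt (nmax n) * Num.sqrt D.
      by rewrite -sqrtrM ?ler_sqrt ?mulr_ge0//; lra.
    move=> hq; have := ler_pM (ler0n _ _) (sqrtr_ge0 _) hn hq.
    by rewrite mulrACA (mulrC D) (mulrC (nmax n * _)) mulrA.
  have S : \sum_(m < N.+1) m.+1%:R * f m <= D * Num.sqrt D * (2 * Num.sqrt N.+1%:R).
    rewrite (eq_bigr (fun m : 'I_N.+1 => D * Num.sqrt D * (Num.sqrt m.+1%:R)^-1)); last first.
      by move=> m _; rewrite /f; field; rewrite gt_eqF ?sqrtr_gt0//= natr1 pnatr_eq0.
    by rewrite -mulr_sumr ler_wpM2l ?mulr_ge0 ?(ltW D0)//; exact: sum_inv_sqrt_le.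
  by apply: (le_trans (ler_wpM2l C10 S)); rewrite !mulrA.
apply: (@le_trans _ _ (C2 * (C1 * D ^+ 2) * (1 + ln N.+1%:R))); last first.
  by rewrite ler_wpM2r ?addr_ge0// lerDl.
set r := fun n => rho_star O (ipt n).
pose i n := (nmax n)^-1.
have i0 n : n \in s -> 0 < i n.
  by move=> /hs[n0 _]; rewrite /i invr_gt0; have := nmax_ge1 n0; lra.
have amgm k l : k \in s -> l \in s -> qwt k * qwt l <= 2^-1 * (i k ^+ 2 * i l + i l ^+ 2 * i k).
  move=> ks ls; have ik := i0 _ ks; have il := i0 _ ls.
  have q n : n \in s -> qwt n = i n * Num.sqrt (i n).
    move=> ns; have /hs[n0 _] := ns; have n1 := nmax_ge1 n0.
    by rewrite /qwt /i invfM sqrtrV//; lra.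
  rewrite !q//; set x := Num.sqrt (i k); set y := Num.sqrt (i l).
  have xx : i k = x * x by rewrite -expr2 sqr_sqrtr// ltW.
  have yy : i l = y * y by rewrite -expr2 sqr_sqrtr// ltW.
  have := mulr_ge0 (mulr_ge0 (ltW ik) (ltW il)) (sqr_ge0 (x - y)).
  by rewrite expr2 mulrBr !mulrBl -xx -yy !expr2; lra.
apply: (@le_trans _ _ (\sum_(k <- s) \sum_(l <- s) 2^-1 * (i k ^+ 2 * i l + i l ^+ 2 * i k) / (1 + (r k - r l) ^+ 2))).
  rewrite big_seq [leRHS]big_seq; apply: ler_sum => k ks.
  rewrite big_seq [leRHS]big_seq; apply: ler_sum => l ls.
  by rewrite ler_wpM2r ?invr_ge0 ?(ltW (d0 _))//; exact: amgm.
have sym : \sum_(k <- s) \sum_(l <- s) 2^-1 * (i k ^+ 2 * i l + i l ^+ 2 * i k) / (1 + (r k - r l) ^+ 2) =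
   \sum_(k <- s) \sum_(l <- s) i k ^+ 2 * (i l / (1 + (r k - r l) ^+ 2)).
  have E : \sum_(k <- s) \sum_(l <- s) i l ^+ 2 * (i k / (1 + (r k - r l) ^+ 2)) =
      \sum_(k <- s) \sum_(l <- s) i k ^+ 2 * (i l / (1 + (r k - r l) ^+ 2)).
    rewrite exchange_big/=; apply: eq_bigr => k _; apply: eq_bigr => l _.
    by rewrite -(sqrrN (r l - r k)) opprB.
  transitivity (2^-1 * (\sum_(k <- s) \sum_(l <- s) i k ^+ 2 * (i l / (1 + (r k - r l) ^+ 2)) +
     \sum_(k <- s) \sum_(l <- s) i l ^+ 2 * (i k / (1 + (r k - r l) ^+ 2)))).
    rewrite -big_split/= mulr_sumr; apply: eq_bigr => k _.
    by rewrite -big_split/= mulr_sumr; apply: eq_bigr => l _; ring.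
  by rewrite E; field.
rewrite sym.
apply: (@le_trans _ _ (\sum_(k <- s) i k ^+ 2 * C2)).
  rewrite big_seq [leRHS]big_seq; apply: ler_sum => k ks; rewrite -mulr_sumr ler_wpM2l ?sqr_ge0//.
  by apply: (h2 N.+1) => //; have /andP[] := sN _ ks.
rewrite -mulr_suml mulrC -mulrA ler_wpM2l//.
pose f (m : nat) : R := D ^+ 2 / m.+1%:R ^+ 2.
apply: (le_trans (h1 N.+1 s _ f us _ sN _)).
- by move=> m; rewrite /f divr_ge0// sqr_ge0.
- move=> n ns; have /hs[n0 _] := ns; have hn := nmax_shell n0; have n1 := nmax_ge1 n0.
  rewrite /i /f -expr_div_n lerXn2r ?nnegrE ?invr_ge0 ?divr_ge0 ?(ltW D0)//; first by lra.
  by rewrite -[leRHS]invrK lef_pV2 ?posrE ?invf_div//; [lra|rewrite divr_gt0].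
rewrite -mulrA ler_wpM2l//.
rewrite (eq_bigr (fun m : 'I_N.+1 => D ^+ 2 * m.+1%:R^-1)); last first.
  by move=> m _; rewrite /f; field; rewrite ?natr1 ?pnatr_eq0.
by rewrite -mulr_sumr ler_wpM2l ?sqr_ge0//; exact: sum_inv_le_ln.
Qed.

End PolarBody.

(** * The smoothing kernel *)

Section Trigonometry.
Context {R : realType}.
Local Notation mu := (@lebesgue_measure R).

Lemma sinD_int (x : R) (z : int) : sin (x + 2 * pi * z%:~R) = sin x.
Proof.
have E (n : nat) (y : R) : sin (y + 2 * pi * n%:R) = sin y.
  rewrite (_ : _ + _ = y + (pi *+ 2) *+ n); last first.
    by rewrite -(mulr_natr (pi *+ 2)) -(mulr_natr pi 2); ring.
  exact: (periodicn (@sinD2pi R)).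
case: z => n; first by rewrite -pmulrn E.
by rewrite NegzE mulrNz -pmulrn mulrN -[X in _ = sin X](subrK (2 * pi * n.+1%:R)) E.
Qed.

Lemma cosD_int (x : R) (z : int) : cos (x + 2 * pi * z%:~R) = cos x.
Proof. by rewrite -!sinDpihalf addrAC sinD_int. Qed.

Lemma sin_le_id (x : R) : 0 <= x -> sin x <= x.
Proof.
rewrite le_eqVlt => /predU1P[<-|x0]; first by rewrite sin0.
have [|c _] := @MVT R sin cos 0 x x0 (fun t _ => is_derive_sin t).
  by apply: continuous_subspaceT; exact: continuous_sin.
rewrite sin0 !subr0 => ->; rewrite ler_piMl ?cos_le1// ltW//.
Qed.

Lemma norm_sin_mul (n : nat) (x : R) : `|sin (n%:R * x)| <= n%:R * `|sin x|.
Proof.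
elim: n => [|n IH]; first by rewrite !mul0r sin0 normr0.
rewrite -natr1 mulrDl mul1r sinD (le_trans (ler_normD _ _))// mulrDl mul1r lerD//.
  by rewrite normrM (le_trans _ IH)// ler_piMr ?cos_max.
by rewrite normrM ler_piMl ?cos_max.
Qed.

Lemma one_sub_cos (x : R) : 1 - cos (2 * x) = 2 * sin x ^+ 2.
Proof.
rewrite (_ : 2 * x = x *+ 2); last by rewrite mulr2n; ring.
by rewrite cos_mulr2n sin2cos2 mulr2n; ring.
Qed.

Lemma one_sub_cos_le (x : R) : 0 <= x -> 1 - cos (2 * x) <= 2 * x ^+ 2.
Proof.
move=> x0; rewrite one_sub_cos ler_wpM2l//.
have h1 := sin_le_id x0; rewrite -(real_normK (num_real (sin x))).
rewrite lerXn2r ?nnegrE// ler_norml h1 andbT.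
have [x1|x1] := leP x 1; last by have := sin_geN1 x; lra.
have : 0 <= sin x by apply: sin_ge0_pi; rewrite x0/=; have := pi_ge2 R; lra.
lra.
Qed.

(** Since [|sin (n y)| <= n |sin y|], the choice [y = pi / (2n)] gives [1 <= n |sin y|]. *)
Lemma one_sub_cos_ge (n : nat) : (0 < n)%N ->
  2 / n%:R ^+ 2 <= 1 - cos (2 * pi * (2 * n%:R)^-1) :> R.
Proof.
move=> n0; have p0 : 0 < n%:R :> R by rewrite ltr0n.
rewrite (_ : 2 * pi * (2 * n%:R)^-1 = 2 * (pi / 2 / n%:R)); last by field; rewrite gt_eqF.
rewrite one_sub_cos -exprVn ler_wpM2l// -[leRHS](real_normK (num_real _)).
rewrite lerXn2r ?nnegrE ?invr_ge0 ?(ltW p0)//.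
have := norm_sin_mul n (pi / 2 / n%:R).
rewrite mulrC divfK ?gt_eqF// sin_pihalf normr1 => h.
by rewrite -[leLHS]mul1r ler_pdivrMr// mulrC.
Qed.

Lemma Rintegral_cos_period (z n : int) :
  \int[mu]_(x in `[n%:~R - 1/2, n%:~R + 1/2]) cos (2 * pi * z%:~R * x) = (z == 0)%:R.
Proof.
have lt1 : n%:~R - 1/2 < n%:~R + 1/2 :> R by lra.
have [->|z0] := eqVneq z 0.
  under eq_Rintegral do rewrite mulr0 mul0r cos0.
  rewrite Rintegral_cst//= lebesgue_measure_itv/= lte_fin lt1 -EFinB/=; lra.
have p0 : 2 * pi * z%:~R != 0 :> R by rewrite !mulf_neq0 ?intr_eq0// gt_eqF ?pi_gt0.
transitivity (\int[mu]_(x in `[n%:~R - 1/2, n%:~R + 1/2]) cos (2 * pi * z%:~R * x + 0)).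
  by apply: eq_Rintegral => x _; rewrite addr0.
rewrite Rintegral_cos_lin// !addr0.
rewrite (_ : 2 * pi * z%:~R * (n%:~R + 1/2) = 2 * pi * z%:~R * (n%:~R - 1/2) + 2 * pi * z%:~R); last by field.
by rewrite sinD_int subrr mul0r.
Qed.

End Trigonometry.

Section Kernel.
Context {R : realType}.
Local Notation mu := (@lebesgue_measure R).
Variable m : nat.
Hypothesis m2 : (1 < m)%N.

Definition kb (j : nat) : R := sin (pi * j%:R / m%:R).
Definition kB : R := \sum_(j < m) kb j ^+ 2.
Definition zdiff (i j : nat) : int := i%:Z - j%:Z.

(* |sum_j kb j e(jx)|^2 / kB.  The sine weights make the first Fourier coefficient cos(pi/m),
   hence 1 - cos(2 pi x) has mean O(1/m^2) against [kern] and Chebyshev bounds its mass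
   away from the integers. *)
Definition kern (x : R) : R :=
  (\sum_(i < m) \sum_(j < m) kb i * kb j * cos (2 * pi * (zdiff i j)%:~R * x)) / kB.

Let m0 : 0 < m%:R :> R. Proof. by rewrite ltr0n (ltn_trans _ m2). Qed.

Lemma kb_ge0 j : (j <= m)%N -> 0 <= kb j.
Proof.
move=> jm; have p0 : 0 < pi :> R := pi_gt0 R; apply: sin_ge0_pi; apply/andP; split.
  by rewrite divr_ge0 ?mulr_ge0 ?(ltW p0)// ltW.
by rewrite ler_pdivrMr// ler_pM2l// ler_nat.
Qed.

Lemma kb0 : kb 0 = 0. Proof. by rewrite /kb mulr0 mul0r sin0. Qed.
Lemma kbm : kb m = 0. Proof. by rewrite /kb mulfK ?gt_eqF// sinpi. Qed.

Lemma kB_gt0 : 0 < kB.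
Proof.
rewrite /kB (bigD1 (Ordinal m2))//= ltr_pwDl//; last by apply: sumr_ge0 => i _; exact: sqr_ge0.
rewrite exprn_gt0// /kb; apply: sin_gt0_pi.
rewrite mulr1 divr_gt0 ?pi_gt0//= ltr_pdivrMr// -[ltLHS]mulr1 ltr_pM2l ?pi_gt0//.
by rewrite (ltr_nat R 1).
Qed.

Let kB0 := kB_gt0.

Lemma kernE x : kern x = ((\sum_(i < m) kb i * cos (2 * pi * i%:R * x)) ^+ 2 +
  (\sum_(i < m) kb i * sin (2 * pi * i%:R * x)) ^+ 2) / kB.
Proof.
rewrite /kern !expr2 !big_distrlr/= -big_split/=; congr (_ / _).
apply: eq_bigr => i _; rewrite -big_split/=; apply: eq_bigr => j _.
rewrite /zdiff intrB -!pmulrn.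
rewrite (_ : 2 * pi * (i%:R - j%:R) * x = 2 * pi * i%:R * x - 2 * pi * j%:R * x); last by ring.
by rewrite cosB; ring.
Qed.

Lemma kern_ge0 x : 0 <= kern x.
Proof. by rewrite kernE divr_ge0 ?addr_ge0 ?sqr_ge0// ltW. Qed.

Lemma continuous_cos_mul (a : R) : continuous (fun x : R => cos (a * x)).
Proof.
by move=> t; have := @continuous_cos_lin R a 0 t; under [X in continuous_at _ X -> _]eq_fun do rewrite addr0.
Qed.

Lemma continuous_kern : continuous kern.
Proof.
move=> x; apply: cvgM; last exact: cvg_cst.
apply: cvg_big => [|i _]; first exact: add_continuous.
apply: cvg_big => [|j _]; first exact: add_continuous.
by apply: cvgM; [exact: cvg_cst|exact: continuous_cos_mul].
Qed.

Lemma Rintegral_kern_mul (n : int) (w : int) :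
  \int[mu]_(x in `[n%:~R - 1/2, n%:~R + 1/2]) (kern x * cos (2 * pi * w%:~R * x)) =
  (\sum_(i < m) \sum_(j < m) kb i * kb j *
    (2^-1 * ((zdiff i j + w == 0)%:R + (zdiff i j - w == 0)%:R))) / kB.
Proof.
pose g (i j : 'I_m) (x : R) := 2^-1 * (cos (2 * pi * (zdiff i j + w)%:~R * x) + cos (2 * pi * (zdiff i j - w)%:~R * x)).
have cg i j : continuous (g i j).
  move=> x; apply: cvgM; first exact: cvg_cst.
  by apply: cvgD; exact: continuous_cos_mul.
have cg2 (i j : 'I_m) : continuous (fun x => kb i * kb j * g i j x).
  by move=> x; apply: cvgM; [exact: cvg_cst|exact: cg].
transitivity (\int[mu]_(x in `[n%:~R - 1/2, n%:~R + 1/2]) (kB^-1 * \sum_(i < m) \sum_(j < m) kb i * kb j * g i j x)).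
  apply: eq_Rintegral => x _; rewrite /kern mulrAC mulrC; congr (_ * _).
  rewrite mulr_suml; apply: eq_bigr => i _; rewrite mulr_suml; apply: eq_bigr => j _.
  rewrite /g; move: (zdiff i j) => z; rewrite -[kb i * kb j * _ * _]mulrA; congr (_ * _).
  rewrite rmorphD rmorphB /=.
  rewrite (_ : 2 * pi * (_ + _) * x = 2 * pi * z%:~R * x + 2 * pi * w%:~R * x); last by ring.
  rewrite (_ : 2 * pi * (_ - _) * x = 2 * pi * z%:~R * x - 2 * pi * w%:~R * x); last by ring.
  by rewrite cosB cosD; field.
rewrite Rintegral_scale_continuous; last first.
  move=> x; apply: cvg_big => [|i _]; first exact: add_continuous.
  by apply: cvg_big => [|j _]; [exact: add_continuous|exact: cg2].
rewrite mulrC; congr (_ / _); rewrite Rintegral_sum_continuous; last first.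
  by move=> i x; apply: cvg_big => [|j _]; [exact: add_continuous|exact: cg2].
apply: eq_bigr => i _; rewrite Rintegral_sum_continuous//; apply: eq_bigr => j _.
rewrite Rintegral_scale_continuous//; congr (_ * _).
rewrite Rintegral_scale_continuous; last by move=> x; apply: cvgD; exact: continuous_cos_mul.
congr (_ * _); rewrite RintegralD//; [|by apply: continuous_integrable; exact: continuous_cos_mul|by apply: continuous_integrable; exact: continuous_cos_mul].
by rewrite !Rintegral_cos_period.
Qed.

Lemma Rintegral_kern (n : int) :
  \int[mu]_(x in `[n%:~R - 1/2, n%:~R + 1/2]) kern x = 1.
Proof.
have := Rintegral_kern_mul n 0.
under eq_Rintegral do rewrite mulr0 mul0r cos0 mulr1.
move=> ->; rewrite -[RHS](divff (lt0r_neq0 kB0)); congr (_ / _).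
apply: eq_bigr => i _; rewrite (bigD1 i)//= big1 ?addr0.
  by rewrite /zdiff subrr ?addr0 ?subr0 eqxx expr2 /= mulr1n; field.
move=> j ji; rewrite /zdiff ?addr0 ?subr0 subr_eq0 eqz_nat.
have /negbTE -> : (i : nat) != j by rewrite eq_sym.
by rewrite addr0 !mulr0.
Qed.

(** As [kb] vanishes at 0 and at [m], and the neighbours of [kb j] add up to [2 cos (pi / m) kb j],
    the sum of [kb j * kb j.+1] is [cos (pi / m)] times [kB]. *)
Lemma kern_first_coef (n : int) :
  \int[mu]_(x in `[n%:~R - 1/2, n%:~R + 1/2]) (kern x * (1 - cos (2 * pi * x))) =
  1 - cos (pi / m%:R).
Proof.
have c1 : continuous (fun x => kern x * cos (2 * pi * 1%:~R * x)).
  by move=> x; apply: cvgM; [exact: continuous_kern|exact: continuous_cos_mul].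
transitivity (\int[mu]_(x in `[n%:~R - 1/2, n%:~R + 1/2]) (kern x - kern x * cos (2 * pi * 1%:~R * x))).
  by apply: eq_Rintegral => x _; rewrite mulr1; ring.
rewrite RintegralB//; [|by apply: continuous_integrable; exact: continuous_kern|exact: continuous_integrable].
rewrite Rintegral_kern Rintegral_kern_mul; congr (1 - _).
apply: (mulIf (lt0r_neq0 kB0)); rewrite divfK ?gt_eqF//.
pose S := \sum_(j < m) kb j * kb j.+1.
have S1 : \sum_(j < m) kb j * kb j.-1 = S.
  have : \sum_(j < m.+1) kb j * kb j.-1 = S.
    rewrite big_ord_recl kb0 mul0r add0r; apply: eq_bigr => j _.
    by rewrite /bump/= mulrC.
  by rewrite big_ord_recr/= kbm mul0r addr0.
have cosS : cos (pi / m%:R) * kB = S.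
  apply: (mulfI (_ : 2 != 0 :> R)) => //.
  rewrite (_ : 2 * S = S + S); last by ring.
  rewrite -{1}S1 -big_split/= /kB mulrA mulr_sumr; apply: eq_bigr => -[[|j] jm] _ /=.
    by rewrite kb0 expr0n/= !mul0r mulr0 addr0.
  rewrite -mulrDr expr2 mulrCA; congr (_ * _).
  rewrite /kb (_ : pi * j%:R / m%:R = pi * j.+1%:R / m%:R - pi / m%:R); last first.
    by rewrite -[j.+1%:R]natr1; ring.
  rewrite (_ : pi * j.+2%:R / m%:R = pi * j.+1%:R / m%:R + pi / m%:R); last first.
    by rewrite -[j.+2%:R]natr1; ring.
  by rewrite sinB sinD; ring.
rewrite cosS.
have T (P : rel nat) (f : nat -> nat -> R) : (forall i j, P i j = (j == i.+1)) ->
    \sum_(i < m) \sum_(j < m) kb i * kb j * (P i j)%:R = S.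
  move=> hP; apply: eq_bigr => i _.
  have [im|im] := ltnP i.+1 m.
    rewrite (bigD1 (Ordinal im))//= hP eqxx mulr1 big1 ?addr0// => j ji.
    rewrite hP; case: eqP => [e|_]; last by rewrite mulr0.
    by move: ji; rewrite -val_eqE/= e eqxx.
  have e : i.+1 = m by apply/eqP; rewrite eqn_leq im ltn_ord.
  rewrite e kbm mulr0 big1// => j _; rewrite hP; case: eqP => [e2|_]; last by rewrite mulr0.
  by have := ltn_ord j; rewrite e2 e ltnn.
have T1 : \sum_(i < m) \sum_(j < m) kb i * kb j * (zdiff i j + 1 == 0)%:R = S.
  by apply: (T (fun i j => zdiff i j + 1 == 0)) => // i j; rewrite /zdiff; lia.
have T2 : \sum_(i < m) \sum_(j < m) kb i * kb j * (zdiff i j - 1 == 0)%:R = S.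
  rewrite exchange_big/= -T1; apply: eq_bigr => i _; apply: eq_bigr => j _.
  by rewrite (mulrC (kb j)); congr (_ * _%:R); rewrite /zdiff; lia.
rewrite (eq_bigr (fun i : 'I_m => 2^-1 * (\sum_(j < m) kb i * kb j * (zdiff i j + 1 == 0)%:R) +
   2^-1 * (\sum_(j < m) kb i * kb j * (zdiff i j - 1 == 0)%:R))); last first.
  move=> i _; rewrite !mulr_sumr -big_split/=; apply: eq_bigr => j _; ring.
by rewrite big_split/= -!mulr_sumr T1 T2; field.
Qed.

End Kernel.

Section ProductKernel.
Context {R : realType}.
Local Notation mu := (@lebesgue_measure R).
Local Notation mu2 := (mu \x mu)%E.
Local Notation T := (measurableTypeR R).
Local Notation TT := (measurableTypeR R * measurableTypeR R)%type.

Lemma ge0_integral_prod (f g : T -> R) (A B : set T) :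
  measurable A -> measurable B -> measurable_fun setT f -> measurable_fun setT g ->
  (forall x, 0 <= f x) -> (forall x, 0 <= g x) ->
  (\int[mu2]_(z in A `*` B) (f z.1 * g z.2)%:E =
   \int[mu]_(x in A) (f x)%:E * \int[mu]_(y in B) (g y)%:E)%E.
Proof.
move=> mA mB mf mg f0 g0.
have mfA : measurable_fun setT (fun x : T => (f x * \1_A x)%:E).
  by apply/measurable_EFinP; apply: measurable_funM => //; exact: measurable_indic.
have mgB : measurable_fun setT (fun x : T => (g x * \1_B x)%:E).
  by apply/measurable_EFinP; apply: measurable_funM => //; exact: measurable_indic.
pose F (z : TT) := ((f z.1 * \1_A z.1)%:E * (g z.2 * \1_B z.2)%:E)%E.
have mF : measurable_fun setT F.
  apply: emeasurable_funM.
    exact: (measurableT_comp mfA measurable_fst).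
  exact: (measurableT_comp mgB measurable_snd).
have fA0 x : (0 <= (f x * \1_A x)%:E)%E by rewrite lee_fin mulr_ge0.
have gB0 x : (0 <= (g x * \1_B x)%:E)%E by rewrite lee_fin mulr_ge0.
transitivity (\int[mu2]_z F z)%E.
  rewrite integral_mkcond; apply: eq_integral => z _; rewrite /F patchE !indicE -EFinM.
  case: ifPn => [/set_mem[h1 h2]|/negP h]; first by rewrite !mem_set//= !mulr1.
  have [h1|h1] := boolP (z.1 \in A); last by rewrite mulr0 mul0r.
  have [h2|h2] := boolP (z.2 \in B); last by rewrite mulr0 mulr0.
  by exfalso; apply: h; apply/mem_set; split; exact: set_mem.
rewrite (fubini_tonelli1 F)//; last by move=> z; rewrite mule_ge0.
have ind (u : T -> R) (S : set T) : (\int[mu]_(x in S) (u x)%:E = \int[mu]_x (u x * \1_S x)%:E)%E.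
  by rewrite integral_mkcond; apply: eq_integral => x _; rewrite patchE indicE; case: ifP => _; rewrite ?mulr1 ?mulr0.
rewrite (ind f A) (ind g B) -ge0_integralZr//; last by apply: integral_ge0.
apply: eq_integral => x _; rewrite /fubini_F /F /= ge0_integralZl//.
Qed.

Variable m : nat.
Hypothesis m2 : (1 < m)%N.
Let m0 : 0 < m%:R :> R. Proof. by rewrite ltr0n (ltn_trans _ m2). Qed.

Definition kern2 (z : TT) : R := kern m z.1 * kern m z.2.

Lemma measurable_kern : measurable_fun setT (kern m : T -> T).
Proof. exact: continuous_measurable_fun (@continuous_kern R m). Qed.

Lemma measurable_kern2 : measurable_fun setT (kern2 : TT -> T).
Proof.
by apply: measurable_funM; [exact: (measurableT_comp measurable_kern measurable_fst)|
  exact: (measurableT_comp measurable_kern measurable_snd)].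
Qed.

Lemma kern2_ge0 z : 0 <= kern2 z.
Proof. by rewrite mulr_ge0 ?kern_ge0. Qed.

Let mkE (D : set T) (f : R -> R) : continuous f -> measurable_fun D (fun x => (f x)%:E).
Proof.
by move=> cf; apply/measurable_EFinP; apply: measurable_funTS; exact: continuous_measurable_fun.
Qed.

Lemma integral_cell (f : R -> R) n : continuous f ->
  (\int[mu]_(x in cell n) (f x)%:E =
   (\int[mu]_(x in `[n%:~R - 1/2, n%:~R + 1/2]) f x)%:E)%E.
Proof.
move=> cf; rewrite /cell integral_itv_bndo_bndc; last by apply/measurable_funTS; exact: mkE.
by rewrite /Rintegral fineK//; apply: integrable_fin_num => //; exact: continuous_integrable.
Qed.

Lemma integral_kern_cell n : (\int[mu]_(x in cell n) (kern m x)%:E = 1)%E.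
Proof. by rewrite integral_cell ?Rintegral_kern//; exact: (@continuous_kern R m). Qed.

Variable q : nat.
Hypothesis q0 : (0 < q)%N.
Let qr0 : 0 < q%:R :> R. Proof. by rewrite ltr0n. Qed.

Let a : R := (2 * q%:R)^-1.

Definition near1 (n : int) : set T := cell n `&` [set x : T | `|n%:~R - x| <= a].

Lemma measurable_near1 n : measurable (near1 n).
Proof.
apply: measurableI; first exact: measurable_itv.
rewrite (_ : [set x : T | _] = `[n%:~R - a, n%:~R + a]%classic); first exact: measurable_itv.
by apply/seteqP; split => x /=; rewrite in_itv/= ler_distlC.
Qed.

(** Outside the near part, the distance of [x] to the centre of its cell lies between [1/(2q)] and
    1/2, a range on which the cosine of [2 pi] times the distance decreases. *)
Lemma far_cos n x : cell n x -> ~ near1 n x -> 2 / q%:R ^+ 2 <= 1 - cos (2 * pi * x).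
Proof.
move=> cx nx; apply: le_trans (one_sub_cos_ge q0) _; rewrite lerD2l lerN2 -/a.
have ax : a < `|x - n%:~R|.
  by rewrite ltNge distrC; apply/negP => h; apply: nx.
have x2 : `|x - n%:~R| <= 1/2.
  by move: cx; rewrite /cell/= in_itv/= ler_norml => /andP[h1 h2]; apply/andP; split; lra.
have p0 : 0 < pi :> R := pi_gt0 R.
have a0 : 0 < a by rewrite invr_gt0 mulr_gt0.
rewrite -(subrK n%:~R x) mulrDr cosD_int.
have -> : cos (2 * pi * (x - n%:~R)) = cos (2 * pi * `|x - n%:~R|).
  by rewrite -[LHS]cos_norm normrM ger0_norm ?mulr_ge0// ltW.
apply: ltW; rewrite ltr_cos ?in_itv/=.
- by rewrite ltr_pM2l// mulr_gt0.
- apply/andP; split; first by rewrite !mulr_ge0// ?ltW.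
  by have := ler_wpM2l (ltW p0) (le_trans (ltW ax) x2); lra.
- apply/andP; split; first by rewrite !mulr_ge0// ?ltW.
  by have := ler_wpM2l (ltW p0) x2; lra.
Qed.

(** Chebyshev: away from the centre [1 - cos (2 pi x)] is at least [2 / q^2], while its mean against
    the kernel is [1 - cos (pi / m)]. The 4 bounds [(pi / 2)^2]. *)
Lemma integral_kern_near n :
  ((1 - 4 * q%:R ^+ 2 / m%:R ^+ 2)%:E <= \int[mu]_(x in near1 n) (kern m x)%:E)%E.
Proof.
have mc : measurable (cell n : set T) by exact: measurable_itv.
have mn := measurable_near1 n.
have split_cell : (1 = \int[mu]_(x in near1 n) (kern m x)%:E + \int[mu]_(x in cell n `\` near1 n) (kern m x)%:E)%E.
  rewrite -(integral_kern_cell n) -ge0_integral_setU//; first by rewrite setDUK// => x [].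
  - exact: measurableD.
  - by apply: mkE; exact: (@continuous_kern R m).
  - by move=> x _; rewrite lee_fin kern_ge0.
  - by rewrite disj_set2E setDIK.
have far : (\int[mu]_(x in cell n `\` near1 n) (kern m x)%:E <= (4 * q%:R ^+ 2 / m%:R ^+ 2)%:E)%E.
  have c1 : continuous (fun x : R => kern m x * (1 - cos (2 * pi * x))).
    move=> x; apply: cvgM; first exact: (@continuous_kern R m x).
    by apply: cvgB; [exact: cvg_cst|exact: continuous_cos_mul].
  have pos x : 0 <= kern m x * (1 - cos (2 * pi * x)).
    by rewrite mulr_ge0 ?kern_ge0// subr_ge0 cos_le1.
  have c2 : continuous (fun x : R => q%:R ^+ 2 / 2 * (kern m x * (1 - cos (2 * pi * x)))).
    by move=> x; apply: cvgM; [exact: cvg_cst|exact: c1].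
  have q2 : 0 <= q%:R ^+ 2 / 2 :> R by rewrite divr_ge0// sqr_ge0.
  apply: (@le_trans _ _ (\int[mu]_(x in cell n `\` near1 n)
      (q%:R ^+ 2 / 2 * (kern m x * (1 - cos (2 * pi * x))))%:E)%E).
    apply: ge0_le_integral => //.
    - exact: measurableD.
    - by move=> x _; rewrite lee_fin kern_ge0.
    - by apply: mkE; exact: (@continuous_kern R m).
    - by apply: mkE; exact: c2.
    - move=> x [cx nx]; rewrite lee_fin mulrCA ler_peMr ?kern_ge0//.
      have := far_cos cx nx; rewrite ler_pdivrMr ?exprn_gt0// => h.
      by rewrite -(ler_pM2r (_ : 0 < 2 :> R))//; lra.
  apply: (@le_trans _ _ (\int[mu]_(x in cell n)
      (q%:R ^+ 2 / 2 * (kern m x * (1 - cos (2 * pi * x))))%:E)%E).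
    apply: ge0_subset_integral => //.
    - exact: measurableD.
    - by apply: mkE; exact: c2.
    - by move=> x _; rewrite lee_fin mulr_ge0//; exact: pos.
  rewrite integral_cell// lee_fin Rintegral_scale_continuous// (kern_first_coef m2).
  rewrite (_ : pi / m%:R = 2 * (pi / 2 / m%:R)); last by field; rewrite gt_eqF.
  have h : 0 <= pi / 2 / m%:R :> R by rewrite !divr_ge0 ?pi_ge0// ltW.
  apply: (le_trans (ler_wpM2l q2 (one_sub_cos_le h))).
  rewrite [leLHS](_ : _ = q%:R ^+ 2 / m%:R ^+ 2 * (pi / 2) ^+ 2); last by move: (pi : R) => P; field; rewrite gt_eqF.
  rewrite [leRHS](_ : _ = q%:R ^+ 2 / m%:R ^+ 2 * 2 ^+ 2); last by ring.
  rewrite ler_wpM2l ?divr_ge0 ?sqr_ge0// lerXn2r ?nnegrE ?divr_ge0 ?pi_ge0//.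
  exact/ltW/pihalf_lt2.
have fin : (\int[mu]_(x in near1 n) (kern m x)%:E)%E \is a fin_num.
  rewrite ge0_fin_numE; last by apply: integral_ge0 => x _; rewrite lee_fin kern_ge0.
  apply: (@le_lt_trans _ _ (\int[mu]_(x in cell n) (kern m x)%:E)%E); last by rewrite integral_kern_cell ltry.
  apply: ge0_subset_integral => //.
  - by apply: mkE; exact: (@continuous_kern R m).
  - by move=> x _; rewrite lee_fin kern_ge0.
  - by move=> x [].
rewrite EFinB leeBlDr// {1}split_cell; exact: leeD2l.
Qed.

Lemma near_squareE n : near_square a n = near1 n.1 `*` near1 n.2.
Proof. by apply/seteqP; split => x [[? ?] [? ?]]; split. Qed.

Lemma integral_kern2_square n : (\int[mu2]_(z in square n) (kern2 z)%:E = 1)%E.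
Proof.
rewrite /square /kern2 ge0_integral_prod ?integral_kern_cell ?mule1//.
- exact: measurable_itv.
- exact: measurable_itv.
- exact: measurable_kern.
- exact: measurable_kern.
- exact: kern_ge0.
- exact: kern_ge0.
Qed.

Hypothesis qm : (2 * q <= m)%N.

Lemma integral_kern2_near n :
  ((1 - 8 * q%:R ^+ 2 / m%:R ^+ 2)%:E <= \int[mu2]_(z in near_square a n) (kern2 z)%:E)%E.
Proof.
rewrite near_squareE /kern2 ge0_integral_prod; first last.
- exact: kern_ge0.
- exact: kern_ge0.
- exact: measurable_kern.
- exact: measurable_kern.
- exact: measurable_near1.
- exact: measurable_near1.
set t : R := 4 * q%:R ^+ 2 / m%:R ^+ 2.
(* The product of the two one-dimensional masses is at least [(1 - t)^2 >= 1 - 2 t]; [t <= 1] keeps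
   the factors nonnegative. *)
have t1 : t <= 1.
  rewrite ler_pdivrMr ?exprn_gt0// mul1r (_ : 4 = 2 ^+ 2); last by rewrite expr2; lra.
  by rewrite -exprMn -natrM lerXn2r ?nnegrE// ler_nat.
apply: (@le_trans _ _ ((1 - t)%:E * (1 - t)%:E)%E).
  rewrite -EFinM lee_fin (_ : 8 * q%:R ^+ 2 / m%:R ^+ 2 = 2 * t); last by rewrite /t; ring.
  by have := sqr_ge0 t; rewrite expr2; lra.
by apply: lee_pmul; rewrite ?lee_fin ?subr_ge0//; exact: integral_kern_near.
Qed.

Lemma integral_kern2_far n :
  (\int[mu2]_(z in square n `\` near_square a n) (kern2 z)%:E <= (8 * q%:R ^+ 2 / m%:R ^+ 2)%:E)%E.
Proof.
have mk D : measurable_fun D (fun z : TT => (kern2 z)%:E).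
  by apply/measurable_EFinP; apply: measurable_funTS; exact: measurable_kern2.
have ms := measurable_square n; have mn := measurable_near_square a n.
have sub : near_square a n `<=` square n by move=> z [].
have E : (1 = \int[mu2]_(z in near_square a n) (kern2 z)%:E +
    \int[mu2]_(z in square n `\` near_square a n) (kern2 z)%:E)%E.
  rewrite -(integral_kern2_square n) -ge0_integral_setU//; first by rewrite setDUK.
  - exact: measurableD.
  - by move=> x _; rewrite lee_fin kern2_ge0.
  - by rewrite disj_set2E setDIK.
have fin A : measurable A -> A `<=` square n -> (\int[mu2]_(z in A) (kern2 z)%:E)%E \is a fin_num.
  move=> mA As; rewrite ge0_fin_numE; last by apply: integral_ge0 => x _; rewrite lee_fin kern2_ge0.
  apply: (@le_lt_trans _ _ (\int[mu2]_(x in square n) (kern2 x)%:E)%E); last by rewrite integral_kern2_square ltry.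
  by apply: ge0_subset_integral => // x _; rewrite lee_fin kern2_ge0.
have f1 := fin _ mn sub.
have f2 : (\int[mu2]_(z in square n `\` near_square a n) (kern2 z)%:E)%E \is a fin_num.
  by apply: fin; [exact: measurableD|move=> z []].
have := integral_kern2_near n; move: E; rewrite -(fineK f1) -(fineK f2) -EFinD !lee_fin.
by move=> [] E h; lra.
Qed.

End ProductKernel.

(** * Fourier expansion of the kernel *)

Section KernelFourier.
Context {R : realType}.
Variable m : nat.
Hypothesis m2 : (1 < m)%N.

Definition kcoef (z : int) : R :=
  (\sum_(i < m) \sum_(j < m | zdiff i j == z) kb m i * kb m j) / kB m.

(** Frequencies run over [-m, ..., m], shifted to ordinals so that they form a finite type. *)
Definition zidx (p : 'I_(m + m).+1) : int := p%:Z - m%:Z.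

Let kB0 : 0 < kB m := @kB_gt0 R m m2.
Let kbp (i : 'I_m) : 0 <= kb m i :> R := @kb_ge0 R m m2 i (ltnW (ltn_ord i)).

Lemma kcoef_ge0 z : 0 <= kcoef z.
Proof.
by rewrite divr_ge0 ?(ltW kB0)// sumr_ge0// => i _; rewrite sumr_ge0// => j _; rewrite mulr_ge0.
Qed.

(** AM-GM on the products; for fixed [i] at most one [j] has the given difference, and vice
    versa. *)
Lemma kcoef_le1 z : kcoef z <= 1.
Proof.
rewrite ler_pdivrMr// mul1r.
have sq i j : kb m i * kb m j <= 2^-1 * (kb m i ^+ 2 + kb m j ^+ 2) :> R.
  by have := sqr_ge0 (kb m i - kb m j : R); rewrite !expr2; lra.
apply: (@le_trans _ _ (\sum_(i < m) \sum_(j < m | zdiff i j == z) (2^-1 * (kb m i ^+ 2 + kb m j ^+ 2)))).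
  by apply: ler_sum => i _; apply: ler_sum => j _; exact: sq.
under eq_bigr => i _ do under eq_bigr => j _ do rewrite mulrDr.
under eq_bigr => i _ do rewrite big_split/=.
rewrite big_split/= [X in _ + X](exchange_big_dep xpredT)//=.
have one (u : R) (P : pred 'I_m) : 0 <= u -> (forall j j', P j -> P j' -> j = j') -> \sum_(j < m | P j) u <= u.
  move=> u0 hP; have [j Pj|nP] := pickP P; last by rewrite big_pred0.
  rewrite (bigD1 j)//= big1 ?addr0// => j' /andP[Pj' /negP h].
  by exfalso; apply: h; rewrite (hP _ _ Pj' Pj).
have h2 : kB m = \sum_(i < m) 2^-1 * kb m i ^+ 2 + \sum_(i < m) 2^-1 * kb m i ^+ 2 :> R.
  by rewrite -big_split/=; apply: eq_bigr => i _; field.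
rewrite h2; apply: lerD; apply: ler_sum => i _; apply: one; rewrite ?mulr_ge0 ?sqr_ge0//.
- by move=> j j' /eqP h /eqP h'; apply: val_inj; move: h h'; rewrite /zdiff /=; lia.
- by move=> j j' /eqP h /eqP h'; apply: val_inj; move: h h'; rewrite /zdiff /=; lia.
Qed.

Lemma kcoef0 : kcoef 0 = 1.
Proof.
rewrite /kcoef -[RHS](divff (lt0r_neq0 kB0)); congr (_ / _); apply: eq_bigr => i _.
rewrite (bigD1 i)/=; last by rewrite /zdiff subrr.
rewrite big1 ?addr0 ?expr2// => j /andP[/eqP h]; rewrite -val_eqE/=.
by move: h; rewrite /zdiff; lia.
Qed.

Lemma sum_zdiff (g : int -> R) :
  \sum_(i < m) \sum_(j < m) kb m i * kb m j * g (zdiff i j) =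
  kB m * \sum_(p < (m + m).+1) kcoef (zidx p) * g (zidx p).
Proof.
rewrite mulr_sumr.
have zp (i j : 'I_m) : (i + m - j < (m + m).+1)%N by have := ltn_ord i; have := ltn_ord j; lia.
transitivity (\sum_(p < (m + m).+1) \sum_(i < m) \sum_(j < m | zdiff i j == zidx p) kb m i * kb m j * g (zidx p)).
  rewrite [RHS]exchange_big/=; apply: eq_bigr => i _.
  rewrite (exchange_big_dep xpredT)//=; apply: eq_bigr => j _.
  have e : zidx (Ordinal (zp i j)) = zdiff i j.
    by rewrite /zidx /zdiff /=; have := ltn_ord j; lia.
  rewrite (bigD1 (Ordinal (zp i j)))/= ?e// big1 ?addr0// => p /andP[/eqP h].
  rewrite -val_eqE/=; move: h; rewrite /zidx /zdiff; have := ltn_ord j; lia.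
apply: eq_bigr => p _; rewrite /kcoef mulrA mulrCA mulfV ?gt_eqF// mulr1 mulr_suml.
by apply: eq_bigr => i _; rewrite mulr_suml.
Qed.

Lemma kern_fourier x : kern m x = \sum_p kcoef (zidx p) * cos (2 * pi * (zidx p)%:~R * x).
Proof.
by rewrite /kern (sum_zdiff (fun z => cos (2 * pi * z%:~R * x))) mulrAC mulfV ?mul1r// gt_eqF.
Qed.

(** The weights are symmetric in [i] and [j] while the sine is odd. In [kern2_fourier], subtracting
    a product of two such zeros turns products of cosines into cosines of one linear form. *)
Lemma kern_fourier_sin (x : R) : \sum_p kcoef (zidx p) * sin (2 * pi * (zidx p)%:~R * x) = 0.
Proof.
apply: (mulfI (lt0r_neq0 kB0)); rewrite mulr0 -(sum_zdiff (fun z => sin (2 * pi * z%:~R * x))).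
set S := LHS; suff : S = - S by lra.
rewrite {1}/S exchange_big/= /S -sumrN; apply: eq_bigr => i _; rewrite -sumrN; apply: eq_bigr => j _.
rewrite (_ : zdiff j i = - zdiff i j); last by rewrite /zdiff opprB.
by rewrite mulrNz mulrN mulNr sinN (mulrC (kb m j)) mulrN.
Qed.

Lemma kern2_fourier (z : R * R) : kern2 m z =
  \sum_p \sum_q (kcoef (zidx p) * kcoef (zidx q)) *
    cos (2 * pi * ((zidx p)%:~R * z.1 + (zidx q)%:~R * z.2)).
Proof.
transitivity (kern m z.1 * kern m z.2 -
  (\sum_p kcoef (zidx p) * sin (2 * pi * (zidx p)%:~R * z.1)) *
  (\sum_p kcoef (zidx p) * sin (2 * pi * (zidx p)%:~R * z.2))).
  by rewrite kern_fourier_sin mul0r subr0.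
rewrite !kern_fourier !big_distrlr/= -sumrB; apply: eq_bigr => p _; rewrite -sumrB; apply: eq_bigr => q _.
rewrite (_ : 2 * pi * (_ + _) = 2 * pi * (zidx p)%:~R * z.1 + 2 * pi * (zidx q)%:~R * z.2); last by ring.
by rewrite cosD; ring.
Qed.

End KernelFourier.

(** * The smoothed error term *)

Section FrequencyIndex.
Context {R : realType}.
Variable m : nat.

Definition kidx (p : freq m) : int * int := (zidx p.1, zidx p.2).
Definition kcf (p : freq m) : R := kcoef m (zidx p.1) * kcoef m (zidx p.2).

Lemma zidx_inj : injective (@zidx m).
Proof. by move=> p q; rewrite /zidx => e; apply: val_inj => /=; lia. Qed.

Lemma kidx_inj : injective kidx.
Proof. by move=> [p q] [p' q'] [/zidx_inj -> /zidx_inj ->]. Qed.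

Hypothesis m2 : (1 < m)%N.

Lemma kcf_ge0 p : 0 <= kcf p.
Proof. by rewrite mulr_ge0 ?kcoef_ge0. Qed.

Lemma kcf_le1 p : kcf p <= 1.
Proof. by rewrite -[leRHS]mulr1 ler_pM ?kcoef_ge0 ?kcoef_le1. Qed.

End FrequencyIndex.

Section LatticeProfiles.
Context {R : realType}.
Local Notation mu := (@lebesgue_measure R).
Local Notation mu2 := (mu \x mu)%E.
Local Notation T := (measurableTypeR R).
Local Notation TT := (measurableTypeR R * measurableTypeR R)%type.
Variables (O : set (R * R)) (c M K : R).
Hypothesis bO : body O c M.
Hypothesis hK : cap_bound O K.

Definition oppn (n : int * int) : int * int := (- n.1, - n.2).

(* Slicing along the larger coordinate of n keeps the Jacobian comparable to 1/|n|. *)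
Definition prof (n : int * int) : R -> R :=
  if `|n.2| <= `|n.1| then slen O (ipt n).1 (ipt n).2
  else slen (swap2 O) (ipt n).2 (ipt n).1.

Let norm_int (z : int) : `|z%:~R| = `|z|%:~R :> R. Proof. by rewrite intr_norm. Qed.

Lemma prof_profile n : n != (0, 0) ->
  profile (prof n) (- rho_star O (ipt (oppn n))) (rho_star O (ipt n)) (K * qwt n).
Proof.
move=> n0; rewrite /prof /qwt /nmax /ipt /oppn /=; case: ifPn => h.
  have n10 : n.1 != 0.
    by apply: contra n0 => /eqP h0; move: h; rewrite h0 normr0 normr_le0 => /eqP h1;
       rewrite (surjective_pairing n) h0 h1.
  have -> : Num.max `|n.1%:~R| `|n.2%:~R| = `|n.1%:~R| :> R.
    by apply/max_idPl; rewrite !norm_int ler_int.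
  have := @slen_profile R O c M K (n.1%:~R, n.2%:~R) bO hK.
  by rewrite /= !mulrNz; apply; rewrite intr_eq0.
rewrite -ltNge in h.
have n20 : n.2 != 0 by apply: contraTneq h => ->; rewrite normr0 -leNgt.
have -> : Num.max `|n.1%:~R| `|n.2%:~R| = `|n.2%:~R| :> R.
  by apply/max_idPr; rewrite !norm_int ler_int ltW.
have := @slen_profile R (swap2 O) c M K (n.2%:~R, n.1%:~R) (body_swap bO) (cap_bound_swap hK).
by rewrite /= !rho_swap/= !mulrNz; apply; rewrite intr_eq0.
Qed.

Lemma prof_ge0 n u : 0 <= prof n u.
Proof. by rewrite /prof; case: ifP => _; exact: slen_ge0. Qed.

Lemma measurable_prof n : measurable_fun setT (prof n : T -> T).
Proof.
rewrite /prof; case: ifP => _; apply: measurable_slen; first exact: measurable_body bO.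
exact: measurable_body (body_swap bO).
Qed.

Definition ndot (n : int * int) (z : R * R) : R := (ipt n).1 * z.1 + (ipt n).2 * z.2.

Lemma measurable_ndot n : measurable_fun setT (ndot n : TT -> T).
Proof. by apply: measurable_funD; apply: measurable_funM. Qed.

Lemma prof_integral n t (phi : T -> R) : n != (0, 0) -> 0 < t ->
  measurable_fun setT phi -> (forall x, 0 <= phi x) ->
  (\int[mu2]_(z in dil t O) (phi (ndot n z))%:E =
   \int[mu]_u (t ^+ 2 * (phi (t * u) * prof n u))%:E)%E.
Proof.
move=> n0 t0 mphi phi0; rewrite /prof; case: ifPn => h.
  have n10 : n.1 != 0.
    by apply: contra n0 => /eqP h0; move: h; rewrite h0 normr0 normr_le0 => /eqP h1;
       rewrite (surjective_pairing n) h0 h1.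
  have [_ _ _ OM _] := bO.
  by apply: (dil_slice_integral _ (measurable_body bO) OM t0 _ mphi phi0); rewrite intr_eq0.
rewrite -ltNge in h.
have n20 : n.2 != 0 by apply: contraTneq h => ->; rewrite normr0 -leNgt.
have bS := body_swap bO; have [_ _ _ OM _] := bS.
rewrite swap2_integral.
- rewrite (_ : swap2 (dil t O) = dil t (swap2 O))//.
  rewrite -(dil_slice_integral _ (measurable_body bS) OM t0 _ mphi phi0) ?intr_eq0//.
  by apply: eq_integral => z _; rewrite /ndot/= addrC.
- exact: measurable_dil_body bO _.
- apply/measurable_EFinP; exact: (measurableT_comp mphi (measurable_ndot n)).
- by move=> z; rewrite lee_fin.
Qed.

Definition gridpt (a h v : R) (j : nat) : R := a + j%:R * h + v.

Lemma measurable_gridpt a h j : measurable_fun setT (fun v : T => gridpt a h v j : T).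
Proof. exact: measurable_funD. Qed.

Variables (a h : R) (L : nat).
Hypothesis h0 : 0 < h.

Lemma prof_grid_integral n t (phi : T -> R) : n != (0, 0) -> 0 < t ->
  measurable_fun setT phi -> (forall x, 0 <= phi x) ->
  (forall u, prof n u != 0 -> a <= u < a + L%:R * h) ->
  (\int[mu2]_(z in dil t O) (phi (ndot n z))%:E =
   \int[mu]_(v in `[0%R, h[) (t ^+ 2 * \sum_(j < L) prof n (gridpt a h v j) * phi (t * gridpt a h v j))%:E)%E.
Proof.
move=> n0 t0 mphi phi0 supp; rewrite prof_integral//.
rewrite (@integral_grid_support R (fun u => t ^+ 2 * (phi (t * u) * prof n u)) a h L)//.
- by apply: eq_integral => v _; rewrite mulr_sumr; congr (_%:E); apply: eq_bigr => j _; rewrite /gridpt; ring.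
- apply: measurable_funM => //; apply: measurable_funM; last exact: measurable_prof.
  have mt : measurable_fun setT (fun u : T => t * u : T) by exact: measurable_funM.
  exact: (measurableT_comp mphi mt).
- by move=> u; rewrite mulr_ge0 ?sqr_ge0// mulr_ge0 ?phi0 ?prof_ge0.
- by move=> u; rewrite !mulf_eq0 !negb_or => /andP[_ /andP[_ /supp]].
Qed.

Lemma prof_bound n : n != (0, 0) -> exists2 C : R, 0 <= C & forall u, prof n u <= C.
Proof.
move=> n0; have pW := prof_profile n0.
set al := - rho_star O _ in pW; set be := rho_star O (ipt n) in pW.
have K0 : 0 <= K * qwt n.
  case: hK => K0 _; rewrite mulr_ge0// invr_ge0 mulr_ge0 ?sqrtr_ge0//.
  by rewrite (le_trans ler01)// nmax_ge1.
exists (K * qwt n * Num.sqrt (be - al)); first by rewrite mulr_ge0 ?sqrtr_ge0.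
move=> u; have [->|u0] := eqVneq (prof n u) 0; first by rewrite mulr_ge0 ?sqrtr_ge0.
have hu := profile_supp pW u0; apply: (le_trans (profile_right pW hu)).
case/andP: hu => h1 h2; rewrite ler_wpM2l// ler_sqrt; lra.
Qed.

Lemma measurable_prof_grid n j : measurable_fun setT (fun v : T => prof n (gridpt a h v j) : T).
Proof. exact: (measurableT_comp (measurable_prof n) (measurable_gridpt a h j)). Qed.

Lemma measurable_cos_grid t j : measurable_fun setT (fun v : T => cos (2 * pi * (t * gridpt a h v j)) : T).
Proof.
have mc := continuous_measurable_fun (@continuous_cos_mul R (2 * pi)).
apply: (measurableT_comp mc); apply: measurable_funM => //.
exact: measurable_gridpt.
Qed.

Definition gsum (n : int * int) (t v : R) : R :=
  \sum_(j < L) prof n (gridpt a h v j) * cos (2 * pi * (t * gridpt a h v j)).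

Lemma measurable_gsum n t : measurable_fun setT (gsum n t : T -> T).
Proof.
apply: measurable_sum => j; apply: measurable_funM; first exact: measurable_prof_grid.
exact: measurable_cos_grid.
Qed.

Lemma bounded_integrable (f : T -> R) (C : R) : measurable_fun setT f ->
  (forall v, `|f v| <= C) -> mu.-integrable `[0%R, h[ (EFin \o f).
Proof.
move=> mf fC; apply: measurable_bounded_integrable => //.
- by rewrite /= lebesgue_measure_itv/=; case: ifP => _; rewrite -?EFinB ltry.
- exact: measurable_funTS.
- exists C; split; first exact: num_real.
  by move=> x Cx v _ /=; rewrite (le_trans (fC v))// ltW.
Qed.

Lemma gsum_bound n t : n != (0, 0) -> exists C : R, forall v, `|gsum n t v| <= C.
Proof.
move=> n0; have [C C0 hC] := prof_bound n0; exists (\sum_(j < L) C) => v.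
apply: (le_trans (ler_norm_sum _ _ _)); apply: ler_sum => j _.
rewrite normrM -[leRHS]mulr1 ler_pM// ?cos_max// ger0_norm ?prof_ge0//.
Qed.

Lemma integrable_dil (f : TT -> R) (C t : R) : 0 < t -> measurable_fun setT f ->
  (forall z, `|f z| <= C) -> mu2.-integrable (dil t O) (EFin \o f).
Proof.
move=> t0 mf fC; apply: measurable_bounded_integrable => //.
- exact: measurable_dil_body bO _.
- by rewrite -[X in (X < _)%E]/(mu2 (dil t O)) (dil_measure bO t0) ltry.
- exact: measurable_funTS.
- exists C; split; first exact: num_real.
  by move=> x Cx v _ /=; rewrite (le_trans (fC v))// ltW.
Qed.

Lemma measurable_cos_ndot n : measurable_fun setT (fun z : TT => cos (2 * pi * ndot n z) : T).
Proof.
have mc := continuous_measurable_fun (@continuous_cos_mul R (2 * pi)).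
exact: (measurableT_comp mc (measurable_ndot n)).
Qed.

Lemma Rintegral_dil1 t : 0 < t -> \int[mu2]_(z in dil t O) (1 : R) = t ^+ 2 * area2 O.
Proof.
move=> t0; rewrite /Rintegral integral_cst; last exact: measurable_dil_body bO _.
by rewrite mul1e -[X in fine X]/(mu2 (dil t O)) (dil_measure bO t0).
Qed.

(** Slicing is available for nonnegative functions, so it is applied to [1 + cos] and to [1], and
    the results are subtracted; boundedness supplies the integrability. *)
Lemma cos_integral n t : n != (0, 0) -> 0 < t ->
  (forall u, prof n u != 0 -> a <= u < a + L%:R * h) ->
  \int[mu2]_(z in dil t O) cos (2 * pi * ndot n z) =
  t ^+ 2 * \int[mu]_(v in `[0, h[) gsum n t v.
Proof.
move=> n0 t0 supp.
have mI : measurable (`[0, h[%classic : set T) by exact: measurable_itv.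
have mc := continuous_measurable_fun (@continuous_cos_mul R (2 * pi)).
have mphi : measurable_fun setT (fun u : T => 1 + cos (2 * pi * u) : T) by exact: measurable_funD.
have phi0 (u : T) : 0 <= 1 + cos (2 * pi * u) by rewrite -lerBlDl sub0r cos_geN1.
have mone : measurable_fun setT (fun u : T => 1 : T) by exact: measurable_cst.
have E1 := prof_grid_integral n0 t0 mphi phi0 supp.
have E2 := prof_grid_integral n0 t0 mone (fun=> ler01) supp.
have mdil := measurable_dil_body bO t.
have i1 : mu2.-integrable (dil t O) (EFin \o (fun=> 1 : R)).
  by apply: (@integrable_dil _ 1) => //; move=> z; rewrite normr1.
have i2 : mu2.-integrable (dil t O) (EFin \o (fun z : TT => cos (2 * pi * ndot n z))).
  by apply: (@integrable_dil _ 1) => //; [exact: measurable_cos_ndot|move=> z; exact: cos_max].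
pose G1 (v : R) := \sum_(j < L) prof n (gridpt a h v j).
have mG1 : measurable_fun setT (G1 : T -> T).
  by apply: measurable_sum => j; exact: measurable_prof_grid.
have [C C0 hC] := prof_bound n0.
have j1 : mu.-integrable `[0%R, h[ (EFin \o G1).
  apply: (@bounded_integrable _ (\sum_(j < L) C)) => // v.
  apply: (le_trans (ler_norm_sum _ _ _)); apply: ler_sum => j _.
  by rewrite ger0_norm ?prof_ge0.
have j2 : mu.-integrable `[0%R, h[ (EFin \o gsum n t).
  by have [C' hC'] := gsum_bound t n0; apply: (bounded_integrable (measurable_gsum n t) hC').
have F1 : \int[mu2]_(z in dil t O) (1 + cos (2 * pi * ndot n z)) =
   t ^+ 2 * \int[mu]_(v in `[0, h[) (G1 v + gsum n t v).
  rewrite /Rintegral E1 -[RHS]RintegralZl//; last first.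
    by have := integrableD mI j1 j2.
  rewrite /Rintegral; congr fine; apply: eq_integral => v _; congr (_ * _)%:E.
  by rewrite /G1 /gsum -big_split/=; apply: eq_bigr => j _; rewrite mulrDr mulr1.
have F2 : \int[mu2]_(z in dil t O) (1 : R) = t ^+ 2 * \int[mu]_(v in `[0, h[) G1 v.
  rewrite /Rintegral E2 -[RHS]RintegralZl//.
  rewrite /Rintegral; congr fine; apply: eq_integral => v _; congr (_ * _)%:E.
  by rewrite /G1; apply: eq_bigr => j _; rewrite mulr1.
rewrite RintegralD// in F1; rewrite RintegralD// F2 (mulrDr (t ^+ 2)) in F1.
exact: addrI F1.
Qed.

Variable m : nat.
Hypothesis m2 : (1 < m)%N.

(* Up to the factor t^2 and averaging over v, the nonconstant part of the smoothed count. *)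
Definition osc (t v : R) : R := \sum_(p : freq m | kidx p != (0, 0)) kcf p * gsum (kidx p) t v.

Lemma osc_bound t : exists C : R, forall v, `|osc t v| <= C.
Proof.
have /choice[C hC] : forall p : freq m, exists C : R, kidx p != (0, 0) -> forall v, `|gsum (kidx p) t v| <= C.
  move=> p; have [kp|kp] := boolP (kidx p != (0, 0)); last by exists 0.
  by have [C hC] := gsum_bound t kp; exists C.
exists (\sum_(p : freq m | kidx p != (0, 0)) C p) => v.
apply: (le_trans (ler_norm_sum _ _ _)); apply: ler_sum => p p0.
rewrite normrM (ger0_norm (kcf_ge0 m2 p)) -[leRHS]mul1r ler_pM ?(kcf_ge0 m2) ?(kcf_le1 m2)//.
exact: hC.
Qed.

(** The zero frequency has coefficient 1 and contributes exactly [t ^+ 2 * area2 O]; every other one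
    goes through [cos_integral]. *)
Lemma error_integral t : 0 < t ->
  (forall (p : freq m) u, kidx p != (0, 0) -> prof (kidx p) u != 0 -> a <= u < a + L%:R * h) ->
  \int[mu2]_(z in dil t O) kern2 m z - t ^+ 2 * area2 O =
  t ^+ 2 * \int[mu]_(v in `[0, h[) osc t v.
Proof.
move=> t0 supp; have mdil := measurable_dil_body bO t.
have mI : measurable (`[0, h[%classic : set T) by exact: measurable_itv.
have icos (p : freq m) : mu2.-integrable (dil t O) (EFin \o (fun z : TT => cos (2 * pi * ndot (kidx p) z))).
  by apply: (@integrable_dil _ 1) => //; [exact: measurable_cos_ndot|move=> z; exact: cos_max].
have sumI (s : seq (freq m)) :
    mu2.-integrable (dil t O) (EFin \o (fun z : TT => \sum_(p <- s) kcf p * cos (2 * pi * ndot (kidx p) z))) /\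
    \int[mu2]_(z in dil t O) (\sum_(p <- s) kcf p * cos (2 * pi * ndot (kidx p) z)) =
    \sum_(p <- s) kcf p * \int[mu2]_(z in dil t O) cos (2 * pi * ndot (kidx p) z).
  elim: s => [|p s [IH1 IH2]].
    split.
      apply: (@eq_integrable _ _ _ _ _ mdil (cst 0%E)); last exact: integrable0.
      by move=> z _; rewrite /= big_nil.
    rewrite big_nil; under eq_Rintegral do rewrite big_nil.
    by rewrite Rintegral_cst// mul0r.
  have ip : mu2.-integrable (dil t O) (EFin \o (fun z : TT => kcf p * cos (2 * pi * ndot (kidx p) z))).
    by have := integrableZl mdil (kcf p) (icos p).
  split.
    apply: (@eq_integrable _ _ _ _ _ mdil (fun z => ((kcf p * cos (2 * pi * ndot (kidx p) z))%:E +
      (\sum_(p <- s) kcf p * cos (2 * pi * ndot (kidx p) z))%:E)%E)).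
      by move=> z _; rewrite /= big_cons EFinD.
    exact: (integrableD mdil ip IH1).
  rewrite big_cons -IH2 -RintegralZl// -RintegralD//.
  by apply: eq_Rintegral => z _; rewrite big_cons.
have -> : \int[mu2]_(z in dil t O) kern2 m z =
    \sum_(p : freq m) kcf p * \int[mu2]_(z in dil t O) cos (2 * pi * ndot (kidx p) z).
  have [_ h2] := sumI (index_enum _); rewrite -h2.
  by apply: eq_Rintegral => z _; rewrite (kern2_fourier m2) pair_big/=.
have mm : (m < (m + m).+1)%N by lia.
pose p0 := (Ordinal mm, Ordinal mm).
have p00 : kidx p0 = (0, 0) by rewrite /kidx /zidx /= subrr.
rewrite (bigD1 p0)//= p00.
have z0 : zidx (Ordinal mm) = 0 by rewrite /zidx /= subrr.
have -> : kcf p0 = 1 :> R by rewrite /kcf /= z0 kcoef0// mulr1.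
have -> : \int[mu2]_(z in dil t O) cos (2 * pi * ndot (0, 0) z) = t ^+ 2 * area2 O.
  rewrite -Rintegral_dil1//; apply: eq_Rintegral => z _.
  by rewrite /ndot /ipt/= !mul0r addr0 mulr0 cos0.
rewrite mul1r addrAC subrr add0r.
have jg (p : freq m) : kidx p != (0, 0) -> mu.-integrable `[0%R, h[ (EFin \o (fun v => kcf p * gsum (kidx p) t v)).
  move=> kp; have [C' hC'] := gsum_bound t kp.
  have ig := bounded_integrable (measurable_gsum (kidx p) t) hC'.
  by have := integrableZl mI (kcf p) ig.
have sumJ (s : seq (freq m)) :
    mu.-integrable `[0%R, h[ (EFin \o (fun v => \sum_(p <- s | kidx p != (0, 0)) kcf p * gsum (kidx p) t v)) /\
    \int[mu]_(v in `[0, h[) (\sum_(p <- s | kidx p != (0, 0)) kcf p * gsum (kidx p) t v) =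
    \sum_(p <- s | kidx p != (0, 0)) kcf p * \int[mu]_(v in `[0, h[) gsum (kidx p) t v.
  elim: s => [|p s [IH1 IH2]].
    split.
      apply: (@eq_integrable _ _ _ _ _ mI (cst 0%E)); last exact: integrable0.
      by move=> z _; rewrite /= big_nil.
    rewrite big_nil; under eq_Rintegral do rewrite big_nil.
    by rewrite Rintegral_cst// mul0r.
  rewrite big_cons; case: ifPn => kp; last first.
    split.
      apply: (@eq_integrable _ _ _ _ _ mI _ _ _ IH1).
      by move=> z _; rewrite /= big_cons (negbTE kp).
    by rewrite -IH2; apply: eq_Rintegral => z _; rewrite big_cons (negbTE kp).
  have [C' hC'] := gsum_bound t kp.
  have ig := bounded_integrable (measurable_gsum (kidx p) t) hC'.
  split.
    apply: (@eq_integrable _ _ _ _ _ mI (fun v => ((kcf p * gsum (kidx p) t v)%:E +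
      (\sum_(p <- s | kidx p != (0, 0)) kcf p * gsum (kidx p) t v)%:E)%E)).
      by move=> z _; rewrite /= big_cons kp EFinD.
    exact: (integrableD mI (jg p kp) IH1).
  rewrite -IH2 -RintegralZl// -RintegralD//; last exact: jg.
  by apply: eq_Rintegral => z _; rewrite big_cons kp.
rewrite /osc (sumJ (index_enum _)).2 mulr_sumr.
apply: eq_big => [p|p kp].
  by rewrite -p00 (inj_eq (@kidx_inj m)).
rewrite cos_integral//; first by rewrite mulrCA.
  by rewrite -p00 (inj_eq (@kidx_inj m)).
by move=> u; apply: supp; rewrite -p00 (inj_eq (@kidx_inj m)).
Qed.

End LatticeProfiles.

(** * Mean square over one grid *)

Section MeanSquareFixedShift.
Context {R : realType}.
Local Notation mu := (@lebesgue_measure R).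
Local Notation T := (measurableTypeR R).

(** On a grid the cosine is an eigenvector of the second difference, with eigenvalue
    [2 cos (2 pi t h) - 2]. The second difference moves from [C] to [W] without boundary terms
    because [W] vanishes near both ends of the grid. *)
Lemma summation_by_parts (W : R -> R) (a h v t : R) (L : nat) : 0 < h -> 0 <= v < h ->
  (forall u, W u != 0 -> a + h <= u /\ u + h < a + L%:R * h) ->
  (2 * cos (2 * pi * (t * h)) - 2) *
    \sum_(j < L) W (gridpt a h v j) * cos (2 * pi * (t * gridpt a h v j)) =
  \sum_(j < L) diff2 W h (gridpt a h v j) * cos (2 * pi * (t * gridpt a h v j)).
Proof.
move=> h0 /andP[v0 vh] supp.
pose Y j := gridpt a h v j.
pose C y := cos (2 * pi * (t * y)).
(* The discrete Wronskian of [W] and [C]: its increments are the termwise differences of the two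
   sides. *)
pose F j := W (Y j) * C (Y j - h) - W (Y j - h) * C (Y j).
have Wlow u : u < a + h -> W u = 0.
  by move=> hu; apply/eqP; apply: contraT => /supp[]; lra.
have Whigh u : a + L%:R * h <= u + h -> W u = 0.
  by move=> hu; apply/eqP; apply: contraT => /supp[]; lra.
have F0 : F 0%N = 0.
  by rewrite /F !Wlow ?mul0r ?subrr// /Y /gridpt mul0r; lra.
have FL : F L = 0.
  by rewrite /F !Whigh ?mul0r ?subrr// /Y /gridpt; lra.
have YS j : Y j.+1 = Y j + h by rewrite /Y /gridpt -natr1; ring.
have CC y : C (y + h) + C (y - h) = 2 * cos (2 * pi * (t * h)) * C y.
  rewrite /C (_ : 2 * pi * (t * (y + h)) = 2 * pi * (t * y) + 2 * pi * (t * h)); last by ring.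
  rewrite (_ : 2 * pi * (t * (y - h)) = 2 * pi * (t * y) - 2 * pi * (t * h)); last by ring.
  by rewrite cosD cosB; ring.
apply/eqP; rewrite eq_sym -subr_eq0 mulr_sumr -sumrB; apply/eqP.
transitivity (\sum_(0 <= j < L) (F j.+1 - F j)).
  rewrite big_mkord; apply: eq_bigr => j _; rewrite /F YS addrK -/(Y j) -/(C (Y j)).
  have := CC (Y j); rewrite /diff2; set x := C (Y j + h); set y := C (Y j - h); set z := C (Y j).
  set th := cos _; move=> e.
  have -> : x = 2 * th * z - y by rewrite -e; ring.
  by ring.
by rewrite telescope_sumr// FL F0 subrr.
Qed.

Lemma diff2_outside (W : R -> R) (al be kap h y : R) : profile W al be kap -> 0 < h ->
  y < al - h \/ be + h < y -> diff2 W h y = 0.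
Proof.
move=> pW h0 hy.
have Z u : u <= al \/ be <= u -> W u = 0.
  by move=> hu; apply/eqP; apply: contraT => /(profile_supp pW)/andP[]; case: hu; lra.
by rewrite /diff2 !Z ?mulr0 ?subr0 ?addr0//; case: hy; [left|right|left|right|left|right]; lra.
Qed.

Variables (O : set (R * R)) (c M K : R).
Hypothesis bO : body O c M.
Hypothesis hK : cap_bound O K.

Lemma qwt_ge0 (n : int * int) : 0 <= qwt n :> R.
Proof.
have h : 0 <= nmax n :> R by rewrite /nmax le_max normr_ge0.
by rewrite /qwt invr_ge0 mulr_ge0// sqrtr_ge0.
Qed.

Lemma qwt_opp (n : int * int) : qwt (oppn n) = qwt n :> R.
Proof. by rewrite /qwt /nmax /oppn /= !mulrNz !normrN. Qed.

Lemma oppn_inj : injective oppn.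
Proof. by move=> [x y] [x' y'] [/oppr_inj -> /oppr_inj ->]. Qed.

Lemma oppn_eq0 n : (oppn n == (0, 0)) = (n == (0, 0)).
Proof. by rewrite -!pair_eqE /= !oppr_eq0. Qed.

Lemma nmax_kidx (m : nat) (p : freq m) : nmax (kidx p) <= m%:R :> R.
Proof.
have z (i : 'I_(m + m).+1) : (`|zidx i| <= m%:Z)%R by rewrite /zidx; have := ltn_ord i; lia.
by rewrite /nmax ge_max -!intr_norm -[m%:R]/(m%:Z%:~R) !ler_int !z.
Qed.

Section FixedGrid.
Variables (m L : nat) (a h s : R).
Hypothesis m2 : (1 < m)%N.
Hypothesis h0 : 0 < h.
Hypothesis hs : 2 * h <= s.
Hypothesis sc : 2 * s <= c.
Hypothesis s1 : 2 * s <= 1.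
Hypothesis supp : forall p u, kidx p != (0, 0) -> prof O (@kidx m p) u != 0 ->
  a + h <= u /\ u + h < a + L%:R * h.
Variable v : R.
Hypothesis hv : 0 <= v < h.

Local Notation KK := (freq m).
Let Y (j : 'I_L) : R := gridpt a h v j.
Let be (p : KK) : R := rho_star O (ipt (kidx p)).
Let be' (p : KK) : R := rho_star O (ipt (oppn (kidx p))).
Let d (p : KK) (j : 'I_L) : R := kcf p * diff2 (prof O (kidx p)) h (Y j).
Let nz (p : KK) : bool := kidx p != (0, 0).

(** The three windows partition the grid points at which the second difference can be nonzero. Each
    end window stays within distance 1 of its endpoint, as the grouped mean value estimate
    requires. *)
Definition pright (p : KK) (j : 'I_L) : bool := nz p && (be p - s < Y j <= be p + h).
Definition pleft (p : KK) (j : 'I_L) : bool := nz p && (- be' p - h <= Y j < - be' p + s).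
Definition pmid (p : KK) (j : 'I_L) : bool := nz p && (- be' p + s <= Y j <= be p - s).

Definition fpart (P : KK -> 'I_L -> bool) (t : R) : R :=
  \sum_p \sum_(j | P p j) d p j * cos (2 * pi * (t * Y j)).

Let nmax_pos (n : int * int) : n != (0, 0) -> c <= c * nmax n.
Proof. by move=> n0; rewrite ler_peMr ?nmax_ge1// ltW// (body_c_gt0 bO). Qed.

Let be_ge p : nz p -> c <= be p.
Proof. by move=> h'; apply: le_trans (nmax_pos h') (nmax_rho bO _). Qed.

Let be'_ge p : nz p -> c <= be' p.
Proof.
move=> h'; have h2 : oppn (kidx p) != (0, 0) by rewrite oppn_eq0.
exact: le_trans (nmax_pos h2) (nmax_rho bO _).
Qed.

(* With h = 1/(2r) the factor on the left is at most -2 for t close to r, so [osc] is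
   controlled by the three parts. *)
Lemma osc_by_parts t : (2 * cos (2 * pi * (t * h)) - 2) * osc O a h L m t v =
  fpart pright t + fpart pleft t + fpart pmid t.
Proof.
have [h0' hs'] := (h0, hs); have [sc' c0'] := (sc, body_c_gt0 bO).
rewrite /osc mulr_sumr /fpart -!big_split/= big_mkcond/=; apply: eq_bigr => p _.
case: ifPn => kp; last first.
  by rewrite !big_pred0 ?addr0// => j; rewrite /pright /pleft /pmid /nz (negbTE kp).
rewrite mulrCA summation_by_parts//; last by move=> u; exact: supp.
have pW := prof_profile bO hK kp.
have b1 := be_ge kp; have b2 := be'_ge kp.
rewrite [X in X + _ + _]big_mkcond [X in _ + X + _]big_mkcond [X in _ + _ + X]big_mkcond.
rewrite -!big_split mulr_sumr /=; apply: eq_bigr => j _.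
rewrite -/(Y j) (mulrA (kcf p)) -/(d p j) /pright /pleft /pmid /nz kp /=.
have dz : - be' p - h <= Y j <= be p + h \/ d p j = 0.
  have [g1|g1] := leP (- be' p - h) (Y j); last first.
    by right; rewrite /d (diff2_outside pW h0) ?mulr0//; left.
  have [g2|g2] := leP (Y j) (be p + h); first by left.
  by right; rewrite /d (diff2_outside pW h0) ?mulr0//; right.
case: dz => [/andP[g1 g2]|->]; last by rewrite mul0r !if_same !addr0.
rewrite g1 g2 andbT /=.
have [g3|g3] := ltP (be p - s) (Y j).
  have e1 : (Y j < - be' p + s) = false by apply/negbTE; rewrite -leNgt; lra.
  by rewrite e1 andbF !addr0.
have [g4|g4] := ltP (Y j) (- be' p + s); first by rewrite /= add0r addr0.
by rewrite /= !add0r.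
Qed.

Let kap (p : KK) : 0 <= K * qwt (kidx p).
Proof. by have [K0 _] := hK; rewrite mulr_ge0// qwt_ge0. Qed.

Let sab p : nz p -> 4 * s <= be p - - be' p.
Proof. by move=> h'; have := be_ge h'; have := be'_ge h'; have := sc; lra. Qed.

Let dle p j : `|d p j| <= `|diff2 (prof O (kidx p)) h (Y j)|.
Proof. by rewrite /d normrM (ger0_norm (kcf_ge0 m2 p)) ler_piMl// kcf_le1. Qed.

Definition Apart (p : KK) : R := if nz p then 9 * (K * qwt (kidx p) * Num.sqrt h) else 0.

Lemma pright_sum p : \sum_(j | pright p j) `|d p j| <= Apart p.
Proof.
rewrite /Apart; case: ifPn => kp; last by rewrite big_pred0// => j; rewrite /pright (negbTE kp).
have E (j : 'I_L) : a + v + j%:R * h = Y j by rewrite /Y /gridpt; ring.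
have H : \sum_(j < L | be p - s <= Y j) `|diff2 (prof O (kidx p)) h (Y j)| <= 9 * (K * qwt (kidx p) * Num.sqrt h).
  have := diff2_filter_right (prof_profile bO hK kp) (kap p) h0 hs (sab kp) L (a + v).
  by congr (_ <= _); apply: eq_big => j; rewrite E.
apply: le_trans H; apply: (@le_trans _ _ (\sum_(j < L | be p - s <= Y j) `|d p j|)).
  rewrite [leLHS]big_mkcond [leRHS]big_mkcond; apply: ler_sum => j _.
  rewrite /pright kp/=; case: ifPn => [/andP[/ltW -> _]//|_]; by case: ifP.
by apply: ler_sum => j _; exact: dle.
Qed.

Lemma pleft_sum p : \sum_(j | pleft p j) `|d p j| <= Apart p.
Proof.
rewrite /Apart; case: ifPn => kp; last by rewrite big_pred0// => j; rewrite /pleft (negbTE kp).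
have E (j : 'I_L) : a + v + j%:R * h = Y j by rewrite /Y /gridpt; ring.
have H : \sum_(j < L | Y j <= - be' p + s) `|diff2 (prof O (kidx p)) h (Y j)| <= 9 * (K * qwt (kidx p) * Num.sqrt h).
  have := diff2_filter_left (prof_profile bO hK kp) (kap p) h0 hs (sab kp) L (a + v).
  by congr (_ <= _); apply: eq_big => j; rewrite E.
apply: le_trans H; apply: (@le_trans _ _ (\sum_(j < L | Y j <= - be' p + s) `|d p j|)).
  rewrite [leLHS]big_mkcond [leRHS]big_mkcond; apply: ler_sum => j _.
  rewrite /pleft kp/=; case: ifPn => [/andP[_ /ltW ->]//|_]; by case: ifP.
by apply: ler_sum => j _; exact: dle.
Qed.

Lemma pmid_sum p : \sum_(j | pmid p j) `|d p j| <=
  if nz p then 4 * (K * qwt (kidx p)) * h / Num.sqrt s else 0.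
Proof.
case: ifPn => kp; last by rewrite big_pred0// => j; rewrite /pmid (negbTE kp).
have E (j : 'I_L) : a + v + j%:R * h = Y j by rewrite /Y /gridpt; ring.
have H : \sum_(j < L | - be' p + s <= Y j <= be p - s) `|diff2 (prof O (kidx p)) h (Y j)| <= 4 * (K * qwt (kidx p)) * h / Num.sqrt s.
  have := diff2_filter_mid (prof_profile bO hK kp) (kap p) h0 hs (sab kp) L (a + v).
  by congr (_ <= _); apply: eq_big => j; rewrite E.
under eq_bigl do rewrite /pmid kp /=.
by apply: le_trans H; apply: ler_sum => j _; exact: dle.
Qed.

Let idxs : seq (int * int) := [seq kidx p | p <- enum {: KK} & nz p].

Let idxs_uniq : uniq idxs.
Proof. by rewrite map_inj_uniq; [rewrite filter_uniq// enum_uniq|exact: (@kidx_inj m)]. Qed.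

Let idxs_sum (F : int * int -> R) : \sum_(n <- idxs) F n = \sum_(p | nz p) F (kidx p).
Proof. by rewrite big_map big_filter big_enum_cond. Qed.

Variable N : nat.
Hypothesis hN : 2 * M * m%:R < N.+1%:R.

Let M0 : 0 <= 2 * M.
Proof. by have := body_cM bO; have := body_c_gt0 bO; lra. Qed.

Let idxs_rho n : n \in idxs -> n != (0, 0) /\ rho_star O (ipt n) < N.+1%:R.
Proof.
move=> /mapP[p]; rewrite mem_filter => /andP[np _] ->; split => //.
apply: le_lt_trans hN; apply: le_trans (rho_nmax bO _) _; by apply: ler_wpM2l => //; exact: nmax_kidx.
Qed.

Let idxs_rho' n : n \in map oppn idxs -> n != (0, 0) /\ rho_star O (ipt n) < N.+1%:R.
Proof.
move=> /mapP[n' n'in ->]; have [n0 _] := idxs_rho n'in; split; first by rewrite oppn_eq0.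
move: n'in => /mapP[p]; rewrite mem_filter => /andP[np _] ->.
apply: le_lt_trans hN; apply: le_trans (rho_nmax bO _) _; apply: ler_wpM2l => //.
by have := nmax_kidx p; rewrite /nmax /oppn /= !mulrNz !normrN.
Qed.

Variable C : R.
Hypothesis C0 : 0 <= C.
Hypothesis hC : forall (N : nat) (s : seq (int * int)),
  uniq s -> (forall n, n \in s -> n != (0, 0) /\ rho_star O (ipt n) < N.+1%:R) ->
  \sum_(k <- s) \sum_(l <- s) qwt k * qwt l / (1 + (rho_star O (ipt k) - rho_star O (ipt l)) ^+ 2)
    <= C * (1 + ln N.+1%:R) /\
  \sum_(k <- s) qwt k <= C * Num.sqrt N.+1%:R.

Let Apart_sum (g : KK -> KK -> R) :
  \sum_p \sum_q Apart p * Apart q / g p q =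
  (9 * K * Num.sqrt h) ^+ 2 * \sum_(p | nz p) \sum_(q | nz q) qwt (kidx p) * qwt (kidx q) / g p q.
Proof.
rewrite mulr_sumr [RHS]big_mkcond; apply: eq_bigr => p _; rewrite /Apart.
case: ifPn => _; last by rewrite big1// => q _; rewrite !mul0r.
rewrite mulr_sumr [RHS]big_mkcond; apply: eq_bigr => q _.
by case: ifPn => _; [ring|rewrite mulr0 mul0r].
Qed.

Lemma right_double_sum :
  \sum_p \sum_q Apart p * Apart q / (1 + (be p - be q) ^+ 2) <=
  (9 * K) ^+ 2 * C * (h * (1 + ln N.+1%:R)).
Proof.
rewrite Apart_sum exprMn sqr_sqrtr ?(ltW h0)//.
rewrite [leRHS](_ : _ = (9 * K) ^+ 2 * h * (C * (1 + ln N.+1%:R))); last by ring.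
rewrite ler_wpM2l; [by []|by rewrite mulr_ge0 ?sqr_ge0// ltW|].
have [H _] := hC idxs_uniq idxs_rho.
apply: le_trans H; rewrite (idxs_sum (fun k => \sum_(l <- idxs) qwt k * qwt l / (1 + (rho_star O (ipt k) - rho_star O (ipt l)) ^+ 2))).
by rewrite le_eqVlt; apply/orP; left; apply/eqP; apply: eq_bigr => p _; rewrite idxs_sum.
Qed.

(** The left endpoint for a frequency [n] is [- rho_star] at [- n], so this is the same lattice sum
    over the reflected frequencies. *)
Lemma left_double_sum :
  \sum_p \sum_q Apart p * Apart q / (1 + (be' p - be' q) ^+ 2) <=
  (9 * K) ^+ 2 * C * (h * (1 + ln N.+1%:R)).
Proof.
rewrite Apart_sum exprMn sqr_sqrtr ?(ltW h0)//.
rewrite [leRHS](_ : _ = (9 * K) ^+ 2 * h * (C * (1 + ln N.+1%:R))); last by ring.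
rewrite ler_wpM2l; [by []|by rewrite mulr_ge0 ?sqr_ge0// ltW|].
have us : uniq (map oppn idxs) by rewrite map_inj_uniq//; exact: oppn_inj.
have [H _] := hC us idxs_rho'.
apply: le_trans H; rewrite big_map (idxs_sum (fun k => \sum_(l <- map oppn idxs) qwt (oppn k) * qwt l / (1 + (rho_star O (ipt (oppn k)) - rho_star O (ipt l)) ^+ 2))).
rewrite le_eqVlt; apply/orP; left; apply/eqP; apply: eq_bigr => p _; rewrite big_map idxs_sum.
by apply: eq_bigr => q _; rewrite !qwt_opp.
Qed.

(** No cancellation in [t] is used: absolute values give [h] times the sum of [|k|^{-3/2}], of order
    [h] times the root of [N.+1]. *)
Lemma pmid_bound t : `|fpart pmid t| <= 4 * K * C / Num.sqrt s * (h * Num.sqrt N.+1%:R).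
Proof.
have [_ H] := hC idxs_uniq idxs_rho; rewrite idxs_sum in H.
have [K0 _] := hK.
apply: (le_trans (ler_norm_sum _ _ _)).
apply: (@le_trans _ _ (\sum_p (if nz p then 4 * (K * qwt (kidx p)) * h / Num.sqrt s else 0))).
  apply: ler_sum => p _; apply: le_trans (pmid_sum p); apply: (le_trans (ler_norm_sum _ _ _)).
  by apply: ler_sum => j _; rewrite normrM ler_piMr// cos_max.
rewrite -big_mkcond /=.
rewrite (eq_bigr (fun p => (4 * K / Num.sqrt s * h) * qwt (kidx p))); last by move=> p _; ring.
rewrite -mulr_sumr (_ : 4 * K * C / Num.sqrt s * (h * Num.sqrt N.+1%:R) = (4 * K / Num.sqrt s * h) * (C * Num.sqrt N.+1%:R)); last by ring.
by rewrite ler_wpM2l// !mulr_ge0 ?invr_ge0 ?sqrtr_ge0// ltW.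
Qed.

Variable cc : R.

Let Yid (t : R) (j : 'I_L) : 2 * pi * (t * Y j) = 2 * pi * Y j * t.
Proof. by ring. Qed.

Lemma pright_mean_square :
  (\int[mu]_(t in `[(cc + 1/4)%R, (cc + 3/4)%R]) ((fpart pright t) ^+ 2)%R%:E <=
   (90 * ((9 * K) ^+ 2 * C * (h * (1 + ln N.+1%:R))))%:E)%E.
Proof.
have [[h0' hs'] [sc' s1']] := ((h0, hs), (sc, s1)); have c0' := body_c_gt0 bO.
apply: (@le_trans _ _ (90 * \sum_p \sum_q Apart p * Apart q / (1 + (be p - be q) ^+ 2))%:E); last first.
  by rewrite lee_fin ler_wpM2l// right_double_sum.
apply: le_trans (@grouped_cosine_sum_mean_square R _ _ pright d (fun _ j => Y j) be Apart cc _ _ pright_sum).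
- by rewrite le_eqVlt; apply/orP; left; apply/eqP; apply: eq_integral => t _; congr (_ ^+ 2)%:E;
    apply: eq_bigr => p _; apply: eq_bigr => j _; rewrite Yid.
- by move=> p j /andP[kp /andP[g1 _]]; have := be_ge kp; lra.
- move=> p j /andP[kp /andP[g1 g2]]; rewrite ler_norml; apply/andP; split; lra.
Qed.

Lemma pleft_mean_square :
  (\int[mu]_(t in `[(cc + 1/4)%R, (cc + 3/4)%R]) ((fpart pleft t) ^+ 2)%R%:E <=
   (90 * ((9 * K) ^+ 2 * C * (h * (1 + ln N.+1%:R))))%:E)%E.
Proof.
have [[h0' hs'] [sc' s1']] := ((h0, hs), (sc, s1)); have c0' := body_c_gt0 bO.
apply: (@le_trans _ _ (90 * \sum_p \sum_q Apart p * Apart q / (1 + (be' p - be' q) ^+ 2))%:E); last first.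
  by rewrite lee_fin ler_wpM2l// left_double_sum.
(* The mean value estimate wants nonnegative frequencies; near the left endpoint [Y j] is negative,
   and the cosine is even. *)
apply: le_trans (@grouped_cosine_sum_mean_square R _ _ pleft d (fun _ j => - Y j) be' Apart cc _ _ pleft_sum).
- rewrite le_eqVlt; apply/orP; left; apply/eqP; apply: eq_integral => t _; congr (_ ^+ 2)%:E.
  by apply: eq_bigr => p _; apply: eq_bigr => j _; rewrite Yid mulrN mulNr cosN.
- by move=> p j /andP[kp /andP[_ g1]]; have := be'_ge kp; lra.
- move=> p j /andP[kp /andP[g1 g2]]; rewrite ler_norml; apply/andP; split; lra.
Qed.

Lemma continuous_fpart P : continuous (fpart P).
Proof.
move=> t; apply: cvg_big => [|p _]; first exact: add_continuous.
apply: cvg_big => [|j _]; first exact: add_continuous.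
apply: cvgM; first exact: cvg_cst.
have := @continuous_cos_mul R (2 * pi * Y j) t.
by under [X in continuous_at _ X -> _]eq_fun do rewrite -Yid.
Qed.

Lemma continuous_osc : continuous (fun t => osc O a h L m t v : R).
Proof.
move=> t; apply: cvg_big => [|p _]; first exact: add_continuous.
apply: cvgM; first exact: cvg_cst.
apply: cvg_big => [|j _]; first exact: add_continuous.
apply: cvgM; first exact: cvg_cst.
have := @continuous_cos_mul R (2 * pi * Y j) t.
by under [X in continuous_at _ X -> _]eq_fun do rewrite -Yid.
Qed.

(** The factor in [osc_by_parts] has square at least 4, so the square of [osc] is at most 3/4 of the
    sum of the squares of the three parts. The two end windows give 135 as 3/4 of 180. *)
Lemma osc_mean_square :
  (forall t, cc + 1/4 <= t <= cc + 3/4 -> cos (2 * pi * (t * h)) <= 0) ->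
  (\int[mu]_(t in `[(cc + 1/4)%R, (cc + 3/4)%R]) ((osc O a h L m t v) ^+ 2)%R%:E <=
   ((135 * (9 * K) ^+ 2 * C + (4 * K * C / Num.sqrt s) ^+ 2) * (h * (1 + ln N.+1%:R) + h ^+ 2 * N.+1%:R))%:E)%E.
Proof.
move=> hcos.
have mE (f : R -> R) D : continuous f -> measurable_fun D (fun t : T => (f t)%:E).
  by move=> cf; apply/measurable_EFinP; apply: measurable_funTS; exact: continuous_measurable_fun.
have sqc (f : R -> R) : continuous f -> continuous (fun t => f t ^+ 2).
  by move=> cf t; apply: cvgM; exact: cf.
set B := 4 * K * C / Num.sqrt s * (h * Num.sqrt N.+1%:R).
have cR := @continuous_fpart pright; have cL := @continuous_fpart pleft.
apply: (@le_trans _ _ (\int[mu]_(t in `[(cc + 1/4)%R, (cc + 3/4)%R])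
   ((3/4 * (fpart pright t) ^+ 2)%:E + ((3/4 * (fpart pleft t) ^+ 2)%:E + (3/4 * B ^+ 2)%:E)))%E).
  apply: ge0_le_integral => //.
  - by move=> t _; rewrite lee_fin sqr_ge0.
  - by apply: mE; apply: sqc; exact: continuous_osc.
  - by apply: emeasurable_funD; [|apply: emeasurable_funD => //]; apply: mE => t;
      (apply: cvgM; first exact: cvg_cst); apply: sqc.
  - move=> t; rewrite /= in_itv/= => /hcos ct; rewrite -!EFinD lee_fin.
    have := osc_by_parts t; set x := osc _ _ _ _ _ _ _; set y := fpart pright t.
    set z := fpart pleft t; set w := fpart pmid t; set th := cos _ in ct * => e.
    have wB : w ^+ 2 <= B ^+ 2.
      by rewrite -(real_normK (num_real w)) lerXn2r ?nnegrE ?pmid_bound// (le_trans _ (pmid_bound t)).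
    have h1 : 4 * x ^+ 2 <= (y + z + w) ^+ 2.
      rewrite -e exprMn ler_wpM2r ?sqr_ge0// expr2.
      by nra.
    by have := sqr_ge0 (y - z); have := sqr_ge0 (y - w); have := sqr_ge0 (z - w); nra.
rewrite ge0_integralD//=; last 4 first.
- by move=> t _; rewrite lee_fin mulr_ge0// sqr_ge0.
- by apply: mE => t; apply: cvgM; [exact: cvg_cst|exact: sqc].
- by move=> t _; rewrite -EFinD lee_fin addr_ge0// mulr_ge0// sqr_ge0.
- by apply: emeasurable_funD => //; apply: mE => t; apply: cvgM; [exact: cvg_cst|exact: sqc].
rewrite ge0_integralD//=; last 3 first.
- by move=> t _; rewrite lee_fin mulr_ge0// sqr_ge0.
- by apply: mE => t; apply: cvgM; [exact: cvg_cst|exact: sqc].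
- by move=> t _; rewrite lee_fin mulr_ge0// sqr_ge0.
under eq_integral do rewrite EFinM.
rewrite ge0_integralZl//; last 2 first.
- by apply: mE; exact: sqc.
- by move=> t _; rewrite lee_fin sqr_ge0.
under [X in (_ + (X + _) <= _)%E]eq_integral do rewrite EFinM.
rewrite ge0_integralZl//; last 2 first.
- by apply: mE; exact: sqc.
- by move=> t _; rewrite lee_fin sqr_ge0.
rewrite integral_cst//= lebesgue_measure_itv/= lte_fin ltrD2l ifT; last by lra.
have q0 : (0 <= (3/4 : R)%:E)%E by rewrite lee_fin.
apply: (le_trans (leeD (lee_wpmul2l q0 pright_mean_square) (leeD (lee_wpmul2l q0 pleft_mean_square) (lexx _)))).
rewrite -EFinB -!EFinM -!EFinD lee_fin.
have -> : B ^+ 2 = (4 * K * C / Num.sqrt s) ^+ 2 * (h ^+ 2 * N.+1%:R).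
  by rewrite /B [LHS]exprMn; congr (_ * _); rewrite [LHS]exprMn sqr_sqrtr.
set X := h * (1 + ln N.+1%:R); set Z := h ^+ 2 * N.+1%:R.
have ln0 : 0 <= ln N.+1%:R :> R by rewrite ln_ge0// ler1n.
have X0 : 0 <= X by rewrite mulr_ge0 ?addr_ge0// ltW.
have Z0 : 0 <= Z by rewrite mulr_ge0 ?sqr_ge0.
set D := 4 * K * C / Num.sqrt s; set a9 := (9 * K) ^+ 2 * C.
have a90 : 0 <= a9 by rewrite mulr_ge0 ?sqr_ge0.
have D0 : 0 <= D ^+ 2 by exact: sqr_ge0.
have := mulr_ge0 a90 Z0; have := mulr_ge0 D0 X0; have := mulr_ge0 D0 Z0.
rewrite -[135 * _ * C]mulrA -/a9; rewrite -/X -/Z in X0 Z0 *.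
have -> : cc + 3/4 - (cc + 1/4) = 1/2 by field.
by move: (D ^+ 2) => E; lra.
Qed.

End FixedGrid.
End MeanSquareFixedShift.

(** * Mean square of the error term *)

Section IntegralInequalities.
Context {R : realType}.
Local Notation mu := (@lebesgue_measure R).
Local Notation T := (measurableTypeR R).

(* No measurability is needed: the integral of a nonnegative function is a supremum over
   simple functions below it. *)
Lemma ge0_le_integral_any d (X : measurableType d) (nu : {measure set X -> \bar R})
    (D : set X) (f g : X -> \bar R) :
  (forall x, D x -> (0 <= f x)%E) -> (forall x, D x -> (f x <= g x)%E) ->
  (\int[nu]_(x in D) f x <= \int[nu]_(x in D) g x)%E.
Proof.
move=> f0 fg; have g0 x : D x -> (0 <= g x)%E by move=> Dx; rewrite (le_trans (f0 _ Dx))// fg.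
rewrite !ge0_integralE//; apply: ereal_sup_le => _ [p hp <-]; exists p => // x.
apply: (le_trans (hp x)); rewrite !patchE; case: ifPn => // /set_mem Dx; exact: fg.
Qed.

Lemma integral_shift_closed (f : T -> R) (x y b : R) :
  measurable_fun setT f -> (forall t, 0 <= f t) ->
  (\int[mu]_(t in `[x, y]) (f (t + b)%R)%:E = \int[mu]_(t in `[(x + b)%R, (y + b)%R]) (f t)%:E)%E.
Proof.
move=> mf f0; rewrite [RHS]integral_mkcond (@ge0_integral_affine R 1%R b)//; last 2 first.
- apply/(measurable_restrictT _ _).1 => //; apply: measurable_funTS; exact/measurable_EFinP.
- by move=> t; rewrite patchE; case: ifP => // _; rewrite lee_fin.
rewrite normr1 mul1e [LHS]integral_mkcond; apply: eq_integral => t _.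
by rewrite !patchE mul1r !mem_setE !in_itv/= !lerD2r.
Qed.

(** Cauchy-Schwarz, from the nonnegative integral of [(f - I / h)^2]. *)
Lemma sqr_Rintegral_le (h : R) (f : T -> R) (C : R) : 0 < h -> measurable_fun setT f ->
  (forall v, `|f v| <= C) ->
  (((\int[mu]_(v in `[0, h[) f v) ^+ 2)%:E <= h%:E * \int[mu]_(v in `[0%R, h[) (f v ^+ 2)%:E)%E.
Proof.
move=> h0 mf fC.
have mI : measurable (`[0, h[%classic : set T) by exact: measurable_itv.
have C0 : 0 <= C by apply: le_trans (fC 0).
have i1 := bounded_integrable h mf fC.
have mf2 : measurable_fun setT (fun v : T => f v ^+ 2 : T) by exact: measurable_funX.
have i2 : mu.-integrable `[0%R, h[ (EFin \o (fun v => f v ^+ 2)).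
  apply: (bounded_integrable h mf2 (C := C ^+ 2)) => v.
  by rewrite normrX lerXn2r ?nnegrE.
set I := \int[mu]_(v in `[0, h[) f v.
have -> : (\int[mu]_(v in `[0%R, h[) (f v ^+ 2)%:E)%E = (\int[mu]_(v in `[0, h[) (f v ^+ 2))%:E.
  by rewrite /Rintegral fineK//; exact: integrable_fin_num.
rewrite -EFinM lee_fin; set J := \int[mu]_(v in `[0, h[) _.
have ic : mu.-integrable `[0%R, h[ (EFin \o (fun=> (I / h) ^+ 2)).
  by apply: (@bounded_integrable _ h _ `|(I / h) ^+ 2|) => //; exact: measurable_cst.
have il : mu.-integrable `[0%R, h[ (EFin \o (fun v => - (2 * I / h) * f v)).
  by have := integrableZl mI (- (2 * I / h)) i1.
have : 0 <= \int[mu]_(v in `[0, h[) ((f v ^+ 2 + - (2 * I / h) * f v) + (I / h) ^+ 2).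
  apply: Rintegral_ge0 => v _.
  have := sqr_ge0 (f v - I / h); rewrite !expr2; lra.
rewrite RintegralD//; last by have := integrableD mI i2 il.
rewrite RintegralD// RintegralZl// -/I -/J Rintegral_cst//= lebesgue_measure_itv/= lte_fin h0 sube0 /=.
have -> : J + - (2 * I / h) * I + (I / h) ^+ 2 * h = (h * J - I ^+ 2) / h by field; rewrite gt_eqF.
by rewrite pmulr_lge0 ?invr_gt0// subr_ge0.
Qed.

(** Cauchy-Schwarz in [v] followed by Tonelli: a mean square bound in [t] that is uniform in the
    shift [v] survives integration over [v]. *)
Lemma mean_square_Rintegral_le (h : R) (f : T * T -> R) (D : set T) (B : R) : 0 < h ->
  measurable D -> measurable_fun setT f ->
  (forall t, exists C, forall v, `|f (t, v)| <= C) ->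
  (forall v, 0 <= v < h -> (\int[mu]_(t in D) (f (t, v) ^+ 2)%:E <= B%:E)%E) ->
  (\int[mu]_(t in D) ((\int[mu]_(v in `[0%R, h[) f (t, v)) ^+ 2)%:E <= (h * (h * B))%:E)%E.
Proof.
move=> h0 mD mf fC fB.
have mI : measurable (`[0, h[%classic : set T) by exact: measurable_itv.
pose g (z : T * T) : \bar R := ((f z ^+ 2)%:E * (\1_D z.1 * \1_(`[0, h[%classic) z.2)%:E)%E.
have mg : measurable_fun setT g.
  apply: emeasurable_funM; first by apply/measurable_EFinP; exact: measurable_funX.
  apply/measurable_EFinP; apply: measurable_funM.
    have m1 : measurable_fun setT (\1_D : T -> R) := measurable_indic mD.
    exact: (measurableT_comp m1 measurable_fst).
  have m2 : measurable_fun setT (\1_(`[0, h[%classic) : T -> R) := measurable_indic mI.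
  exact: (measurableT_comp m2 measurable_snd).
have g0 z : (0 <= g z)%E by rewrite mule_ge0 ?lee_fin ?sqr_ge0// mulr_ge0.
have mft t : measurable_fun setT (fun v : T => f (t, v)) by exact: (measurableT_comp mf (measurable_pair1 t)).
have F1 t : D t -> (\int[mu]_(v in `[0%R, h[) (f (t, v) ^+ 2)%:E = \int[mu]_v g (t, v))%E.
  move=> Dt; rewrite integral_mkcond; apply: eq_integral => v _.
  rewrite /g /= patchE !indicE (mem_set Dt) mul1r.
  by case: ifPn => _; rewrite ?mule1 ?mule0.
apply: (@le_trans _ _ (\int[mu]_(t in D) (h%:E * \int[mu]_v g (t, v)))%E).
  apply: ge0_le_integral_any => t Dt; first by rewrite lee_fin sqr_ge0.
  rewrite -F1//; have [C hC] := fC t; exact: (sqr_Rintegral_le h0 (mft t) hC).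
have mG : measurable_fun setT (fun t : T => \int[mu]_v g (t, v))%E.
  exact: (measurable_fun_fubini_tonelli_F g mg g0).
rewrite ge0_integralZl//; last 3 first.
- exact: measurable_funTS.
- by move=> t _; apply: integral_ge0.
- by rewrite lee_fin ltW.
rewrite EFinM lee_wpmul2l ?lee_fin ?(ltW h0)//.
have -> : (\int[mu]_(t in D) \int[mu]_v g (t, v) = \int[mu]_t \int[mu]_v g (t, v))%E.
  rewrite integral_mkcond; apply: eq_integral => t _; rewrite patchE; case: ifPn => // nD.
  by rewrite integral0_eq// => v _; rewrite /g indicE (negbTE nD) mul0r mule0.
rewrite (fubini_tonelli g mg g0).
apply: (@le_trans _ _ (\int[mu]_(v in `[0%R, h[) (B%:E))%E); last first.
  by rewrite integral_cst//= lebesgue_measure_itv/= lte_fin h0 sube0 -EFinM mulrC.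
rewrite [leRHS]integral_mkcond; apply: ge0_le_integral_any => v _; first exact: integral_ge0.
rewrite patchE; case: ifPn => [|nv]; last first.
  by rewrite integral0_eq// => t _; rewrite /g/= !indicE (negbTE nv) mulr0 mule0.
rewrite mem_setE in_itv/= => hv; apply: le_trans (fB v hv).
rewrite [leRHS]integral_mkcond; apply: ge0_le_integral_any => t _; first exact: g0.
rewrite /g /= patchE !indicE; case: ifPn => _; last by rewrite mul0r mule0.
by rewrite mem_setE in_itv/= hv mulr1 mule1.
Qed.

End IntegralInequalities.

Section ErrorMeanSquare.
Context {R : realType}.
Local Notation mu := (@lebesgue_measure R).
Local Notation mu2 := (mu \x mu)%E.
Local Notation T := (measurableTypeR R).
Variables (O : set (R * R)) (c M K : R).
Hypothesis bO : body O c M.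
Hypothesis hK : cap_bound O K.

Lemma measurable_osc_pair (a h : R) (L m : nat) :
  measurable_fun setT (fun z : T * T => osc O a h L m z.1 z.2 : T).
Proof.
have -> : (fun z : T * T => osc O a h L m z.1 z.2) = fun z =>
    \sum_(p <- [seq p <- enum {: freq m} | kidx p != (0, 0)])
      kcf p * \sum_(j < L) prof O (kidx p) (gridpt a h z.2 j) * cos (2 * pi * (z.1 * gridpt a h z.2 j)).
  by apply/funext => z; rewrite big_filter big_enum_cond.
have mgr j : measurable_fun setT (fun z : T * T => gridpt a h z.2 j : T).
  by apply: (measurableT_comp (measurable_gridpt a h j)); exact: measurable_snd.
apply: measurable_sum => p; apply: measurable_funM => //.
apply: measurable_sum => j; apply: measurable_funM.
  exact: (measurableT_comp (measurable_prof bO (kidx p)) (mgr j)).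
have mc := continuous_measurable_fun (@continuous_cos_mul R (2 * pi)).
apply: (measurableT_comp mc); apply: measurable_funM; last exact: mgr.
exact: measurable_fst.
Qed.

Lemma cos_half_period (r t : R) : 0 < r -> r / 2 <= t <= 3 * r / 2 ->
  cos (2 * pi * (t * (2 * r)^-1)) <= 0.
Proof.
move=> r0 /andP[t1 t2].
have -> : 2 * pi * (t * (2 * r)^-1) = (pi * (t / r) - pi) + pi by field; rewrite gt_eqF.
rewrite (cosDpi (pi * (t / r) - pi)) oppr_le0; apply: cos_ge0_pihalf.
have tr1 : 1/2 <= t / r by rewrite ler_pdivlMr//; lra.
have tr2 : t / r <= 3/2 by rewrite ler_pdivrMr//; lra.
have p0 : 0 <= pi :> R := pi_ge0 R.
have := ler_wpM2l p0 tr1; have := ler_wpM2l p0 tr2.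
by move=> g1 g2; apply/andP; split; lra.
Qed.

Definition smooth_error (m : nat) (t : R) : R :=
  \int[mu2]_(z in dil t O) kern2 m z - t ^+ 2 * area2 O.

(** The condition on [b] keeps [t + b] in [[r/2, 3r/2]], the range of [cos_half_period]. *)
Lemma smooth_error_mean_square : exists r0 C : R, [/\ 2 <= r0, 0 <= C &
  forall r b : R, r0 <= r -> `|b| + 1/2 <= r / 2 ->
  (\int[mu]_(t in `[r, (r + 1/2)%R]) ((smooth_error (Num.truncn r).+1 (t + b)) ^+ 2)%:E <=
   (C * (r * ln r))%:E)%E].
Proof.
have c0 := body_c_gt0 bO; have cM := body_cM bO; have [K0 _] := hK.
have [C0 C00 hC] := lattice_double_sum bO.
pose s : R := Num.min c 1 / 2.
have s0 : 0 < s by rewrite divr_gt0// lt_min c0 ltr01.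
have sc : 2 * s <= c by rewrite /s mulrCA mulfV// mulr1 ge_min lexx.
have s1 : 2 * s <= 1 by rewrite /s mulrCA mulfV// mulr1 ge_min lexx orbT.
pose C1 : R := 4 * M + 1.
have C11 : 1 <= C1 by rewrite /C1; lra.
have lnC1 : 0 <= ln C1 by exact: ln_ge0.
pose Cs : R := 135 * (9 * K) ^+ 2 * C0 + (4 * K * C0 / Num.sqrt s) ^+ 2.
have Cs0 : 0 <= Cs by rewrite addr_ge0 ?sqr_ge0// !mulr_ge0 ?sqr_ge0.
pose C2 : R := (2 + ln C1) / 2 + C1 / 4.
have C20 : 0 <= C2 by rewrite /C2; lra.
(* [expR 1] makes [ln r >= 1], which absorbs constants; [s^-1] makes [2 * h = 1 / r] at most [s]. *)
exists (expR 1 + s^-1 + 2), ((9/4) ^+ 2 / 4 * (Cs * C2)).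
have e0 : 0 < expR 1 :> R := expR_gt0 1.
have si0 : 0 < s^-1 by rewrite invr_gt0.
split; first by lra.
  by rewrite !mulr_ge0.
move=> r b hr; have := ler_norm b; have := ler_norm (- b); rewrite normrN => bl bu hb.
have r0 : 0 < r by lra.
have lnr : 1 <= ln r by rewrite -(expRK 1) ler_ln ?posrE//; lra.
set m := (Num.truncn r).+1.
have m2 : (1 < m)%N by rewrite ltnS truncn_gt0; lra.
have mr : m%:R <= r + 1.
  by rewrite -natr1 lerD2r truncn_le//; lra.
pose h : R := (2 * r)^-1.
have h0 : 0 < h by rewrite invr_gt0 mulr_gt0.
have hs : 2 * h <= s.
  rewrite /h invfM mulrA mulfV// mul1r -[leRHS]invrK lef_pV2 ?posrE//; lra.
(* [X] bounds [rho_star] at all frequencies of the kernel, so [[-X, X]] contains every support. The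
   grid starts [h] earlier, and the 2 extra cells in [L] leave the margin that summation by parts
   requires. *)
pose X : R := 2 * M * m%:R.
have X0 : 0 <= X by rewrite !mulr_ge0//; lra.
pose a : R := - X - h.
pose L := ((Num.truncn ((X + X) / h)).+1 + 2)%N.
have hL : X + h < a + L%:R * h.
  have := truncnS_gt ((X + X) / h); rewrite ltr_pdivrMr// => hT.
  by rewrite /L /a natrD mulrDl; lra.
have nm (p : freq m) : nmax (kidx p) <= m%:R :> R by exact: nmax_kidx.
have M20 : 0 <= 2 * M by lra.
have supp0 (p : freq m) u : kidx p != (0, 0) -> prof O (kidx p) u != 0 ->
    - X < u < X.
  move=> kp pu; have /andP[h1 h2] := profile_supp (prof_profile bO hK kp) pu.
  have b1 : rho_star O (ipt (kidx p)) <= X.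
    by apply: (le_trans (rho_nmax bO _)); exact: ler_wpM2l.
  have b2 : rho_star O (ipt (oppn (kidx p))) <= X.
    apply: (le_trans (rho_nmax bO _)); apply: ler_wpM2l => //.
    by have := nm p; rewrite /nmax /oppn /= !mulrNz !normrN.
  by move: b1 b2 h1 h2; clear - bO hK; move=> *; apply/andP; split; lra.
have supp (p : freq m) u : kidx p != (0, 0) -> prof O (kidx p) u != 0 ->
    a + h <= u /\ u + h < a + L%:R * h.
  by move=> kp pu; have /andP[h1 h2] := supp0 _ _ kp pu; rewrite {1}/a; move: h1 h2 hL; clear - bO hK; move=> *; split; lra.
pose N := Num.truncn X.
have hN : 2 * M * m%:R < N.+1%:R by exact: truncnS_gt.
have N1 : N.+1%:R <= C1 * r.
  apply: (@le_trans _ _ (X + 1)); first by rewrite -natr1 lerD2r truncn_le.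
  rewrite /X /C1; have := ler_wpM2l M20 mr; have := ler_wpM2l M20 (_ : 1 <= r); nra.
(* The window [[cc + 1/4, cc + 3/4]] is then [[r + b, r + b + 1/2]]. *)
pose cc : R := r + b - 1/4.
pose B : R := Cs * (h * (1 + ln N.+1%:R) + h ^+ 2 * N.+1%:R).
(* [W] dominates [(t + b)^2] because [t + b <= 3 r / 2]; being constant in [t], it leaves a pure
   cosine sum to average. *)
pose W : R := 9/4 * r ^+ 2.
have W0 : 0 <= W by rewrite /W mulr_ge0 ?sqr_ge0//; lra.
have oscB v : 0 <= v < h ->
    (\int[mu]_(t in `[r, (r + 1/2)%R]) ((W * osc O a h L m (t + b) v) ^+ 2)%:E <= (W ^+ 2 * B)%:E)%E.
  move=> hv; rewrite (@integral_shift_closed R (fun t => (W * osc O a h L m t v) ^+ 2)); last 2 first.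
  - apply: measurable_funX; apply: measurable_funM => //.
    exact: (measurableT_comp (measurable_osc_pair a h L m) (measurable_pair2 v)).
  - by move=> t; exact: sqr_ge0.
  under eq_integral do rewrite exprMn EFinM.
  rewrite ge0_integralZl//; last 3 first.
  - apply/measurable_EFinP; apply: measurable_funTS; apply: measurable_funX.
    exact: (measurableT_comp (measurable_osc_pair a h L m) (measurable_pair2 v)).
  - by move=> t _; rewrite lee_fin sqr_ge0.
  - by rewrite lee_fin sqr_ge0.
  rewrite [leRHS]EFinM; apply: lee_wpmul2l; first by rewrite lee_fin sqr_ge0.
  have -> : r + b = cc + 1/4 by rewrite /cc; clear - bO hK; lra.
  have -> : r + 1/2 + b = cc + 3/4 by rewrite /cc; clear - bO hK; lra.
  apply: (osc_mean_square bO hK m2 h0 hs sc s1 supp hv hN C00 hC).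
  move=> t /andP[t1 t2].
  apply: cos_half_period => //; apply/andP; split.
    by apply: le_trans t1; rewrite /cc; move: bl hb; clear - bO hK; lra.
  by apply: (le_trans t2); rewrite /cc; move: bu hb; clear - bO hK; lra.
have bd t : exists C, forall v, `|W * osc O a h L m (t + b) v| <= C.
  have [C hC'] := osc_bound bO hK a h L m2 (t + b); exists (W * C) => v.
  by rewrite normrM (ger0_norm W0) ler_wpM2l.
have mf : measurable_fun setT (fun z : T * T => W * osc O a h L m (z.1 + b) z.2 : T).
  apply: measurable_funM => //.
  apply: (measurableT_comp (measurable_osc_pair a h L m) (f := fun z => osc O a h L m z.1 z.2)
    (g := fun z : T * T => (z.1 + b, z.2))).
  apply/measurable_fun_pairP; split; last exact: measurable_snd.
  by apply: measurable_funD => //; exact: measurable_fst.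
have main := mean_square_Rintegral_le h0 (measurable_itv `[r, (r + 1/2)%R]) mf bd oscB.
apply: (@le_trans _ _ (\int[mu]_(t in `[r, (r + 1/2)%R])
    ((\int[mu]_(v in `[0%R, h[) (W * osc O a h L m (t + b) v)) ^+ 2)%:E)%E).
  apply: ge0_le_integral_any => t; rewrite /= in_itv/= => /andP[t1 t2]; first by rewrite lee_fin sqr_ge0.
  have t0 : 0 < t + b by move: t1 bl hb r0; clear - bO hK; lra.
  have tr : t + b <= 3 * r / 2 by move: t2 bu hb; clear - bO hK; lra.
  rewrite lee_fin /smooth_error (error_integral bO hK h0 m2 t0 (a := a) (L := L)); last first.
    by move=> p u kp pu; have [g1 g2] := supp _ _ kp pu; move: g1 g2 h0; clear - bO hK; move=> *; apply/andP; split; lra.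
  have [C hC'] := osc_bound bO hK a h L m2 (t + b).
  rewrite RintegralZl//; last first.
    apply: (bounded_integrable h _ hC').
    exact: (measurableT_comp (measurable_osc_pair a h L m) (measurable_pair1 (t + b))).
  rewrite [leLHS]exprMn [leRHS]exprMn; apply: ler_wpM2r; first exact: sqr_ge0.
  apply: lerXn2r; rewrite ?nnegrE ?sqr_ge0//.
  rewrite /W (_ : 9 / 4 * r ^+ 2 = (3 * r / 2) ^+ 2); last by field.
  by apply: lerXn2r => //; rewrite nnegrE ltW// (lt_le_trans t0).
apply: (le_trans main); rewrite lee_fin.
have lnN : ln N.+1%:R <= ln C1 + ln r.
  rewrite -lnM ?posrE//; last by lra.
  by rewrite ler_ln ?posrE ?mulr_gt0//; lra.
have hh : h = 2^-1 / r by rewrite /h invfM.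
have key : h * (1 + ln N.+1%:R) + h ^+ 2 * N.+1%:R <= C2 * ln r / r.
  apply: (@le_trans _ _ (h * (1 + (ln C1 + ln r)) + h ^+ 2 * (C1 * r))).
    by apply: lerD; [apply: ler_wpM2l; [exact: ltW|lra] | apply: ler_wpM2l; [exact: sqr_ge0|]].
  have -> : h * (1 + (ln C1 + ln r)) + h ^+ 2 * (C1 * r) = ((1 + (ln C1 + ln r)) / 2 + C1 / 4) / r.
    by rewrite hh; field; rewrite gt_eqF.
  apply: ler_wpM2r; first by rewrite invr_ge0 ltW.
  by rewrite /C2; nra.
have -> : h * (h * (W ^+ 2 * B)) = (9/4) ^+ 2 / 4 * r ^+ 2 * B.
  by rewrite /W hh; field; rewrite gt_eqF.
have -> : (9/4) ^+ 2 / 4 * (Cs * C2) * (r * ln r) = (9/4) ^+ 2 / 4 * r ^+ 2 * (Cs * (C2 * ln r / r)).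
  by field; rewrite gt_eqF.
apply: ler_wpM2l; first by rewrite mulr_ge0 ?sqr_ge0 ?divr_ge0 ?sqr_ge0.
by rewrite /B ler_wpM2l.
Qed.

End ErrorMeanSquare.

(** * Pointwise comparison of the error with the smoothed error *)

Section PointwiseError.
Context {R : realType}.
Local Notation mu := (@lebesgue_measure R).
Local Notation mu2 := (mu \x mu)%E.
Local Notation T := (measurableTypeR R).
Variables (O : set (R * R)) (c M : R).
Hypothesis bO : body O c M.

Lemma integral_kern2_dil (m : nat) (t : R) : (1 < m)%N -> 0 < t ->
  (\int[mu2]_(z in dil t O) (kern2 m z)%:E)%E = (smooth_error O m t + t ^+ 2 * area2 O)%:E.
Proof.
move=> m2 t0; rewrite /smooth_error subrK /Rintegral fineK//.
apply: integrable_fin_num; first exact: measurable_dil_body bO _.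
apply: (integrable_dil bO t0 (@measurable_kern2 R m)
  (C := \sum_p \sum_q `|kcoef m (zidx (m:=m) p) * kcoef m (zidx (m:=m) q)|)) => z.
rewrite kern2_fourier//; apply: (le_trans (ler_norm_sum _ _ _)); apply: ler_sum => p _.
apply: (le_trans (ler_norm_sum _ _ _)); apply: ler_sum => q _.
rewrite normrM -[leRHS]mulr1 ler_wpM2l// ler_norml cos_geN1 cos_le1//.
Qed.

(** Arithmetic only: [N], [Nm], [Np] stand for the counts at [t], [t - B], [t + B], and [S1], [S2]
    for the smoothed errors at [t + b] and [t - b]. The boundary layers [N - Nm] and [Np - N] are
    bounded linearly in [t], so [tau] multiplies [t] and not [t^2]. *)
Lemma error_sandwich (A B N Nm Np S1 S2 t b tau : R) :
  0 <= A -> 0 <= B <= t -> 0 <= b <= t -> 0 <= tau ->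
  N - tau * (N - Nm) <= S1 + (t + b) ^+ 2 * A ->
  S2 + (t - b) ^+ 2 * A <= N + tau * (Np - N) ->
  N <= (t + B) ^+ 2 * A -> (t - B) ^+ 2 * A <= N ->
  (t - B - B) ^+ 2 * A <= Nm -> Np <= (t + B + B) ^+ 2 * A ->
  `|N - t ^+ 2 * A| <= `|S1| + `|S2| + 3 * A * (t * b) + 9 * A * B * (tau * t).
Proof.
move=> A0 /andP[B0 Bt] /andP[b0 bt] ta0 up lo N1 N2 N3 N4.
have AB0 : 0 <= A * B by exact: mulr_ge0.
have d1 : N - Nm <= 9 * A * B * t by nra.
have d2 : Np - N <= 9 * A * B * t by nra.
have e1 := ler_wpM2l ta0 d1; have e2 := ler_wpM2l ta0 d2.
have bb : A * b ^+ 2 <= A * (t * b) by rewrite ler_wpM2l// expr2 ler_wpM2r.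
have g1 := ler_norm S1; have g2 := ler_norm (- S2); rewrite normrN in g2.
have g3 := normr_ge0 S1; have g4 := normr_ge0 S2.
rewrite ler_norml; apply/andP; split; nra.
Qed.

(** With [m] near [r] and [q] near the root of [r], the displacement [b] of order [1/q] costs an
    area of order [t b], about the root of [r], and the tail [tau] of order [1/r] costs a bounded
    amount. As [b] depends on [r] alone, one shift serves the whole interval in the mean square
    bound. *)
Lemma error_pointwise : exists r0 C : R, [/\ 2 <= r0, 0 <= C &
  forall r : R, r0 <= r -> exists b, [/\ 0 <= b, b <= c^-1 &
    forall t, r <= t <= r + 1/2 ->
    `|Eerr O t| <= `|smooth_error O (Num.truncn r).+1 (t + b)| +
      `|smooth_error O (Num.truncn r).+1 (t - b)| + C * Num.sqrt r]].
Proof.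
have c0 := body_c_gt0 bO; have A0 := area2_ge0 O.
set B := c^-1; have B0 : 0 < B by rewrite invr_gt0.
(* 600 exceeds [3 + 9 * 64], the total from [f1] and [f2] below; the 16 makes the root of [r] at
   least 4, which yields [2 * q <= m]. *)
exists (16 + 2 * B), (600 * (area2 O * B)); split; first by lra.
  exact: mulr_ge0 (ler0n _ _) (mulr_ge0 A0 (ltW B0)).
move=> r hr.
have r0 : 0 < r by lra.
set s := Num.sqrt r.
have ss : s ^+ 2 = r by rewrite sqr_sqrtr// ltW.
have s0 : 0 <= s by exact: sqrtr_ge0.
have s4 : 4 <= s.
  by rewrite -(@ler_pXn2r _ 2)// ?nnegrE// ss; lra.
pose q := (Num.truncn s).+1; pose m := (Num.truncn r).+1.
have qs : s < q%:R by exact: truncnS_gt.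
have mr : r < m%:R by exact: truncnS_gt.
have qs1 : q%:R <= s + 1 by rewrite -natr1 lerD2r truncn_le.
have m2 : (1 < m)%N by rewrite ltnS truncn_gt0; lra.
have q0 : (0 < q)%N by [].
have qm : (2 * q <= m)%N.
  by rewrite -(ler_nat R) natrM; apply: ltW; apply: le_lt_trans mr; nra.
pose a : R := (2 * q%:R)^-1.
have a0 : 0 <= a by rewrite invr_ge0 mulr_ge0.
have a1 : a <= 1/2.
  by rewrite /a invfM mul1r ler_piMr// invf_le1// ler1n.
have as1 : a * s <= 1/2.
  rewrite /a invfM -mulrA mul1r ler_piMr// mulrC ler_pdivrMr// mul1r; exact: ltW.
pose tau : R := 8 * q%:R ^+ 2 / m%:R ^+ 2.
have tau0 : 0 <= tau by rewrite divr_ge0// ?mulr_ge0 ?sqr_ge0.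
have taur : tau * r <= 32.
  rewrite /tau mulrAC ler_pdivrMr ?exprn_gt0//.
  have h1 : q%:R ^+ 2 <= 4 * r by rewrite -ss; nra.
  have h2 : r ^+ 2 <= m%:R ^+ 2 by rewrite lerXn2r ?nnegrE// ltW.
  have h3 := ler_wpM2r (ltW r0) h1.
  by lra.
have aB : a / c = a * B by [].
exists (a * B); split.
- by rewrite mulr_ge0// ltW.
- by rewrite ler_piMl ?(ltW B0)//; lra.
move=> t /andP[t1 t2].
have Bt : B < t - B by lra.
have Bt' : B < t by lra.
have b0 : 0 <= a * B by rewrite mulr_ge0// ltW.
have bB : a * B <= B by rewrite ler_piMl ?(ltW B0)//; lra.
have up := @sandwich_upper R O c M bO (kern2 m) a tau (@measurable_kern2 R m) (kern2_ge0 m2) a0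
  (integral_kern2_square m2) (integral_kern2_near m2 q0 qm) t Bt'.
have lo := @sandwich_lower R O c M bO (kern2 m) a tau (@measurable_kern2 R m) (kern2_ge0 m2) a0
  (integral_kern2_square m2) (integral_kern2_far m2 q0 qm) t Bt' a1.
rewrite aB integral_kern2_dil// ?lee_fin in up; last by lra.
rewrite aB integral_kern2_dil// ?lee_fin in lo; last by lra.
have BtB : B < t + B by lra.
apply: (le_trans (error_sandwich (B := B) (b := a * B) A0 _ _ tau0 up lo (lat_size_upper bO Bt') (lat_size_lower bO Bt')
  (lat_size_lower bO Bt) (lat_size_upper bO BtB))).
- by apply/andP; split; lra.
- by apply/andP; split; lra.
rewrite -addrA lerD2l.
have tr : t <= 2 * r by lra.
have AB0 : 0 <= area2 O * B by rewrite mulr_ge0// ltW.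
have f1 : t * (a * B) <= B * s.
  have : t * a <= s.
    apply: (@le_trans _ _ (2 * r * a)); first by rewrite ler_wpM2r.
    rewrite -ss; nra.
  by move=> h; rewrite mulrA mulrC ler_wpM2l// ltW.
have f2 : tau * t <= 64 * s.
  apply: (@le_trans _ _ (tau * (2 * r))); first by rewrite ler_wpM2l.
  by lra.
have g1 := ler_wpM2l A0 f1; have g2 := ler_wpM2l AB0 f2.
have ABs : 0 <= area2 O * B * s by rewrite mulr_ge0.
by lra.
Qed.

End PointwiseError.

Section MeanSquareError.
Context {R : realType}.
Local Notation mu := (@lebesgue_measure R).
Local Notation mu2 := (mu \x mu)%E.
Local Notation T := (measurableTypeR R).

(** The count and the smoothed integral are known to be monotone for positive [t]; replacing the
    other values by 0 gives a monotone function on the whole line. *)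
Lemma nondecreasing_pos_measurable (f : T -> R) (D : set T) : measurable D ->
  (forall t, D t -> 0 < t) -> (forall t, 0 < t -> 0 <= f t) ->
  (forall s t, 0 < s -> s <= t -> f s <= f t) -> measurable_fun D f.
Proof.
move=> mD D0 f0 fm; pose g (t : T) := if 0 < t then f t else 0.
apply: (@eq_measurable_fun _ _ _ _ _ g).
  by move=> t /set_mem /D0 t0; rewrite /g t0.
apply: nondecreasing_measurable => // s t st; rewrite /g.
case: ifPn => s0; first by rewrite (lt_le_trans s0 st) fm.
by case: ifPn => // t0; exact: f0.
Qed.

Lemma measurable_shift_comp (f : T -> R) (x y b : R) :
  measurable_fun `[(x + b)%R, (y + b)%R] f -> measurable_fun `[x, y] (fun t : T => f (t + b)).
Proof.
move=> mf; apply: (@measurable_comp _ _ _ T T _ `[(x + b)%R, (y + b)%R] f _ (fun t : T => t + b)) => //.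
  by move=> _ [t + <-]; rewrite /= !in_itv/= !lerD2r.
by apply: measurable_funD => //.
Qed.

Lemma normr_sqr (x : R) : `|x| ^+ 2 = x ^+ 2.
Proof. by rewrite real_normK// num_real. Qed.

Variables (O : set (R * R)) (c M K : R).
Hypothesis bO : body O c M.

Lemma measurable_Eerr (D : set T) : measurable D -> (forall t, D t -> 0 < t) ->
  measurable_fun D (Eerr O : T -> R).
Proof.
move=> mD D0; apply: measurable_funB.
  apply: nondecreasing_pos_measurable => // s t s0 st; rewrite !Ncount_size ler_nat.
  exact: (size_lat_mono bO).
by apply: measurable_funM => //; exact: measurable_funX.
Qed.

Lemma measurable_smooth_error (m : nat) (D : set T) : (1 < m)%N -> measurable D ->
  (forall t, D t -> 0 < t) -> measurable_fun D (smooth_error O m : T -> R).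
Proof.
move=> m2 mD D0; apply: measurable_funB; last by apply: measurable_funM => //; exact: measurable_funX.
have E t : 0 < t -> (\int[mu2]_(z in dil t O) (kern2 m z)%:E)%E =
    (\int[mu2]_(z in dil t O) kern2 m z)%:E.
  by move=> t0; rewrite (integral_kern2_dil bO)// /smooth_error subrK.
apply: nondecreasing_pos_measurable => // [t t0|s t s0 st].
  by rewrite -lee_fin -E// integral_ge0// => z _; rewrite lee_fin kern2_ge0.
have t0 := lt_le_trans s0 st.
rewrite -lee_fin -!E//; apply: ge0_subset_integral.
- exact: measurable_dil_body bO _.
- exact: measurable_dil_body bO _.
- by apply/measurable_EFinP; apply: measurable_funTS; exact: measurable_kern2.
- by move=> z _; rewrite lee_fin kern2_ge0.
- by move=> z; exact: (dil_mono bO s0 st).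
Qed.

Hypothesis hK : cap_bound O K.

Lemma half_unit_large : exists r0 C : R, [/\ 2 <= r0, 0 <= C &
  forall r, r0 <= r ->
  (\int[mu]_(t in `[r, (r + 1/2)%R]) ((Eerr O t) ^+ 2)%:E <= (C * (r * ln r))%:E)%E].
Proof.
have [r1 [C1 [r12 C10 h1]]] := smooth_error_mean_square bO hK.
have [r2 [C2 [r22 C20 h2]]] := error_pointwise bO.
have c0 := body_c_gt0 bO.
have B0 : 0 < c^-1 by rewrite invr_gt0.
(* [2 * c^-1] gives room for the shifts [b <= c^-1]. Squaring a sum of three terms costs a factor 3,
   for each of the two shifts, hence [6 * C1]. *)
exists (r1 + r2 + 2 * c^-1 + expR 1), (6 * C1 + 2 * C2 ^+ 2).
have e0 : 0 < expR 1 :> R := expR_gt0 1.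
split; first by lra.
  by rewrite addr_ge0// mulr_ge0// sqr_ge0.
move=> r hr; have r2r : r2 <= r by lra.
have [b [b0 bB hb]] := h2 r r2r.
have lnr : 1 <= ln r by rewrite -(expRK 1) ler_ln ?posrE//; lra.
have r0 : 0 < r by lra.
set m := (Num.truncn r).+1 in hb *.
have m2 : (1 < m)%N by rewrite ltnS truncn_gt0; lra.
have ib : (\int[mu]_(t in `[r, (r + 1/2)%R]) ((smooth_error O m (t + b)) ^+ 2)%:E <= (C1 * (r * ln r))%:E)%E.
  by apply: h1; rewrite ?ger0_norm//; lra.
have ib' : (\int[mu]_(t in `[r, (r + 1/2)%R]) ((smooth_error O m (t - b)) ^+ 2)%:E <= (C1 * (r * ln r))%:E)%E.
  by apply: h1; rewrite ?normrN ?ger0_norm//; lra.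
have mI : measurable (`[r, r + 1/2]%classic : set T) by exact: measurable_itv.
have mS e : - r < e -> measurable_fun (`[r, r + 1/2]%classic : set T)
    (fun t => (3 * (smooth_error O m (t + e)) ^+ 2)%:E).
  move=> re; apply/measurable_EFinP; apply: measurable_funM => //; apply: measurable_funX.
  apply: (@measurable_shift_comp (smooth_error O m)); apply: measurable_smooth_error => // t.
  by rewrite /= in_itv/= => /andP[h _]; lra.
have i3 e : - r < e -> (\int[mu]_(t in `[r, (r + 1/2)%R]) ((smooth_error O m (t + e)) ^+ 2)%:E <= (C1 * (r * ln r))%:E)%E ->
    (\int[mu]_(t in `[r, (r + 1/2)%R]) (3 * (smooth_error O m (t + e)) ^+ 2)%:E <= (3 * (C1 * (r * ln r)))%:E)%E.
  move=> re h; under eq_integral do rewrite EFinM.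
  rewrite ge0_integralZl//.
  - by rewrite [leRHS]EFinM; apply: lee_wpmul2l.
  - apply/measurable_EFinP; apply: measurable_funX.
    apply: (@measurable_shift_comp (smooth_error O m)); apply: measurable_smooth_error => // t.
    by rewrite /= in_itv/= => /andP[h' _]; lra.
  - by move=> t _; rewrite lee_fin sqr_ge0.
have k0 : 0 <= 3 * (C2 ^+ 2 * r) by rewrite !mulr_ge0 ?sqr_ge0// ltW.
apply: (@le_trans _ _ (\int[mu]_(t in `[r, (r + 1/2)%R]) ((3 * (smooth_error O m (t + b)) ^+ 2)%:E +
   (3 * (smooth_error O m (t - b)) ^+ 2)%:E + (3 * (C2 ^+ 2 * r))%:E))%E).
  apply: ge0_le_integral_any => t; first by rewrite lee_fin sqr_ge0.
  rewrite /= in_itv/= => /hb h; rewrite -!EFinD lee_fin.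
  have ss : (Num.sqrt r) ^+ 2 = r by rewrite sqr_sqrtr// ltW.
  rewrite -[X in C2 ^+ 2 * X]ss -[leLHS]normr_sqr -(normr_sqr (smooth_error O m (t + b))) -(normr_sqr (smooth_error O m (t - b))).
  move: h; set X := `|Eerr O t|; set Y := `|smooth_error _ _ _|; set Z := `|smooth_error _ _ _|.
  set W := Num.sqrt r => h.
  have X0 : 0 <= X by exact: normr_ge0.
  apply: (@le_trans _ _ ((Y + Z + C2 * W) ^+ 2)); first by rewrite lerXn2r ?nnegrE// (le_trans X0).
  have := sqr_ge0 (Y - Z); have := sqr_ge0 (Y - C2 * W); have := sqr_ge0 (Z - C2 * W).
  by rewrite !expr2; lra.
have sq e t : (0 <= (3 * (smooth_error O m (t + e)) ^+ 2)%:E)%E by rewrite lee_fin mulr_ge0// sqr_ge0.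
rewrite ge0_integralD//; last 2 first.
- by move=> t _; rewrite adde_ge0//; exact: sq.
- by apply: emeasurable_funD; apply: mS; lra.
have re1 : - r < b by lra.
have re2 : - r < - b by lra.
rewrite (@ge0_integralD _ _ _ _ _ mI _ _ (fun t _ => sq b t) (mS _ re1) (fun t _ => sq (- b) t) (mS _ re2)).
have j1 := i3 _ re1 ib; have j2 := i3 _ re2 ib'.
apply: (@le_trans _ _ ((3 * (C1 * (r * ln r)))%:E + (3 * (C1 * (r * ln r)))%:E + (2 * C2 ^+ 2 * r)%:E)%E).
  apply: leeD; first exact: leeD.
  rewrite integral_cst//= lebesgue_measure_itv/= lte_fin ltrDl divr_gt0// -EFinB -EFinM lee_fin.
  by have : 0 <= C2 ^+ 2 * r by [rewrite mulr_ge0 ?sqr_ge0// ltW|]; lra.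
rewrite -!EFinD lee_fin.
have : C2 ^+ 2 * r <= C2 ^+ 2 * (r * ln r) by rewrite ler_wpM2l ?sqr_ge0// ler_peMr// ltW.
by lra.
Qed.

(** For [r] below [r0] the error is at most [Q], since both count and area grow with [t];
    [ln r >= ln 2] lets this constant be absorbed. *)
Lemma half_unit_mean_square : exists2 C : R, 0 <= C & forall r, 2 <= r ->
  (\int[mu]_(t in `[r, (r + 1/2)%R]) ((Eerr O t) ^+ 2)%:E <= (C * (r * ln r))%:E)%E.
Proof.
have [r0 [C [r02 C0 h]]] := half_unit_large.
pose Q : R := (size (lat O (r0 + 1)))%:R + (r0 + 1) ^+ 2 * area2 O.
have A0 := area2_ge0 O.
have l2 : 0 < ln 2 :> R by rewrite ln_gt0// ltr1n.
have Q0 : 0 <= Q by rewrite addr_ge0// mulr_ge0// sqr_ge0.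
exists (C + Q ^+ 2 / ln 2); first by rewrite addr_ge0// divr_ge0 ?sqr_ge0// ltW.
move=> r r2; have l2r : ln 2 <= ln r by rewrite ler_ln ?posrE//; lra.
have rl0 : 0 <= r * ln r by rewrite mulr_ge0//; lra.
have ql0 : 0 <= Q ^+ 2 / ln 2 by rewrite divr_ge0 ?sqr_ge0// ltW.
have [rr|rr] := leP r0 r.
  by apply: (le_trans (h _ rr)); rewrite lee_fin ler_wpM2r// lerDl.
apply: (@le_trans _ _ (\int[mu]_(t in `[r, (r + 1/2)%R]) (Q ^+ 2)%:E)%E).
  apply: ge0_le_integral_any => t; first by rewrite lee_fin sqr_ge0.
  rewrite /= in_itv/= => /andP[t1 t2]; rewrite lee_fin -[leLHS]normr_sqr lerXn2r ?nnegrE//.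
  apply: (le_trans (ler_normB _ _)); rewrite Ncount_size ger0_norm// (@ger0_norm _ (_ * _)); last first.
    by rewrite mulr_ge0// sqr_ge0.
  apply: lerD; first by rewrite ler_nat (size_lat_mono bO)//; lra.
  by rewrite ler_wpM2r// lerXn2r ?nnegrE//; lra.
rewrite integral_cst//= lebesgue_measure_itv/= lte_fin ltrDl divr_gt0// -EFinB -EFinM lee_fin.
apply: (@le_trans _ _ (Q ^+ 2 / ln 2 * (r * ln r))); last by rewrite ler_wpM2r// lerDr.
rewrite -[leRHS]mulrA ler_wpM2l ?sqr_ge0// mulrC mulrA -[leLHS]mulr1.
have : 1 <= ln r / ln 2 by rewrite ler_pdivlMr// mul1r.
by nra.
Qed.

Lemma mean_square_error : exists2 C : R, 0 <= C & forall r h, 2 <= r -> 1 <= h <= r ->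
  (\int[mu]_(t in `[r, (r + h)%R]) ((Eerr O t) ^+ 2)%:E <= (C * (h * (r * ln r)))%:E)%E.
Proof.
(* At most [3 * h] pieces are used, each starting no later than [2 * r], and
   [ln (2 * r) <= 2 * ln r] for [r >= 2]; so 12 is 3 times 4. *)
have [C C0 hC] := half_unit_mean_square; exists (12 * C); first by rewrite mulr_ge0.
move=> r h r2 /andP[h1 hr].
have l2 : 0 < ln 2 :> R by rewrite ln_gt0// ltr1n.
have l2r : ln 2 <= ln r by rewrite ler_ln ?posrE//; lra.
have r0 : 0 < r by lra.
pose n := (Num.truncn (2 * h)).+1.
have n1 : n%:R <= 3 * h.
  apply: (@le_trans _ _ (2 * h + 1)); last by lra.
  by rewrite /n -natr1 lerD2r truncn_le//; lra.
pose J (i : nat) : set T := `[r + i%:R * (1/2), r + i%:R * (1/2) + 1/2]%classic.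
pose f (t : T) := ((Eerr O t) ^+ 2)%:E.
have mf (i : nat) : measurable_fun setT (f \_ (J i)).
  apply/(measurable_restrictT _ _).1; first exact: measurable_itv.
  apply/measurable_EFinP; apply: measurable_funX; apply: measurable_Eerr; first exact: measurable_itv.
  move=> t; rewrite /J /= in_itv/= => /andP[t1 _]; apply: (lt_le_trans r0); apply: le_trans t1.
  by rewrite lerDl mulr_ge0.
have f0 (i : nat) t : (0 <= (f \_ (J i)) t)%E by rewrite patchE; case: ifP => // _; rewrite lee_fin sqr_ge0.
apply: (@le_trans _ _ (\int[mu]_t (\sum_(i < n) (f \_ (J i)) t))%E).
  rewrite integral_mkcond; apply: ge0_le_integral_any => t _.
    by rewrite patchE; case: ifP => // _; rewrite lee_fin sqr_ge0.
  rewrite patchE; case: ifPn => [|_]; last by rewrite sume_ge0.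
  rewrite mem_setE in_itv/= => /andP[t1 t2].
  have k0 : 0 <= 2 * (t - r) by lra.
  have kn : (Num.truncn (2 * (t - r)) < n)%N by rewrite ltnS; apply: le_truncn; lra.
  rewrite (bigD1 (Ordinal kn))//=; apply: (@le_trans _ _ ((f \_ (J (Num.truncn (2 * (t - r))))) t)); last first.
    by rewrite leeDl// sume_ge0.
  rewrite patchE mem_set// /J /= in_itv/=.
  have /andP := truncn_itv k0; rewrite -(natr1 (Num.truncn _)); move: (Num.truncn _)%:R => j [g1 g2].
  by apply/andP; split; lra.
rewrite ge0_integral_sum//.
apply: (@le_trans _ _ (\sum_(i < n) (C * (4 * (r * ln r)))%:E)%E).
  apply: lee_sum => i _; rewrite -integral_mkcond.
  have i0 : 0 <= i%:R :> R by [].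
  apply: (le_trans (hC (r + i%:R * (1/2)) _)); first by lra.
  have ih : i%:R <= 2 * h.
    apply: (@le_trans _ _ (Num.truncn (2 * h))%:R); first by rewrite ler_nat -ltnS.
    by rewrite truncn_le//; lra.
  rewrite lee_fin ler_wpM2l// (_ : 4 * (r * ln r) = (2 * r) * (2 * ln r)); last by ring.
  rewrite ler_pM//; [lra|rewrite ln_ge0//; lra|lra|].
  apply: (@le_trans _ _ (ln (2 * r))); first by rewrite ler_ln ?posrE//; lra.
  by rewrite lnM ?posrE//; lra.
rewrite sumEFin lee_fin sumr_const card_ord -mulr_natr.
have rl : 0 <= C * (r * ln r) by rewrite !mulr_ge0//; lra.
have := ler_wpM2l rl n1; lra.
Qed.

Lemma Gmean_le : exists C : R, forall r h, 2 <= r -> 1 <= h <= r ->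
  Gmean O r h <= C * Num.sqrt (r * ln r).
Proof.
have [C C0 hC] := mean_square_error; exists (Num.sqrt C) => r h r2 h1r.
have /andP[h1 _] := h1r; have h0 : 0 < h by lra.
rewrite -sqrtrM// /Gmean; apply: ler_wsqrtr; rewrite ler_pdivrMl// mulrCA.
have := hC r h r2 h1r; rewrite /Rintegral.
under [in X in _ -> X]eq_integral do rewrite normr_sqr.
have : (0 <= \int[mu]_(t in `[r, (r + h)%R]) ((Eerr O t) ^+ 2)%:E)%E.
  by apply: integral_ge0 => t _; rewrite lee_fin sqr_ge0.
(* The bound excludes the value plus infinity, and nonnegativity excludes minus infinity, so [fine]
   returns the integral itself. *)
by case: (\int[mu]_(t in _) _)%E => [x| |]//=; rewrite !lee_fin.
Qed.

End MeanSquareError.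

(** * From the stated hypotheses to [body] and [cap_bound] *)

Section Caps.
Context {R : realType}.
Variables (O : set (R * R)).

Lemma adherent2_closure P : adherent2 O P -> closure O P.
Proof.
move=> aP B /nbhs_ballP[e /= e0 eB]; have [x [Ox h1 h2]] := aP e e0.
by exists x; split=> //; apply: eB; split.
Qed.

Lemma closure_le (M : R) P : (forall x, O x -> `|x.1| <= M /\ `|x.2| <= M) ->
  closure O P -> `|P.1| <= M + 1 /\ `|P.2| <= M + 1.
Proof.
move=> OM /(_ (ball P 1)) []; first exact: nbhsx_ballx.
move=> x [/OM[m1 m2] [h1 h2]]; rewrite /ball/= in h1 h2.
have t1 := ler_normD (P.1 - x.1) x.1; have t2 := ler_normD (P.2 - x.2) x.2.
by rewrite !subrK in t1 t2; split; lra.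
Qed.

Lemma body_of_bounded : open O -> convex2 O -> bounded2 O -> interior O (0, 0) ->
  exists c M, body O c M.
Proof.
move=> oO cO [M OM] /interior_subset O0.
have [e e0 h] := (open2P O).1 oO _ O0.
exists (e / 2), M; split=> //; first by rewrite divr_gt0.
by move=> x h1 h2; apply: h; rewrite /= sub0r normrN; lra.
Qed.

(** Normalising [k] to [th = k / |k|] scales the depth to [d = (rho_star O k - u) / |k|]; then [P]
    and [Q] both lie in [Ccap O th d], whose diameter is [mu_cap]. The maximum with 0 supplies the
    sign that [cap_bound] requires. *)
Lemma cap_bound_of_mu (c M K : R) : body O c M ->
  (forall th : R * R, on_S1 th -> forall d : R, 0 < d -> (Num.sqrt d)^-1 * mu_cap O th d <= K) ->
  cap_bound O (Num.max K 0).
Proof.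
move=> bO hK; have [_ _ _ OM _] := bO; split; first by rewrite le_max lexx orbT.
move=> k u P Q k0 uk nP nQ aP aQ Pu Qu.
have n0 : 0 < nrm2 k.
  rewrite /nrm2 sqrtr_gt0 lt_def addr_ge0 ?sqr_ge0// andbT paddr_eq0 ?sqr_ge0// !sqrf_eq0.
  apply/negP => /andP[/eqP k1 /eqP k2]; move/eqP: k0; apply.
  by rewrite (surjective_pairing k) k1 k2.
set n := nrm2 k in n0 *; set d := (rho_star O k - u) / n.
have d0 : 0 < d by rewrite divr_gt0// subr_gt0.
pose th : R * R := (n^-1 * k.1, n^-1 * k.2).
have n2 : n ^+ 2 = k.1 ^+ 2 + k.2 ^+ 2 by rewrite sqr_sqrtr// addr_ge0 ?sqr_ge0.
have thS : on_S1 th.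
  by rewrite /on_S1 /th /= !exprMn -mulrDr -n2 exprVn mulVf// sqrf_eq0 gt_eqF.
have rth : rho_star O th = n^-1 * rho_star O k by apply: (rhoZ bO); rewrite invr_gt0.
have cap X : ~ O X -> adherent2 O X -> dot2 X k = u -> Ccap O th d X.
  move=> nX aX Xu; split.
    by split; [exact: adherent2_closure | move/interior_subset].
  have -> : dot2 X th = n^-1 * dot2 X k by rewrite /dot2 /th /=; ring.
  by rewrite Xu rth /d; field; rewrite gt_eqF.
have mu_le : mu_cap O th d <= Num.max K 0 * Num.sqrt d.
  have s0 : 0 < Num.sqrt d by rewrite sqrtr_gt0.
  have := hK th thS d d0; rewrite mulrC ler_pdivrMr// => h; apply: (le_trans h).
  by rewrite ler_wpM2r ?(ltW s0)// le_max lexx.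
apply: le_trans mu_le; rewrite /mu_cap /diam2; case: pselect => [C0|Cn0].
  by exfalso; have := cap P nP aP Pu; rewrite C0.
apply: sup_ubound; last by exists P; [exact: cap | exists Q; [exact: cap|]].
(* [sup] dominates the distances only once they are known to be bounded above; the bound comes from
   the boundedness of the closure. *)
exists (Num.sqrt ((2 * (M + 1)) ^+ 2 + (2 * (M + 1)) ^+ 2)) => _ [x [[cx _] _] [y [[cy _] _] <-]].
have [x1 x2] := closure_le OM cx; have [y1 y2] := closure_le OM cy.
rewrite /dist2; apply: ler_wsqrtr; apply: lerD; rewrite -(normr_sqr (_ - _));
  rewrite lerXn2r ?nnegrE//; first [by apply: (le_trans (ler_normB _ _)); lra | by have := normr_ge0 x.1; lra].
Qed.

End Caps.

Unset Implicit Arguments.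
Set Strict Implicit.

Theorem theorem1p3 (R : realType) (O : set (R * R)) :
  open O -> convex2 O -> bounded2 O -> interior O (0, 0) ->
  (exists K : R, forall th : R * R, on_S1 th -> forall d : R, 0 < d ->
      (Num.sqrt d)^-1 * mu_cap O th d <= K) ->
  exists C : R, forall Rr h : R, 2 <= Rr -> 1 <= h <= Rr ->
    Gmean O Rr h <= C * Num.sqrt (Rr * ln Rr).
Proof.
move=> oO cO bdO O0 [K hK]; have [c [M bO]] := body_of_bounded oO cO bdO O0.
exact: (Gmean_le bO (cap_bound_of_mu bO hK)).
Qed.
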